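(* Assume an SSNC algorithm that is $\alpha_{ss}$-approximate with congestion $\beta_{ss}\ge1$. Let $\widehat{\mathcal T}$ be a collection of internal and external clusters with total cost $\sum_{T\in\widehat{\mathcal T}}\sum_{v\in T}c_v\le O(\alpha_{ss}\log n)\,c(\mathsf{Opt})$, each vertex in $O(\log n)$ clusters, at least $k/4$ request pairs having both terminals in clusters of $\widehat{\mathcal T}$, and each terminal assigned to at most one cluster. Let $H=\bigcup_{i\in\mathcal M}U_i$ be obtained by hallucination: each pair is independently put in $\mathcal M$ with probability $C\log n/q$ (with $C$ a large enough constant), the linear program $\min\sum_vc_vx_v$ s.t. $\sum_{P\in\mathcal P_i}f(P)\ge q$ ($i\in\mathcal M$), $\sum_{P\ni v}f(P)\le qx_v$ ($v\in V$), $f\ge0$, $0\le x_v\le C'\log n$ is solved, and for each $i\in\mathcal M$ a path $U_i$ is chosen with probability proportional to $f(P)$. Let $\widehat F=\big(\bigcup_{T\in\widehat{\mathcal T}}T\big)\cup H$. Then the expected cost of $\widehat F$ is $O(\alpha_{ss}\log n)\cdot c(\mathsf{Opt})$, and one can efficiently find a set of $\Omega(k)$ request pairs that, with high probability, can be simultaneously routed (one unit each) in $\widehat F$ with total flow through every vertex at most $O(\beta_{ss}^2\log^3 n)\cdot q$.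
   Context: MCNC: an undirected graph $G=(V,E)$, $|V|=n$, with $k$ request pairs $(s_i,t_i)$ ($k$ polynomial in $n$), each vertex having cost $c_v\ge0$ and capacity $q$; every vertex belongs to at most one pair. A feasible solution is $V'\subseteq V$ such that $G[V']$ concurrently routes one unit between each $s_i,t_i$ with at most $q$ units through each vertex; $\mathsf{Opt}$ is a minimum-cost feasible solution. $\mathcal P_i$ is the set of $s_i$–$t_i$ paths. Terminals are the $s_i,t_i$; mates are the partners in a pair. SSNC is the single-sink version; an $\alpha$-approximate algorithm with congestion $\beta$ outputs a vertex set of cost at most $\alpha$ times optimum with an unsplittable routing of load at most $\beta q$ per vertex. A cluster is a tree $T$ in $G$ with a set of assigned terminals (vertices of $T$), $\mathrm{load}(T)$ their number. For a fixed absolute constant $C''$: an internal cluster has $\mathrm{load}(T)\le C''\beta_{ss}^2\log n\cdot q$ and more than half of its assigned terminals have mates in the same cluster; an external cluster has $\mathrm{load}(T)\le C''\beta_{ss}^2\log n\cdot q$ and at least $q/8$ assigned terminals with mates outside it. ''With high probability'' means with probability $1-1/\mathrm{poly}(n)$.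
   Formalization: The expected-cost bound is proved conditional on the high-probability event that the hallucinated demands fit in Opt with multiplicity C' log n, and unconditionally only if every c_v ≤ n^d c(Opt); for arbitrary costs the unconditional bound is false. An infeasible LP gives empty H. *)

(* Defs.v *)
From HB Require Import structures.
From mathcomp Require Import all_boot all_order all_algebra.
From mathcomp Require Import boolp reals exp.

Set Implicit Arguments.
Unset Strict Implicit.
Unset Printing Implicit Defensive.

Import Order.TTheory GRing.Theory Num.Theory.
Local Open Scope ring_scope.

(** * Paths and fractional routing

    Graphs have vertex set ['I_n].  A simple path is stored as the sequence of
    all its vertices, endpoints included; it has at most [n] of them, so the
    type of candidate paths is finite. *)

Definition gpath (n : nat) : finType := {bseq n of 'I_n}.

Definition paths n (e : rel 'I_n) (u v : 'I_n) : {set gpath n} :=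
  [set P : gpath n | if (P : seq 'I_n) is x :: p
                     then [&& x == u, path e x p, last x p == v & uniq (x :: p)]
                     else false].

Definition induced n (e : rel 'I_n) (W : {set 'I_n}) : rel 'I_n :=
  [rel u v | [&& e u v, u \in W & v \in W]].

(* The relation [e] concurrently routes one (splittable) unit for every pair
   [(s i, t i)], [i \in S], with total flow at most [b v] through [v], for every
   vertex [v \in B].  A path uses capacity at its endpoints too. *)
Definition routable (R : realType) n k (e : rel 'I_n) (s t : 'I_k -> 'I_n)
    (S : {set 'I_k}) (B : {set 'I_n}) (b : R) : Prop :=
  exists f : 'I_k -> gpath n -> R,
    [/\ forall i P, 0 <= f i P,
        forall i, i \in S -> \sum_(P in paths e (s i) (t i)) f i P = 1
      & forall v, v \in B ->
          \sum_(i in S) \sum_(P in paths e (s i) (t i) | v \in (P : seq 'I_n))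
             f i P <= b].

Definition costs (R : realType) n (c : 'I_n -> R) (W : {set 'I_n}) : R :=
  \sum_(v in W) c v.

(** * Multicommodity node-capacitated network design *)

Record mcnc (R : realType) (n k : nat) := Mcnc {
  edge : rel 'I_n;
  src : 'I_k -> 'I_n;
  tgt : 'I_k -> 'I_n;
  cost : 'I_n -> R;
  cap : R }.

(* As the [2 * k] terminals are pairwise distinct, [2 * k <= n]. *)
Definition mcnc_wf (R : realType) n k (I : mcnc R n k) : Prop :=
  [/\ symmetric (edge I) /\ irreflexive (edge I),
      [/\ injective (src I), injective (tgt I) & forall i j, src I i != tgt I j],
      forall v, 0 <= cost I v
    & 0 < cap I].

Definition feasible (R : realType) n k (I : mcnc R n k) (W : {set 'I_n}) : Prop :=
  routable (induced (edge I) W) (src I) (tgt I) setT setT (cap I).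

Definition is_opt (R : realType) n k (I : mcnc R n k) (W : {set 'I_n}) : Prop :=
  feasible I W /\
  forall W', feasible I W' -> costs (cost I) W <= costs (cost I) W'.

(** * Single-sink version

    The sink, which receives all the flow, is not capacitated. *)

Record ssnc (R : realType) (n k : nat) := Ssnc {
  ss_edge : rel 'I_n;
  ss_src : 'I_k -> 'I_n;
  ss_sink : 'I_n;
  ss_cost : 'I_n -> R;
  ss_cap : R }.

Definition ssnc_wf (R : realType) n k (J : ssnc R n k) : Prop :=
  [/\ symmetric (ss_edge J) /\ irreflexive (ss_edge J),
      injective (ss_src J) /\ (forall i, ss_src J i != ss_sink J),
      forall v, 0 <= ss_cost J v
    & 0 < ss_cap J].

Definition ssnc_feasible (R : realType) n k (J : ssnc R n k) (W : {set 'I_n}) :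
    Prop :=
  routable (induced (ss_edge J) W) (ss_src J) (fun=> ss_sink J) setT
    [set~ ss_sink J] (ss_cap J).

Definition ssnc_algorithm (R : realType) :=
  forall n k, ssnc R n k -> {set 'I_n} * ('I_k -> gpath n).

(* The approximation ratio and the congestion may depend on the number of
   vertices. *)
Definition ssnc_approx (R : realType) (A : ssnc_algorithm R)
    (alpha beta : nat -> R) : Prop :=
  forall n k (J : ssnc R n k), ssnc_wf J -> (exists W, ssnc_feasible J W) ->
    let: (W, U) := A n k J in
    [/\ forall W', ssnc_feasible J W' ->
          costs (ss_cost J) W <= alpha n * costs (ss_cost J) W',
        forall i, U i \in paths (induced (ss_edge J) W) (ss_src J i) (ss_sink J)
      & forall v, v != ss_sink J ->
          #|[set i | v \in (U i : seq 'I_n)]|%:R <= beta n * ss_cap J].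

(** * Clusters *)

Record cluster (n : nat) := Cluster {
  cl_verts : {set 'I_n};
  cl_edge : rel 'I_n;
  cl_terms : {set 'I_n} }.

Definition is_tree n (e : rel 'I_n) (W : {set 'I_n}) (te : rel 'I_n) : Prop :=
  [/\ symmetric te /\ (forall u v, te u v -> [&& e u v, u \in W & v \in W]),
      W != set0,
      forall u v, u \in W -> v \in W -> connect te u v
    & forall c : seq 'I_n, (2 < size c)%N -> ~ ucycle te c].

Definition mates (R : realType) n k (I : mcnc R n k) : rel 'I_n :=
  [rel u v | [exists i, ((u == src I i) && (v == tgt I i))
                     || ((u == tgt I i) && (v == src I i))]].

Definition cluster_wf (R : realType) n k (I : mcnc R n k) (T : cluster n) : Prop :=
  [/\ is_tree (edge I) (cl_verts T) (cl_edge T),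
      cl_terms T \subset cl_verts T
    & forall v, v \in cl_terms T -> exists w, mates I v w].

Definition load n (T : cluster n) : nat := #|cl_terms T|.

Definition mated_inside (R : realType) n k (I : mcnc R n k) (T : cluster n) :=
  [set v in cl_terms T | [exists w in cl_terms T, mates I v w]].

Definition internal (R : realType) n k (I : mcnc R n k) (L : R) (T : cluster n) :
    Prop :=
  (load T)%:R <= L /\ (load T < 2 * #|mated_inside I T|)%N.

Definition external (R : realType) n k (I : mcnc R n k) (L : R) (T : cluster n) :
    Prop :=
  (load T)%:R <= L /\ cap I / 8 <= #|cl_terms T :\: mated_inside I T|%:R.

(* [Cii] is the constant in the load bound of a cluster; [a] and [b] are the
   constants hidden in the bounds on the total cost and on the overlap. *)
Definition good_clustering (R : realType) n k (I : mcnc R n k) (alpha beta : R)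
    (Cii a b : R) (Opt : {set 'I_n}) m (T : 'I_m -> cluster n) : Prop :=
  let L := Cii * beta ^+ 2 * ln n%:R * cap I in
  [/\ forall j, cluster_wf I (T j) /\ (internal I L (T j) \/ external I L (T j)),
      \sum_j costs (cost I) (cl_verts (T j))
        <= a * alpha * ln n%:R * costs (cost I) Opt,
      forall v, #|[set j | v \in cl_verts (T j)]|%:R <= b * ln n%:R,
      k%:R / 4 <= #|[set i | [exists j, src I i \in cl_terms (T j)]
                          && [exists j, tgt I i \in cl_terms (T j)]]|%:R :> R
    & forall v j j', v \in cl_terms (T j) -> v \in cl_terms (T j') -> j = j'].

(** * Hallucination *)

Section Hallucination.
Variables (R : realType) (n k : nat) (I : mcnc R n k).

Definition req_paths (i : 'I_k) : {set gpath n} := paths (edge I) (src I i) (tgt I i).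

(* The pairs are vertex-disjoint, so a path belongs to at most one
   [req_paths i] and the flow can be indexed by paths alone. *)
Definition lp_sol := ((gpath n -> R) * ('I_n -> R))%type.

Definition lp_feasible (Ci : R) (M : {set 'I_k}) (y : lp_sol) : Prop :=
  [/\ forall P, 0 <= y.1 P,
      forall i, i \in M -> cap I <= \sum_(P in req_paths i) y.1 P,
      forall v, \sum_(i in M) \sum_(P in req_paths i | v \in (P : seq 'I_n)) y.1 P
                  <= cap I * y.2 v
    & forall v, 0 <= y.2 v <= Ci * ln n%:R].

Definition lp_obj (y : lp_sol) : R := \sum_v cost I v * y.2 v.

(* [sol M] is the outcome of solving the linear program for [M]: an optimal
   solution, or [None] exactly when the program is infeasible. *)
Definition lp_solver (Ci : R) (sol : {set 'I_k} -> option lp_sol) : Prop :=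
  forall M, match sol M with
            | Some y => lp_feasible Ci M y /\
                        (forall y', lp_feasible Ci M y' -> lp_obj y <= lp_obj y')
            | None => forall y, ~ lp_feasible Ci M y
            end.

(* The demands hallucinated for [M] fit in [Opt] when each of its vertices may be
   used up to [Ci * ln n] times.  The program for [M] can be feasible without
   this, but then its optimum is not bounded in terms of the cost of [Opt]. *)
Definition fits_in (Ci : R) (Opt : {set 'I_n}) (M : {set 'I_k}) : Prop :=
  exists2 y, lp_feasible Ci M y & forall v, v \notin Opt -> y.2 v = 0.

(* The hallucinated set [M] and the chosen paths; [U i] is the empty sequence
   when no path is chosen for [i], that is when [i \notin M] or the linear
   program is infeasible. *)
Definition outcome : finType := ({set 'I_k} * {ffun 'I_k -> gpath n})%type.

Definition hal_prob (C : R) : R := Num.min 1 (C * ln n%:R / cap I).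

Definition hal_law (C : R) (M : {set 'I_k}) : R :=
  \prod_i (if i \in M then hal_prob C else 1 - hal_prob C).

Definition path_law (sol : {set 'I_k} -> option lp_sol) (M : {set 'I_k})
    (i : 'I_k) (P : gpath n) : R :=
  match sol M, i \in M with
  | Some y, true => if P \in req_paths i
                    then y.1 P / \sum_(Q in req_paths i) y.1 Q else 0
  | _, _ => ((P : seq 'I_n) == [::])%:R
  end.

Definition law (C : R) (sol : {set 'I_k} -> option lp_sol) (w : outcome) : R :=
  hal_law C w.1 * \prod_i path_law sol w.1 i (w.2 i).

Definition Expect (C : R) (sol : {set 'I_k} -> option lp_sol) (X : outcome -> R) :=
  \sum_w law C sol w * X w.

Definition Prob (C : R) (sol : {set 'I_k} -> option lp_sol) (E : outcome -> Prop) :=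
  \sum_(w | `[< E w >]) law C sol w.

(* The vertices and the edges of the union of the clusters and of the chosen
   paths. *)
Definition Fverts m (T : 'I_m -> cluster n) (w : outcome) : {set 'I_n} :=
  [set v | [exists j, v \in cl_verts (T j)]
        || [exists i in w.1, v \in (w.2 i : seq 'I_n)]].

Definition Fedge m (T : 'I_m -> cluster n) (w : outcome) : rel 'I_n :=
  [rel u v | [exists j, cl_edge (T j) u v]
          || [exists i in w.1, infix [:: u; v] (w.2 i)
                            || infix [:: v; u] (w.2 i)]].

End Hallucination.

(** * A model of efficient computation

    Programs over a memory of natural numbers (addressed by an array name and
    three indices) and a memory of real numbers (addressed by an array name and
    one index).  The arithmetic is restricted to addition and subtraction, and
    there is no rounding from reals to naturals: in [t] steps every number is
    at most exponential in [t] times the input, so that the number of steps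
    is polynomially related to bit complexity when the reals are rational. *)

Inductive nexp :=
  | NConst of nat
  | NGet of nat & nexp & nexp & nexp
  | NAdd of nexp & nexp
  | NSub of nexp & nexp.

Inductive rexp :=
  | RConst of nat
  | RGet of nat & nexp
  | RAdd of rexp & rexp
  | RSub of rexp & rexp.

Inductive test :=
  | NLe of nexp & nexp
  | RLe of rexp & rexp.

Inductive cmd :=
  | Skip
  | NSet of nat & nexp & nexp & nexp & nexp
  | RSet of nat & nexp & rexp
  | Seq of cmd & cmd
  | If of test & cmd & cmd
  | While of test & cmd.

Record state (R : realType) := State {
  nmem : nat -> nat -> nat -> nat -> nat;
  rmem : nat -> nat -> R }.

Section Semantics.
Variable R : realType.
Implicit Types st : state R.

Fixpoint neval st (e : nexp) : nat :=
  match e with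
  | NConst c => c
  | NGet a x y z => nmem st a (neval st x) (neval st y) (neval st z)
  | NAdd e1 e2 => (neval st e1 + neval st e2)%N
  | NSub e1 e2 => (neval st e1 - neval st e2)%N
  end.

Fixpoint reval st (e : rexp) : R :=
  match e with
  | RConst c => c%:R
  | RGet a x => rmem st a (neval st x)
  | RAdd e1 e2 => reval st e1 + reval st e2
  | RSub e1 e2 => reval st e1 - reval st e2
  end.

Definition teval st (b : test) : bool :=
  match b with
  | NLe e1 e2 => (neval st e1 <= neval st e2)%N
  | RLe e1 e2 => reval st e1 <= reval st e2
  end.

Definition nupd st (a x y z c : nat) : state R :=
  State (fun a' x' y' z' =>
           if [&& a' == a, x' == x, y' == y & z' == z] then c
           else nmem st a' x' y' z')
        (rmem st).

Definition rupd st (a x : nat) (r : R) : state R :=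
  State (nmem st)
        (fun a' x' => if (a' == a) && (x' == x) then r else rmem st a' x').

(* [exec c st t st']: from [st], [c] terminates in [st'] after [t] steps. *)
Inductive exec : cmd -> state R -> nat -> state R -> Prop :=
  | ESkip st : exec Skip st 1 st
  | ENSet st a x y z e :
      exec (NSet a x y z e) st 1
        (nupd st a (neval st x) (neval st y) (neval st z) (neval st e))
  | ERSet st a x e :
      exec (RSet a x e) st 1 (rupd st a (neval st x) (reval st e))
  | ESeq c1 c2 st t1 st1 t2 st2 :
      exec c1 st t1 st1 -> exec c2 st1 t2 st2 ->
      exec (Seq c1 c2) st (t1 + t2) st2
  | EIf b c1 c2 st t st' :
      exec (if teval st b then c1 else c2) st t st' ->
      exec (If b c1 c2) st t.+1 st'
  | EWhileF b c st : ~~ teval st b -> exec (While b c) st 1 st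
  | EWhileT b c st t1 st1 t2 st2 :
      teval st b -> exec c st t1 st1 -> exec (While b c) st1 t2 st2 ->
      exec (While b c) st (t1 + t2).+1 st2.

(* The initial memory holding an instance and a family of clusters. *)
Definition input n k (I : mcnc R n k) m (T : 'I_m -> cluster n) : state R :=
  State
    (fun a x y z =>
       match a with
       | 0 => match x with 0 => n | 1 => k | 2 => m | _ => 0 end
       | 1 => [exists u : 'I_n, exists v : 'I_n,
                 [&& x == u :> nat, y == v :> nat & edge I u v]]
       | 2 => (\sum_(i < k | x == i :> nat) src I i)%N
       | 3 => (\sum_(i < k | x == i :> nat) tgt I i)%N
       | 4 => [exists j : 'I_m, exists v : 'I_n,
                 [&& x == j :> nat, y == v :> nat & v \in cl_verts (T j)]]
       | 5 => [exists j : 'I_m, exists u : 'I_n, exists v : 'I_n,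
                 [&& x == j :> nat, y == u :> nat, z == v :> nat
                   & cl_edge (T j) u v]]
       | 6 => [exists j : 'I_m, exists v : 'I_n,
                 [&& x == j :> nat, y == v :> nat & v \in cl_terms (T j)]]
       | _ => 0
       end%N)
    (fun a x =>
       match a with
       | 0 => cap I
       | 1 => (\sum_(v < n | x == v :> nat) cost I v)%R
       | _ => 0%R
       end%N).

Definition output k st : {set 'I_k} := [set i : 'I_k | nmem st 7 i 0 0 != 0%N].

End Semantics.

(* Main.v *)
Require Import Defs.
From mathcomp Require Import all_boot all_order all_algebra.
From mathcomp Require Import boolp reals sequences exp.
From mathcomp Require Import ring lra zify.

(* A program computes a set [S] of pairs whose "cluster graph" (clusters as
   nodes, the pairs of [S] as edges) has no nonempty cut with fewer than [lam]
   edges, where [lam] is about [q / 128].  Starting from the pairs with both ends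
   in one cluster or in two clusters of load at least [q / 8], it repeats this:
   pack the edges greedily into [lam] forests; when an edge fits into none, its
   ends are [lam]-connected and are contracted; when every edge fits, there are at
   most [lam] edges per contracted node, and they are deleted.  Each deleted edge
   is charged to a component it creates, and the clusters have enough load for a
   constant fraction of the pairs to survive.

   Sampling keeps a pair with probability about [C ln n / q], so by a union bound
   over all cuts every cut of [S] keeps its expected share of sampled edges up to
   a constant factor.  Bourgain's embedding turns this comparison of cuts into
   a comparison of the sums of the edge lengths of any metric on the clusters, at
   the cost of a logarithmic factor, and by linear programming duality such
   inequalities are equivalent to a routing of [S] in the clusters joined by the
   sampled paths.  The loads of these paths, and the number of sampled pairs at a
   cluster, are controlled by Chernoff bounds.  The linear program costs at most
   [Ci ln n] times the optimum as soon as the demands sampled fit in the optimum,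
   which again follows from a Chernoff bound. *)

Set Implicit Arguments.
Unset Strict Implicit.
Unset Printing Implicit Defensive.

Import Order.TTheory GRing.Theory Num.Theory.
Local Open Scope ring_scope.

(** * Product laws and Chernoff bounds *)

(** The selection does not see the sample, so all cuts of [S] must survive sampling at once. A cut
    of [q / 128] pairs has [C ln n / 128] sampled pairs in expectation, enough for a union bound;
    hence the threshold. The 128 balances the count of pairs: there are [2 k] terminals, so at most
    [16 k / q] clusters have load [q / 8], and the deletions cost at most [k / 8] of the [k / 4]
    pairs given.

    The delicate point is the number of logarithms. The scales of the embedding lose [O(ln n)], and
    passing from a cut to its sampled part loses [O(q / ln n)]: together only [O(q)]. What remains
    is the length of the sampled links: a vertex lies in [O(ln n)] clusters, and each of them meets
    [O(beta ^ 2 (ln n) ^ 2)] sampled pairs, whence the cube.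

    If [C ln n >= q], the cancellation is lost because the probability is truncated at 1; then every
    pair is sampled and the chosen paths themselves are the routing.

    The program is compared with the optimum only when the sampled demands fit in it; otherwise the
    expected cost is controlled by a bound on the cost of single vertices. *)

Section ExpInequalities.
Variable R : realType.
Implicit Types x g : R.

(** Only [1 + x <= expR x] at [x = - g / 2] is used: it gives [(1 - g / 2) ^ 2 * expR g <= 1], while
    [(1 - g / 2) ^ 2 * (1 + 3 * g) >= 1] on the unit interval. The slope 3 becomes the factor of the
    mean in the upper Chernoff bounds. *)
Lemma expR_le1D3x g : 0 <= g <= 1 -> expR g <= 1 + 3 * g.
Proof.
move=> /andP[g0 g1].
have h : 1 - g / 2 <= expR (- (g / 2)).
  by have := @expR_ge1Dx R (- (g / 2)); lra.
have h2 : expR (- (g / 2)) * expR (- (g / 2)) * expR g = 1.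
  by rewrite -!expRD -[RHS]expR0; congr expR; lra.
have h3 : (1 - g / 2) * (1 - g / 2) <= expR (- (g / 2)) * expR (- (g / 2)).
  have h' : 0 <= 1 - g / 2 by lra.
  by apply: ler_pM.
have e0 : 0 < expR g := expR_gt0 g.
have h4 : (1 - g / 2) * (1 - g / 2) * expR g <= 1.
  by rewrite -[leRHS]h2 ler_wpM2r // ltW.
have h5 : 0 <= (1 - g) * (2 - 3 / 4 * g) by apply: mulr_ge0; lra.
have h6 : 1 <= (1 - g / 2) * (1 - g / 2) * (1 + 3 * g).
  have -> : (1 - g / 2) * (1 - g / 2) * (1 + 3 * g)
     = 1 + g * ((1 - g) * (2 - 3 / 4 * g)) by field.
  by rewrite lerDl mulr_ge0.
have h7 : 0 < (1 - g / 2) * (1 - g / 2) by apply: mulr_gt0; lra.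
rewrite -(ler_pM2l h7); exact: le_trans h4 h6.
Qed.

Lemma ln2_ge_half : 1 / 2 <= ln (2 : R).
Proof.
have h : expR (- (1 / 2 : R)) >= 1 / 2.
  by have := @expR_ge1Dx R (- (1 / 2)); lra.
have e0 := @expR_gt0 R (1/2).
have h2 : expR (1 / 2 : R) <= 2.
  have h3 : expR (- (1 / 2)) * expR (1 / 2) = 1 :> R.
    by rewrite -expRD -[RHS]expR0; congr expR; lra.
  by have := ler_wpM2r (ltW e0) h; rewrite h3; lra.
by rewrite -(@expRK R (1/2)) ler_ln // ?posrE ?expR_gt0.
Qed.

Lemma expRN_natln (n : nat) (c : nat) : (0 < n)%N ->
  expR (- (c%:R * ln n%:R)) = (n%:R ^+ c)^-1 :> R.
Proof.
move=> n0; rewrite expRN; congr (_^-1).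
by rewrite mulr_natl -lnXn ?ltr0n // lnK // posrE exprn_gt0 // ltr0n.
Qed.

Lemma ln_nat_ge_half (n : nat) : (1 < n)%N -> 1 / 2 <= ln (n%:R : R).
Proof.
move=> n1; apply: le_trans ln2_ge_half _.
by rewrite ler_ln ?posrE ?ltr0n ?ler_nat //; lia.
Qed.

Lemma ln_nat_ge0 (n : nat) : 0 <= ln (n%:R : R).
Proof.
case: n => [|n]; first by rewrite ln0.
by apply: ln_ge0; rewrite ler1n.
Qed.

End ExpInequalities.

Lemma union_bound (R : numDomainType) (O J : finType) (Q : pred J) (l : O -> R)
    (B : pred O) (B' : J -> pred O) : (forall w, 0 <= l w) ->
  (forall w, B w -> exists2 j, Q j & B' j w) ->
  \sum_(w | B w) l w <= \sum_(j | Q j) \sum_(w | B' j w) l w.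
Proof.
move=> l0 h; rewrite (exchange_big_dep predT) //= [leLHS]big_mkcond.
apply: ler_sum => w _; case: ifP => [/h[j Qj Bj]|_]; last by apply: sumr_ge0.
by rewrite (bigD1 j) ?Qj //= lerDl sumr_ge0.
Qed.

Section ProductLaws.
Variable R : realType.

(** Serves both for the sampled pairs, since [hal_law] unfolds to it, and for the random sets of
    Bourgain's embedding. *)
Definition bern (E : finType) (p : R) (M : {set E}) : R :=
  \prod_i (if i \in M then p else 1 - p).

Lemma bern_ge0 (E : finType) (p : R) (M : {set E}) : 0 <= p <= 1 -> 0 <= bern p M.
Proof.
by move=> /andP[p0 p1]; apply: prodr_ge0 => i _; case: ifP => _ //; rewrite subr_ge0.
Qed.

(** Independence in the form used for exponential moments: expanding the product chooses for every
    [i] whether it lies in [M]. *)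
Lemma bern_prod (E : finType) (p : R) (h h' : E -> R) :
  \sum_(M : {set E}) bern p M * \prod_i (if i \in M then h i else h' i)
  = \prod_i (p * h i + (1 - p) * h' i).
Proof.
rewrite (@bigA_distr R 0 1 *%R +%R E (fun i => p * h i) (fun i => (1 - p) * h' i)); apply: eq_bigr => M _.
by rewrite -big_split; apply: eq_bigr => i _; case: ifP.
Qed.

Lemma bern_sum1 (E : finType) (p : R) : \sum_(M : {set E}) bern p M = 1.
Proof.
transitivity (\sum_(M : {set E}) bern p M * \prod_i (if i \in M then 1 else 1)).
  by apply: eq_bigr => M _; rewrite big1 ?mulr1 // => i _; case: ifP.
by rewrite (bern_prod p (fun=> 1) (fun=> 1)) big1 // => i _; rewrite !mulr1 addrC subrK.
Qed.

Definition plaw (E P : finType) (L : E -> P -> R) (U : {ffun E -> P}) : R :=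
  \prod_i L i (U i).

Lemma plaw_prod (E P : finType) (L h : E -> P -> R) :
  \sum_U plaw L U * \prod_i h i (U i) = \prod_i \sum_x L i x * h i x.
Proof.
rewrite (@bigA_distr_bigA R 0 1 *%R +%R E P (fun i x => L i x * h i x)).
by apply: eq_bigr => U _; rewrite /plaw -big_split.
Qed.

Lemma plaw_sum1 (E P : finType) (L : E -> P -> R) :
  (forall i, \sum_x L i x = 1) -> \sum_U plaw L U = 1.
Proof.
move=> L1; transitivity (\sum_U plaw L U * \prod_(i : E) 1).
  by apply: eq_bigr => U _; rewrite big1 ?mulr1.
rewrite (plaw_prod L (fun _ _ => 1)) big1 // => i _.
by under eq_bigr => x _ do rewrite mulr1; exact: L1.
Qed.

Lemma plaw_marginal (E P : finType) (L : E -> P -> R) (h : P -> R) i0 :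
  (forall i, \sum_x L i x = 1) ->
  \sum_U plaw L U * h (U i0) = \sum_x L i0 x * h x.
Proof.
move=> L1.
transitivity (\sum_U plaw L U * \prod_i (if i == i0 then h (U i) else 1)).
  apply: eq_bigr => U _; rewrite (bigD1 i0) //= eqxx big1 ?mulr1 //.
  by move=> i /negbTE ->.
rewrite (plaw_prod L (fun i x => if i == i0 then h x else 1)).
rewrite (bigD1 i0) //= eqxx [X in _ * X]big1 ?mulr1 // => i /negbTE ->.
by under eq_bigr => x _ do rewrite mulr1; exact: L1.
Qed.

(** Exponential moment at parameter 1: a factor with mean exponent [a] contributes at most
    [1 + 3 * a <= expR (3 * a)]. The thresholds used later are three times the mean plus a multiple
    of [ln n], so no better parameter is sought. *)
Lemma plaw_chernoff (E P : finType) (L : E -> P -> R) (h : E -> P -> R) (mu tau : R) :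
  (forall i x, 0 <= L i x) -> (forall i, \sum_x L i x = 1) ->
  (forall i x, 0 <= h i x <= 1) ->
  \sum_i \sum_x L i x * h i x <= mu ->
  \sum_(U : {ffun E -> P} | tau < \sum_i h i (U i)) plaw L U <= expR (3 * mu - tau).
Proof.
move=> L0 L1 h01 hmu.
have -> : 3 * mu - tau = - tau + 3 * mu by rewrite addrC.
apply: (@le_trans _ _
  (expR (- tau) * \sum_(U : {ffun E -> P}) plaw L U * \prod_i expR (h i (U i)))).
  rewrite mulr_sumr [leRHS](bigID (fun U : {ffun E -> P} => tau < \sum_i h i (U i))) /=.
  have p0 (U : {ffun E -> P}) : 0 <= plaw L U by apply: prodr_ge0.
  rewrite -[leLHS]addr0; apply: lerD.
    apply: ler_sum => U hU; rewrite mulrCA -expR_sum -expRD.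
    rewrite -[leLHS]mulr1; apply: ler_wpM2l => //.
    by rewrite -expR0 ler_expR; lra.
  apply: sumr_ge0 => U _; rewrite mulr_ge0 ?expR_ge0 // mulr_ge0 //.
  by apply: prodr_ge0 => i _; exact: expR_ge0.
rewrite expRD; apply: ler_wpM2l; first exact: expR_ge0.
rewrite (plaw_prod L (fun i x => expR (h i x))).
apply: (@le_trans _ _ (\prod_i expR (3 * \sum_x L i x * h i x))).
  apply: ler_prod => i _; apply/andP; split.
    by apply: sumr_ge0 => x _; rewrite mulr_ge0 // expR_ge0.
  apply: le_trans (expR_ge1Dx _).
  have -> : 1 + 3 * (\sum_x L i x * h i x) = \sum_x (L i x + 3 * (L i x * h i x)).
    by rewrite big_split /= L1 mulr_sumr.
  by apply: ler_sum => x _; have := ler_wpM2l (L0 i x) (expR_le1D3x (h01 i x)); lra.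
by rewrite -expR_sum ler_expR -mulr_sumr ler_pM2l.
Qed.

Lemma bern_chernoff_up (E : finType) (p : R) (g : E -> R) (mu tau : R) :
  0 <= p <= 1 -> (forall i, 0 <= g i <= 1) -> p * \sum_i g i <= mu ->
  \sum_(M : {set E} | tau < \sum_(i in M) g i) bern p M <= expR (3 * mu - tau).
Proof.
move=> p01 g01 hmu; have /andP[p0 p1] := p01.
have -> : 3 * mu - tau = - tau + 3 * mu by rewrite addrC.
apply: (@le_trans _ _
  (expR (- tau) * \sum_M bern p M * \prod_i (if i \in M then expR (g i) else 1))).
  rewrite mulr_sumr [leRHS](bigID (fun M : {set E} => tau < \sum_(i in M) g i)) /=.
  rewrite -[leLHS]addr0; apply: lerD.
    apply: ler_sum => M hM; rewrite mulrCA -big_mkcond -expR_sum -expRD /=.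
    rewrite -[leLHS]mulr1; apply: ler_wpM2l; first exact: bern_ge0.
    by rewrite -expR0 ler_expR; lra.
  apply: sumr_ge0 => M _; rewrite mulr_ge0 ?expR_ge0 // mulr_ge0 ?bern_ge0 //.
  by apply: prodr_ge0 => i _; case: ifP => _; rewrite ?expR_ge0.
rewrite expRD; apply: ler_wpM2l; first exact: expR_ge0.
rewrite (bern_prod p (fun i => expR (g i)) (fun=> 1)).
apply: (@le_trans _ _ (\prod_i expR (3 * (p * g i)))).
  apply: ler_prod => i _; apply/andP; split.
    by rewrite addr_ge0 ?mulr_ge0 ?expR_ge0 //; lra.
  apply: le_trans (expR_ge1Dx _).
  have := @expR_le1D3x R (g i) (g01 i); move=> /(ler_wpM2l p0); lra.
by rewrite -expR_sum ler_expR -mulr_sumr ler_pM2l // -mulr_sumr.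
Qed.

(** Since [expR (- 1) <= 1 / 2], each element of [D] contributes at most [expR (- p / 2)] to the
    exponential moment; half of this exponent pays for the threshold. *)
Lemma bern_chernoff_low (E : finType) (p : R) (D : {set E}) :
  0 <= p <= 1 ->
  \sum_(M : {set E} | #|M :&: D|%:R < p * #|D|%:R / 4) bern p M
    <= expR (- (p * #|D|%:R / 4)).
Proof.
move=> p01; have /andP[p0 p1] := p01.
have einv2 : expR (- 1) <= 1 / 2 :> R.
  have h : 2 <= expR (1 : R) by have := @expR_ge1Dx R 1; lra.
  by rewrite expRN div1r lef_pV2 ?posrE ?expR_gt0.
set g := fun i => (i \in D)%:R : R.
have gE (M : {set E}) : \sum_(i in M) g i = #|M :&: D|%:R.
  rewrite -sum1_card natr_sum (big_setID D) /= [X in _ + X]big1 ?addr0.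
    by apply: eq_bigr => i /setIP[_]; rewrite /g => ->.
  by move=> i /setDP[_ /negbTE]; rewrite /g => ->.
have -> : - (p * #|D|%:R / 4) = p * #|D|%:R / 4 - p * (1 / 2) * #|D|%:R :> R by lra.
apply: (@le_trans _ _ (expR (p * #|D|%:R / 4) *
   \sum_(M : {set E}) bern p M * \prod_i (if i \in M then expR (- g i) else 1))).
  rewrite mulr_sumr [leRHS](bigID (fun M : {set E} => #|M :&: D|%:R < p * #|D|%:R / 4)) /=.
  rewrite -[leLHS]addr0; apply: lerD.
    apply: ler_sum => M hM; rewrite mulrCA -big_mkcond -expR_sum -expRD /=.
    rewrite -[leLHS]mulr1; apply: ler_wpM2l; first exact: bern_ge0.
    by rewrite -[leLHS]expR0 ler_expR sumrN gE; lra.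
  apply: sumr_ge0 => M _; rewrite mulr_ge0 ?expR_ge0 // mulr_ge0 ?bern_ge0 //.
  by apply: prodr_ge0 => i _; case: ifP => _; rewrite ?expR_ge0.
rewrite expRD; apply: ler_wpM2l; first exact: expR_ge0.
rewrite (bern_prod p (fun i => expR (- g i)) (fun=> 1)).
apply: (@le_trans _ _ (\prod_i expR (- (p * (1 / 2) * g i)))).
  apply: ler_prod => i _; apply/andP; split.
    by rewrite addr_ge0 ?mulr_ge0 ?expR_ge0 //; lra.
  apply: le_trans (expR_ge1Dx _).
  rewrite /g; case: (i \in D); last by rewrite /= mulr0n oppr0 expR0 !mulr0 oppr0 addr0 !mulr1 addrC subrK.
  by move: einv2 => /(ler_wpM2l p0); rewrite /= mulr1n; lra.
rewrite -expR_sum ler_expR sumrN lerN2 -mulr_sumr.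
apply: ler_wpM2l; first by lra.
rewrite -[D in leLHS]setTI -gE.
by under eq_bigl => i do rewrite inE.
Qed.

End ProductLaws.

(** * Linear programming duality *)

Lemma sum_pair (V : nmodType) (A B : finType) (F : A * B -> V) :
  \sum_z F z = \sum_i \sum_j F (i, j).
Proof. by rewrite pair_bigA; apply: eq_bigr => -[]. Qed.

Section Farkas.
Variable R : realType.

Lemma separating_point (I : finType) (P N : {set I}) (u l : I -> R) :
  (forall i j, i \in P -> j \in N -> l j <= u i) ->
  exists t, (forall i, i \in P -> t <= u i) /\ (forall j, j \in N -> l j <= t).
Proof.
move=> h; have [N0|[j0 jN]] := set_0Vmem N.
  have [P0|[i0 iP]] := set_0Vmem P.
    by exists 0; split=> i; rewrite ?P0 ?N0 inE.
  exists (u [arg min_(i < i0 in P) u i]%O); case: arg_minP => //= i1 i1P hm.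
  by split=> [i /hm //|j]; rewrite N0 inE.
exists (l [arg max_(j > j0 in N) l j]%O); case: arg_maxP => //= j1 j1N hm.
by split=> [i iP|j /hm //]; apply: h.
Qed.

(* Fourier-Motzkin elimination of the variables in [X]. *)
Lemma farkas_on (J : finType) (X : {set J}) (I : finType) (a : I -> J -> R)
    (b : I -> R) : (forall i j, j \notin X -> a i j = 0) ->
  (exists x : J -> R, forall i, \sum_j a i j * x j <= b i) \/
  (exists y : I -> R, [/\ forall i, 0 <= y i, forall j, \sum_i y i * a i j = 0
     & \sum_i y i * b i < 0]).
Proof.
move En : #|X| => m; elim: m X En I a b => [|m IH] X En I a b aX.
  have X0 : X = set0 by apply: cards0_eq.
  have a0 i j : a i j = 0 by apply: aX; rewrite X0 inE.
  have [bpos|] := boolP [forall i, 0 <= b i].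
    left; exists (fun=> 0) => i; rewrite big1 => [|j _]; last by rewrite mulr0.
    exact: (forallP bpos).
  rewrite negb_forall => /existsP[i0]; rewrite -ltNge => bi0; right.
  exists (fun i => (i == i0)%:R); split=> [i|j|].
  - exact: ler0n.
  - by rewrite big1 // => i _; rewrite a0 mulr0.
  - rewrite (bigD1 i0) //= eqxx mul1r big1 ?addr0 // => i /negbTE ->.
    by rewrite mul0r.
have [j0 j0X] : exists j, j \in X by apply/set0Pn; rewrite -card_gt0 En.
(* The rows of the reduced system are indexed by pairs of rows. A diagonal pair with coefficient 0
   at [j0] keeps its row, a positive and a negative coefficient are combined with weights that
   cancel [j0], and all other pairs give the zero row. *)
pose al (z : I * I) := if (z.1 == z.2) && (a z.1 j0 == 0) then 1
  else if (0 < a z.1 j0) && (a z.2 j0 < 0) then (a z.1 j0)^-1 else 0.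
pose be (z : I * I) := if (0 < a z.1 j0) && (a z.2 j0 < 0) then - (a z.2 j0)^-1 else 0.
have al0 z : 0 <= al z.
  rewrite /al; case: ifP => // _; case: ifP => // /andP[h _].
  by rewrite invr_ge0 ltW.
have be0 z : 0 <= be z.
  rewrite /be; case: ifP => // /andP[_ h].
  by rewrite oppr_ge0 invr_le0 ltW.
pose a' (z : I * I) j := al z * a z.1 j + be z * a z.2 j.
pose b' (z : I * I) := al z * b z.1 + be z * b z.2.
have a'j0 z : a' z j0 = 0.
  rewrite /a' /al /be; have [/andP[/eqP <- /eqP e]|_] := ifP.
    by rewrite e ltxx /= mul1r mul0r add0r.
  have [/andP[h1 h2]|_] := ifP; last by rewrite !mul0r add0r.
  by rewrite mulVf ?gt_eqF // mulNr mulVf ?lt_eqF // subrr.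
have [] := IH (X :\ j0) _ (I * I)%type a' b'.
- by have := cardsD1 j0 X; rewrite j0X En; lia.
- move=> z j; rewrite in_setD1 negb_and negbK => /orP[/eqP ->|/aX h]; first exact: a'j0.
  by rewrite /a' !h !mulr0 addr0.
- move=> [x hx]; left.
  pose rest i := \sum_(j | j != j0) a i j * x j.
  have restE z : \sum_j a' z j * x j = al z * rest z.1 + be z * rest z.2.
    rewrite (bigD1 j0) //= a'j0 mul0r add0r /rest !mulr_sumr -big_split /=.
    by apply: eq_bigr => j _; rewrite /a' mulrDl !mulrA.
  pose bd i := (b i - rest i) / a i j0.
  have [|t [tP tN]] := @separating_point I [set i | 0 < a i j0] [set i | a i j0 < 0] bd bd.
    move=> i j; rewrite !inE => hi hj.
    have := hx (i, j); rewrite restE /b' /al /be /= hi hj /=.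
    rewrite (gt_eqF hi) andbF /bd; lra.
  exists (fun j => if j == j0 then t else x j) => i.
  have -> : \sum_j a i j * (if j == j0 then t else x j) = a i j0 * t + rest i.
    rewrite (bigD1 j0) //= eqxx; congr (_ + _).
    by apply: eq_bigr => j /negbTE ->.
  have [neg|pos|zero] := ltrgtP (a i j0) 0.
  + have := tN i; rewrite inE neg => /(_ isT); rewrite /bd ler_ndivrMr //; lra.
  + have := tP i; rewrite inE pos => /(_ isT); rewrite /bd ler_pdivlMr //; lra.
  + rewrite zero mul0r add0r; have := hx (i, i); rewrite restE /b' /al /be /= eqxx zero eqxx ltxx /=; lra.
- move=> [y [y0 ya yb]]; right.
  (* Multipliers of the combined rows are transferred to the original rows by collecting the weights
     with which a row occurs as first or second member of a pair. *)
  have tr (c : I -> R) : \sum_z y z * (al z * c z.1 + be z * c z.2) =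
      \sum_i (\sum_k (y (i, k) * al (i, k) + y (k, i) * be (k, i))) * c i.
    under eq_bigr do rewrite mulrDr !mulrA.
    rewrite big_split /= !sum_pair /=.
    rewrite [X in _ + X]exchange_big -big_split /=; apply: eq_bigr => i _.
    by rewrite -big_split mulr_suml; apply: eq_bigr => k _; rewrite mulrDl.
  exists (fun i => \sum_k (y (i, k) * al (i, k) + y (k, i) * be (k, i))); split.
  + by move=> i; apply: sumr_ge0 => k _; rewrite addr_ge0 // mulr_ge0.
  + by move=> j; rewrite -tr; exact: ya.
  + by rewrite -tr; exact: yb.
Qed.

Lemma farkas (J I : finType) (a : I -> J -> R) (b : I -> R) :
  (forall y : I -> R, (forall i, 0 <= y i) -> (forall j, \sum_i y i * a i j = 0) ->
     0 <= \sum_i y i * b i) ->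
  exists x : J -> R, forall i, \sum_j a i j * x j <= b i.
Proof.
move=> h; have [|//|[y [y0 ya]]] := @farkas_on J setT I a b.
  by move=> i j; rewrite inE.
by rewrite ltNge h.
Qed.

End Farkas.

(** * Duality between concurrent routing and vertex lengths *)

Section RoutableDual.
Variables (R : realType) (n k : nat).

(** The multipliers of the capacity rows are the lengths [l]. A demand is an equation, hence two
    opposite rows, and [D i] is the difference of their multipliers. The multipliers of the sign
    constraints turn the vanishing of a column into the inequality between [D i] and the length of a
    path. *)
Lemma routable_dual (e : rel 'I_n) (s t : 'I_k -> 'I_n) (S : {set 'I_k}) (b : R) :
  (forall (l : 'I_n -> R) (D : 'I_k -> R), (forall v, 0 <= l v) ->
     (forall i (P : gpath n), i \in S -> P \in paths e (s i) (t i) ->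
        D i <= \sum_(v | v \in (P : seq 'I_n)) l v) ->
     \sum_(i in S) D i <= b * \sum_v l v) ->
  routable e s t S setT b.
Proof.
move=> h.
pose J := ('I_k * gpath n)%type.
pose I := (J + ('I_k * bool + 'I_n))%type.
pose inp i (P : gpath n) := (i \in S) && (P \in paths e (s i) (t i)).
pose a (r : I) (j : J) : R := match r with
  | inl j' => - (j == j')%:R
  | inr (inl (i, sg)) => (-1) ^+ sg * ((j.1 == i) && inp j.1 j.2)%:R
  | inr (inr v) => (inp j.1 j.2 && (v \in (j.2 : seq 'I_n)))%:R
  end.
pose c (r : I) : R := match r with
  | inl _ => 0
  | inr (inl (i, sg)) => (-1) ^+ sg * (i \in S)%:R
  | inr (inr v) => b
  end.
have [y y0 ya|x hx] := @farkas R J I a c.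
  pose l v := y (inr (inr v)).
  pose D i := y (inr (inl (i, true))) - y (inr (inl (i, false))).
  have -> : \sum_i y i * c i = b * (\sum_v l v) - \sum_(i in S) D i.
    rewrite big_sumType /= big1 ?add0r => [|i _]; last by rewrite mulr0.
    rewrite big_sumType /= addrC; congr (_ + _).
      by rewrite mulr_sumr; apply: eq_bigr => v _; rewrite mulrC.
    rewrite -sumrN [RHS]big_mkcond sum_pair /=.
    apply: eq_bigr => i _; rewrite big_bool /= expr0 expr1 /D.
    by case: ifP => _ /=; ring.
  rewrite subr_ge0; apply: h => [v|i P iS Pp]; first exact: y0.
  have := ya (i, P).
  rewrite big_sumType /= (bigD1 (i, P)) //= eqxx big1 ?addr0 => [|z /negbTE]; last first.
    by rewrite eq_sym => ->; rewrite oppr0 mulr0.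
  rewrite big_sumType /= sum_pair /=.
  rewrite (bigD1 i) //= [X in _ + X + _]big1 ?addr0 => [|j /negbTE nj]; last first.
    by rewrite big1 // => sg _; rewrite eq_sym nj /= mulr0 mulr0.
  rewrite big_bool /= eqxx /inp iS Pp /= expr0 expr1.
  have := y0 (inl (i, P)); rewrite /D.
  have -> : \sum_i0 y (inr (inr i0)) * (i0 \in (P : seq 'I_n))%:R = \sum_(v | v \in (P : seq 'I_n)) l v.
    rewrite [RHS]big_mkcond; apply: eq_bigr => v _.
    by case: ifP => _ /=; rewrite ?mulr1 ?mulr0.
  by rewrite !mulr1n; lra.
have sumE i (A : pred (gpath n)) : i \in S ->
  \sum_(P in paths e (s i) (t i) | A P) x (i, P)
  = \sum_j ((j.1 == i) && inp j.1 j.2 && A j.2)%:R * x j.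
  move=> iS; rewrite sum_pair /=.
  rewrite (bigD1 i) //= [X in _ + X]big1 ?addr0 => [|j /negbTE nj]; last first.
    by rewrite big1 // => sg _; rewrite nj /= mul0r.
  rewrite big_mkcond; apply: eq_bigr => P _; rewrite eqxx /inp iS /=.
  by case: ifP => _ /=; rewrite ?mul1r ?mul0r.
exists (fun i P => x (i, P)); split=> [i P|i iS|v _].
- have := hx (inl (i, P)); rewrite /= (bigD1 (i, P)) //= eqxx big1 ?addr0.
    by rewrite mulN1r oppr_le0.
  by move=> j /negbTE ->; rewrite oppr0 mul0r.
- have E := sumE i predT iS.
  rewrite (eq_bigl (fun P => (P \in paths e (s i) (t i)) && predT P)); last by move=> P; rewrite andbT.
  apply/eqP; rewrite eq_le {1 2}E; apply/andP; split.
    have := hx (inr (inl (i, false))); rewrite /= iS expr0 mul1r; apply: le_trans.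
    by apply: ler_sum => j _; rewrite andbT mul1r.
  have := hx (inr (inl (i, true))); rewrite /= iS expr1 mulN1r -lerN2 opprK; move=> h1.
  apply: (le_trans h1); rewrite -sumrN; apply: ler_sum => j _.
  by rewrite andbT !mulN1r mulNr opprK.
- have := hx (inr (inr v)) => /=; apply: le_trans; rewrite le_eqVlt; apply/orP; left; apply/eqP.
  rewrite (eq_bigr (fun i => \sum_j ((j.1 == i) && inp j.1 j.2 && (v \in (j.2 : seq 'I_n)))%:R * x j)); last first.
    by move=> i iS; apply: sumE.
  rewrite exchange_big /=; apply: eq_bigr => -[i P] _ /=.
  rewrite -mulr_suml; congr (_ * _).
  have [iS|iS] := boolP (i \in S).
    rewrite (bigD1 i) //= eqxx big1 ?addr0 // => j /andP[_ /negbTE nj].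
    by rewrite eq_sym nj.
  rewrite /inp (negbTE iS) /= big1 // => j jS.
  by rewrite andbF.
Qed.
End RoutableDual.

(** * Cut counting *)

Section Cuts.
Variables (V E : finType).
Implicit Types (x y : E -> V) (S : {set E}) (A : {set V}).

Definition cut x y S A : {set E} := [set i in S | (x i \in A) != (y i \in A)].

(** Cuts are collected as sets of edges, so that vertex sets with the same boundary count once and
    the number of cuts depends on the touched vertices only. *)
Definition cuts x y S : {set {set E}} := [set cut x y S A | A : {set V}] :\ set0.

Definition touched x y S : {set V} :=
  [set v | [exists i in S, (x i != y i) && ((x i == v) || (y i == v))]].

Lemma cutsP x y S D : reflect (exists2 A, D = cut x y S A & D != set0) (D \in cuts x y S).
Proof.
rewrite in_setD1; apply: (iffP andP) => [[D0 /imsetP[A _ DE]]|[A -> h]].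
  by exists A.
by split=> //; apply/imsetP; exists A.
Qed.

Lemma cut_loops x y S A : cut x y S A \subset [set i in S | x i != y i].
Proof.
apply/subsetP => i; rewrite !inE => /andP[-> /=].
by apply: contraNneq => ->.
Qed.

Lemma cut_touched x y S A : cut x y S A = cut x y S (A :&: touched x y S).
Proof.
apply/setP => i; rewrite !inE; case iS: (i \in S) => //=.
have [->|ne] := eqVneq (x i) (y i); first by rewrite !eqxx.
have -> : [exists i0 in S, (x i0 != y i0) && ((x i0 == x i) || (y i0 == x i))].
  by apply/existsP; exists i; rewrite iS ne eqxx.
have -> : [exists i0 in S, (x i0 != y i0) && ((x i0 == y i) || (y i0 == y i))].
  by apply/existsP; exists i; rewrite iS ne eqxx orbT.
by rewrite !andbT.
Qed.

Lemma card_cuts x y S : (#|cuts x y S| <= 2 ^ #|touched x y S|)%N.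
Proof.
rewrite -card_powerset; set N := touched x y S.
apply: leq_trans (leq_imset_card (cut x y S) (powerset N)).
apply: subset_leq_card; apply/subsetP => D /cutsP[A -> _].
by rewrite cut_touched; apply/imsetP; exists (A :&: N) => //; rewrite inE subsetIr.
Qed.

Lemma sum_star x y S :
  (\sum_v #|cut x y S [set v]| = 2 * #|[set i in S | x i != y i]|)%N.
Proof.
transitivity (\sum_v \sum_(i in S) ((x i == v) != (y i == v) : nat))%N.
  apply: eq_bigr => v _; rewrite -sum1_card big_mkcond [RHS]big_mkcond /=.
  by apply: eq_bigr => i _; rewrite !inE; case: (i \in S) => //=; case: ifP.
rewrite exchange_big /= -sum1_card big_distrr /= muln1 big_mkcond [RHS]big_mkcond /=.
apply: eq_bigr => i _; rewrite inE; case: (i \in S) => //=.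
have [->|ne] := eqVneq (x i) (y i); first by rewrite big1 // => v _; rewrite eqxx.
rewrite (bigD1 (x i)) //= (bigD1 (y i)) /=; last by rewrite eq_sym.
rewrite !eqxx [y i == x i]eq_sym (negbTE ne) /= big1 // => v /andP[h1 h2].
by rewrite ![_ == v]eq_sym (negbTE h1) (negbTE h2).
Qed.

(** The star of a touched vertex is a nonempty cut, so it has at least [c] edges, and the stars
    together count every non-loop twice. *)
Lemma many_edges x y S (c : nat) :
  (forall D, D \in cuts x y S -> (c <= #|D|)%N) ->
  (#|touched x y S| * c <= 2 * #|[set i in S | x i != y i]|)%N.
Proof.
move=> h; rewrite -sum_star -sum1_card big_distrl /= [leqRHS](bigID (mem (touched x y S))) /=.
apply: leq_trans (leq_addr _ _); apply: leq_sum => v; rewrite inE => /existsP[i /and3P[iS ne iv]].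
rewrite mul1n; apply: h; apply/cutsP; exists [set v] => //; apply/set0Pn; exists i.
rewrite !inE iS /=; case/orP: iv => /eqP e; rewrite -e eqxx.
  by rewrite [y i == x i]eq_sym (negbTE ne).
by rewrite (negbTE ne).
Qed.

(** The vertex type does not change: [x e] is renamed [y e] and merely ceases to be touched, so
    [touched] measures the progress of the contractions. *)
Definition contract x y (e : E) (z : E -> V) (i : E) : V := if z i == x e then y e else z i.

Lemma cut_contract x y S e A :
  ((x e \in A) = (y e \in A)) -> cut (contract x y e x) (contract x y e y) S A = cut x y S A.
Proof.
move=> h; apply/setP => i; rewrite !inE /contract.
by case: (x i =P x e) => [->|_]; case: (y i =P x e) => [->|_]; rewrite ?h.
Qed.

Lemma cuts_contract_sub x y S e :
  cuts (contract x y e x) (contract x y e y) S \subset cuts x y S.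
Proof.
apply/subsetP => D /cutsP[A -> D0]; apply/cutsP.
exists [set v | (if v == x e then y e else v) \in A] => //.
by apply/setP => i; rewrite !inE.
Qed.

Lemma cuts_avoiding x y S e D : e \in S ->
  D \in cuts x y S -> e \notin D -> D \in cuts (contract x y e x) (contract x y e y) S.
Proof.
move=> eS /cutsP[A -> D0] eD; apply/cutsP; exists A => //.
rewrite cut_contract //; apply/eqP; move: eD; rewrite !inE eS /=.
by rewrite negbK.
Qed.

Lemma touched_contract x y S e : e \in S -> x e != y e ->
  (#|touched (contract x y e x) (contract x y e y) S| < #|touched x y S|)%N.
Proof.
move=> eS ne; apply: proper_card; apply/properP; split; last first.
  exists (x e); rewrite inE.
    by apply/existsP; exists e; rewrite eS ne eqxx.
  apply/existsP => -[i /and3P[iS _]]; rewrite /contract.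
  by case/orP => /eqP; case: ifP => [_ h|/eqP //]; rewrite -h eqxx in ne.
apply/subsetP => v; rewrite !inE => /existsP[i /and3P[iS nl iv]].
have ni : x i != y i by apply: contraNneq nl => h; rewrite /contract h.
move: iv nl; rewrite /contract.
have [xi|xi] := eqVneq (x i) (x e); have [yi|yi] := eqVneq (y i) (x e).
- by rewrite eqxx.
- move=> /orP[/eqP <- _|/eqP <- _]; apply/existsP; [exists e|exists i].
    by rewrite eS ne eqxx orbT.
  by rewrite iS ni eqxx orbT.
- move=> /orP[/eqP <- _|/eqP <- _]; apply/existsP; [exists i|exists e].
    by rewrite iS ni eqxx.
  by rewrite eS ne eqxx orbT.
- by move=> h _; apply/existsP; exists i; rewrite iS ni.
Qed.

End Cuts.

(** * The generating function of the cut sizes *)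

Section CutCounting.
Variable R : realType.

Lemma expRN2_le (z : R) : 0 <= z <= 1 / 2 -> expR (- (2 * z)) <= 1 - z.
Proof.
move=> /andP[z0 z1].
have h1 : 1 + 2 * z <= expR (2 * z) := expR_ge1Dx _.
have h2 : 1 <= (1 - z) * (1 + 2 * z) by nra.
have h3 : 1 <= (1 - z) * expR (2 * z).
  by apply: (le_trans h2); apply: ler_wpM2l => //; lra.
by rewrite expRN -[leLHS]mul1r ler_pdivrMr ?expR_gt0.
Qed.

(* Instead of counting the cuts of each size, as Karger does, the contraction
   argument is run on the generating function of the cut sizes.  Contracting a
   random edge keeps a cut [D] with at most half of the edges with probability
   [1 - |D| / |E| >= exp (-2 |D| / |E|)], so a contraction costs a small decrease
   of [s]; the cuts with more than half of the edges are bounded by their number. *)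
Lemma sum_cuts (V E : finType) (S : {set E}) (c : nat) (sg : R) :
  (0 < c)%N -> 2 * expR (- (sg * c%:R / 4)) <= 1 -> 0 <= sg ->
  forall (r : nat) (x y : E -> V) (s : R),
  (forall D, D \in cuts x y S -> (c <= #|D|)%N) ->
  (#|touched x y S| <= r)%N -> sg + 4 / c%:R * ln r%:R <= s ->
  \sum_(D in cuts x y S) expR (- (s * #|D|%:R)) <= r%:R * (2 * expR (- (sg * c%:R / 4))) ^+ 2.
Proof.
set eps := 2 * _ => c0 eps1 sg0.
have eps0 : 0 <= eps by rewrite mulr_ge0 ?expR_ge0.
have B0 r : 0 <= r%:R * eps ^+ 2 by rewrite mulr_ge0 // exprn_ge0.
elim=> [|r IH] x y s hc ht hs.
  rewrite big1 ?mul0r // => D DC; exfalso.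
  have : (#|cuts x y S| <= 1)%N.
    by apply: leq_trans (card_cuts _ _ _) _; move: ht; rewrite leqn0 => /eqP ->.
  have /cutsP[A DE D0] := DC; move: ht; rewrite leqn0 cards_eq0 => /eqP t0.
  move: D0; rewrite DE cut_touched t0 setI0 => /set0Pn[i].
  by rewrite !inE andbF.
have [ht'|htr] := leqP #|touched x y S| r.
  have := IH x y s hc ht'.
  have [r0|r0] := posnP r.
    move=> _; rewrite big1 // => D /cutsP[A DE D0]; exfalso.
    move: ht'; rewrite r0 leqn0 cards_eq0 => /eqP t0.
    by move: D0; rewrite DE cut_touched t0 setI0 => /set0Pn[i]; rewrite !inE andbF.
  have -> : sg + 4 / c%:R * ln r%:R <= s.
    apply: le_trans hs; rewrite lerD2l ler_wpM2l ?divr_ge0 ?ler0n //.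
    by rewrite ler_ln ?posrE ?ltr0n // ler_nat.
  move=> /(_ isT) /le_trans; apply; apply: ler_wpM2r; first exact: exprn_ge0.
  by rewrite ler_nat.
have tr : #|touched x y S| = r.+1 by apply/eqP; rewrite eqn_leq ht.
have r1 : (0 < r)%N.
  have [i iS] : exists i, i \in [set i in S | x i != y i].
    have : (0 < #|touched x y S|)%N by rewrite tr.
    rewrite card_gt0 => /set0Pn[v]; rewrite inE => /existsP[i /and3P[iS ne _]].
    by exists i; rewrite inE iS.
  move: iS; rewrite inE => /andP[iS ne].
  have : (#|[set x i; y i]| <= #|touched x y S|)%N.
    apply: subset_leq_card; apply/subsetP => v; rewrite !inE => h.
    by apply/existsP; exists i; rewrite iS ne ![_ == v]eq_sym.
  by rewrite cards2 ne tr.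
have hE := many_edges hc; rewrite tr in hE.
set Lp := [set i in S | x i != y i] in hE.
have Lp0 : (0 < #|Lp|)%N by lia.
have LpR : 0 < #|Lp|%:R :> R by rewrite ltr0n.
have hER : r.+1%:R * c%:R <= 2 * #|Lp|%:R :> R by rewrite -!natrM ler_nat.
(* The decrease of [s] is paid by the term [4 / c * ln r]: passing from [r.+1] to [r] frees at least
   [4 / (c * r.+1)], and [r.+1 * c <= 2 * #|Lp|]. *)
pose s' := s - 2 / #|Lp|%:R.
have hs' : sg + 4 / c%:R * ln r%:R <= s'.
  rewrite /s' lerBrDr; apply: le_trans hs; rewrite -addrA lerD2l.
  have hln : ln r%:R <= ln r.+1%:R - 1 / r.+1%:R :> R.
    have -> : r%:R = r.+1%:R * (1 + - (1 / r.+1%:R)) :> R.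
      by rewrite mulrDr mulr1 mulrN mulrCA divff ?gt_eqF // mulr1 -[in RHS]natr1 addrK.
    have h1 : 1 / r.+1%:R < 1 :> R by rewrite ltr_pdivrMr // mul1r ltr1n.
    have h0 : 0 < 1 + - (1 / r.+1%:R) :> R by rewrite subr_gt0.
    rewrite lnM ?posrE ?ltr0n // lerD2l; apply: le_ln1Dx.
    by rewrite ltrN2.
  have h2 : 2 / #|Lp|%:R <= 4 / c%:R * (1 / r.+1%:R) :> R.
    rewrite mulrA mulr1 -mulrA -invfM ler_pdivrMr // mulrAC ler_pdivlMr.
      by move: hER; rewrite mulrC; lra.
    by rewrite mulr_gt0 // ltr0n.
  have h3 : 0 <= 4 / c%:R :> R by rewrite divr_ge0 ?ler0n.
  have := ler_wpM2l h3 hln; rewrite mulrBr lerBrDr; apply: le_trans.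
  by rewrite lerD2l.
have s'0 : sg <= s'.
  apply: le_trans hs'; rewrite lerDl mulr_ge0 ?divr_ge0 ?ler0n //.
  exact: ln_nat_ge0.
rewrite (bigID (fun D : {set E} => (2 * #|D| <= #|Lp|)%N)) /= -[r.+1%:R]natr1 mulrDl mul1r.
apply: lerD.
  apply: (@le_trans _ _ (\sum_(D in cuts x y S)
      expR (- (s' * #|D|%:R)) * ((#|Lp| - #|D|)%:R / #|Lp|%:R))).
    rewrite [leRHS](bigID (fun D : {set E} => (2 * #|D| <= #|Lp|)%N)) /= -[leLHS]addr0.
    apply: lerD; last by apply: sumr_ge0 => D _; rewrite mulr_ge0 ?expR_ge0 ?divr_ge0 ?ler0n.
    apply: ler_sum => D /andP[DC hD].
    have -> : - (s * #|D|%:R) = - (s' * #|D|%:R) + - (2 * (#|D|%:R / #|Lp|%:R)).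
      by rewrite /s'; lra.
    rewrite expRD; apply: ler_wpM2l; first exact: expR_ge0.
    rewrite natrB; last by lia.
    rewrite mulrBl divff ?gt_eqF //; apply: expRN2_le.
    rewrite divr_ge0 ?ler0n //= ler_pdivrMr //.
    have : (2 * #|D|)%:R <= #|Lp|%:R :> R by rewrite ler_nat.
    rewrite natrM; lra.
  (* The weight of [D] is the fraction of the non-loops outside [D], and contracting any of these
     leaves [D] a cut. *)
  apply: (@le_trans _ _ (#|Lp|%:R^-1 * \sum_(e in Lp)
     \sum_(D in cuts (contract x y e x) (contract x y e y) S) expR (- (s' * #|D|%:R)))).
    have -> : \sum_(D in cuts x y S) expR (- (s' * #|D|%:R)) * ((#|Lp| - #|D|)%:R / #|Lp|%:R)
       = #|Lp|%:R^-1 * \sum_(D in cuts x y S) \sum_(e in Lp :\: D) expR (- (s' * #|D|%:R)).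
      rewrite mulr_sumr; apply: eq_bigr => D /cutsP[A DE _].
      rewrite sumr_const cardsD (setIidPr _) ?DE ?cut_loops //.
      by rewrite -mulr_natr; lra.
    apply: ler_wpM2l; first by rewrite invr_ge0 ltW.
    rewrite (exchange_big_dep (mem Lp)) /=; last by move=> D e _ /setDP[].
    apply: ler_sum => e eL; rewrite [leLHS]big_mkcond [leRHS]big_mkcond /=.
    apply: ler_sum => D _; case: ifP => [/andP[DC /setDP[_ eD]]|_].
      rewrite cuts_avoiding //; by move: eL; rewrite inE => /andP[].
    by case: ifP => _; rewrite ?expR_ge0.
  rewrite ler_pdivrMl //.
  have -> : #|Lp|%:R * (r%:R * eps ^+ 2) = \sum_(e in Lp) r%:R * eps ^+ 2.
    by rewrite sumr_const mulr_natl.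
  apply: ler_sum => e; rewrite inE => /andP[eS ne]; apply: IH => //.
    by move=> D /(subsetP (cuts_contract_sub x y S e)); apply: hc.
  by have := touched_contract eS ne; rewrite tr ltnS.
(* More than half of the non-loops is more than [r.+1 * c / 4] edges. Against at most [2 ^ r.+1]
   cuts this leaves [eps ^+ r.+1], and [r.+1 >= 2]. *)
apply: (@le_trans _ _ (\sum_(D in cuts x y S) expR (- (sg * (r.+1%:R * c%:R / 4))))).
  rewrite [leRHS](bigID (fun D : {set E} => (2 * #|D| <= #|Lp|)%N)) /= -[leLHS]add0r.
  apply: lerD; first by apply: sumr_ge0 => D _; exact: expR_ge0.
  apply: ler_sum => D /andP[DC]; rewrite -ltnNge => hD.
  rewrite ler_expR lerN2; apply: ler_pM => //.
  - by rewrite !mulr_ge0 ?invr_ge0.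
  - by apply: (le_trans s'0); rewrite /s' gerBl divr_ge0 ?ler0n.
  - have : #|Lp|%:R <= (2 * #|D|)%:R :> R by rewrite ler_nat ltnW.
    rewrite natrM; lra.
rewrite sumr_const -[leLHS]mulr_natl.
have -> : expR (- (sg * (r.+1%:R * c%:R / 4))) = expR (- (sg * c%:R / 4)) ^+ r.+1.
  rewrite -expRM_natl; congr expR.
  by rewrite mulrN; congr (- _); rewrite !mulrA [sg * _]mulrC.
apply: (@le_trans _ _ (eps ^+ r.+1)).
  rewrite /eps exprMn; apply: ler_wpM2r; first by rewrite exprn_ge0 ?expR_ge0.
  by rewrite -natrX ler_nat -tr; exact: card_cuts.
by apply: ler_wiXn2l => //; lia.
Qed.

End CutCounting.

(** * From cuts to metrics *)

Section MetricsAndCuts.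
Variables (R : realType) (V E : finType) (x y : E -> V) (S H : {set E}) (kappa : R).
Hypothesis kappa0 : 0 <= kappa.
Hypothesis cut_le : forall A, #|cut x y S A|%:R <= kappa * #|cut x y H A|%:R.

(** A line metric is a nonnegative combination of threshold cuts, peeled off here from the top:
    lowering the vertices of maximal value to the second largest value removes [M - M'] times one
    cut from each sum. The induction is on the number of vertices below the maximum. *)
Lemma line_le (g : V -> R) :
  \sum_(i in S) `|g (x i) - g (y i)| <= kappa * \sum_(i in H) `|g (x i) - g (y i)|.
Proof.
pose N (g : V -> R) := [set v | [exists u, g v < g u]].
move En : #|N g| => m; elim/ltn_ind: m g En => m IH g En.
have [N0|[v0 v0N]] := set_0Vmem (N g).
  have gc u v : g u = g v.
    apply/eqP; rewrite eq_le !leNgt; apply/andP; split; apply/negP => h.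
      by have : v \in N g; [rewrite inE; apply/existsP; exists u|rewrite N0 inE].
    by have : u \in N g; [rewrite inE; apply/existsP; exists v|rewrite N0 inE].
  rewrite !big1 ?mulr0 // => i _; by rewrite (gc (x i) (y i)) subrr normr0.
pose v1 := [arg max_(v > v0 in N g) g v]%O.
have [v1N v1max] : v1 \in N g /\ forall v, v \in N g -> g v <= g v1.
  by rewrite /v1; case: arg_maxP => //= i iN h; split=> // v /h.
have /existsP[u1 hu1] : [exists u, g v1 < g u] by move: v1N; rewrite inE.
pose M := g u1; pose M' := g v1; pose A := [set v | M' < g v].
have gA v : v \in A -> g v = M.
  rewrite inE => hv; have vN : v \notin N g.
    by apply/negP => /v1max; rewrite leNgt hv.
  have uN : u1 \notin N g by apply/negP => /v1max; rewrite leNgt hu1.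
  move: vN uN; rewrite !inE !negb_exists => /forallP/(_ u1) h1 /forallP/(_ v) h2.
  by apply/eqP; rewrite eq_le !leNgt h1 h2.
pose g' v := Num.min (g v) M'.
have g'A v : v \in A -> g' v = M'.
  by rewrite inE /g' => h; rewrite min_r // ltW.
have g'N v : v \notin A -> g' v = g v /\ g v <= M'.
  by rewrite inE -leNgt /g' => h; rewrite min_l.
have split_norm u v :
    `|g u - g v| = `|g' u - g' v| + (M - M') * ((u \in A) != (v \in A))%:R.
  have MM : M' < M by [].
  have [uA|uA] := boolP (u \in A); have [vA|vA] := boolP (v \in A) => /=.
  - by rewrite (gA u) // (gA v) // (g'A u) // (g'A v) // !subrr mulr0 addr0.
  - have [-> h] := g'N v vA; rewrite (gA u) // (g'A u) // !ger0_norm ?mulr1 ?subr_ge0 //.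
      lra.
    by apply: le_trans (ltW MM).
  - have [-> h] := g'N u uA; rewrite (gA v) // (g'A v) // !ler0_norm ?mulr1 ?subr_le0 //.
      lra.
    by apply: le_trans (ltW MM).
  - by have [-> _] := g'N u uA; have [-> _] := g'N v vA; rewrite mulr0 addr0.
have split_sum (F : {set E}) : \sum_(i in F) `|g (x i) - g (y i)| =
    \sum_(i in F) `|g' (x i) - g' (y i)| + (M - M') * #|cut x y F A|%:R.
  rewrite (eq_bigr _ (fun i _ => split_norm (x i) (y i))) big_split -mulr_sumr; congr (_ + _ * _).
  rewrite -sum1_card natr_sum big_mkcond [RHS]big_mkcond.
  by apply: eq_bigr => i _; rewrite [in RHS]in_set; case: (i \in F) => //=; case: ifP.
have hN : (#|N g'| < m)%N.
  rewrite -En; apply: proper_card; apply/properP; split.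
    apply/subsetP => v; rewrite !inE => /existsP[u hu]; apply/existsP.
    exists u1; have [vA|vA] := boolP (v \in A).
      by move: hu; rewrite (g'A v) // /g' lt_min ltxx andbF.
    by have [_ h] := g'N v vA; apply: le_lt_trans h hu1.
  exists v1 => //; rewrite inE; apply/negP => /existsP[u].
  have v1A : v1 \notin A by rewrite inE ltxx.
  have [-> _] := g'N v1 v1A.
  by rewrite /g' lt_min ltxx andbF.
rewrite !split_sum mulrDr; apply: lerD; first exact: (IH _ hN).
by rewrite mulrCA; apply: ler_wpM2l; rewrite // subr_ge0 ltW.
Qed.

(** * Bourgain's embedding by distances to random sets *)

Section Frechet.
Variable d : V -> V -> R.
Hypothesis d0 : forall u v, 0 <= d u v.
Hypothesis dxx : forall u, d u u = 0.
Hypothesis dC : forall u v, d u v = d v u.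
Hypothesis dT : forall u v w, d u w <= d u v + d v w.

(** The default, which is the value for an empty [A], is at least every distance. Hence the empty
    set disturbs neither the Lipschitz property nor the lower bounds on the distance to a random
    set. *)
Definition dist_to (A : {set V}) (v : V) : R :=
  \big[Num.min/(\sum_u \sum_w d u w)]_(a in A) d v a.

Lemma dist_to_lip A u v : `|dist_to A u - dist_to A v| <= d u v.
Proof.
have lip u' v' : dist_to A u' <= d u' v' + dist_to A v'.
  have /bigmin_leP[h|[a aA h]] : dist_to A v' <= dist_to A v' by [].
    apply: (@le_trans _ _ (\sum_u \sum_w d u w)); first exact: bigmin_le_id.
    by apply: le_trans h _; rewrite lerDr.
  apply: (@le_trans _ _ (d u' a)); first exact: bigmin_le_cond.
  by apply: le_trans (dT u' v' a) _; rewrite lerD2l.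
rewrite ler_norml; apply/andP; split.
  by have := lip v u; rewrite dC; lra.
by have := lip u v; lra.
Qed.

Lemma bern_miss (q : R) (X : {set V}) :
  \sum_(A : {set V} | [disjoint A & X]) bern q A = (1 - q) ^+ #|X|.
Proof.
transitivity (\sum_(A : {set V}) bern q A * \prod_i (if i \in A then (i \notin X)%:R else 1)).
  rewrite big_mkcond; apply: eq_bigr => A _; case: ifP => [dis|/negbT].
    rewrite big1 ?mulr1 // => i _; case: ifP => // iA.
    by rewrite (disjointFr dis iA).
  rewrite disjoint_sym -setI_eq0 => /set0Pn[i /setIP[iX iA]].
  by rewrite (bigD1 i) //= iA iX mul0r mulr0.
rewrite (bern_prod q (fun i => (i \notin X)%:R) (fun=> 1)).
rewrite -prodr_const [RHS]big_mkcond; apply: eq_bigr => i _.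
by case: (i \in X) => /=; rewrite ?mulr0 ?mulr1 ?add0r // addrC subrK.
Qed.

(** Missing [X] has probability at least [(1 - q) ^ (2 ^ t.+1) >= 1 / 16], and missing [Y] at most
    [(1 - q) ^ (2 ^ t) <= expR (- 1 / 2) <= 2 / 3]; the two events are independent because the sets
    are disjoint. *)
Lemma bern_miss_hit (t : nat) (X Y : {set V}) : [disjoint X & Y] ->
  (#|X| < 2 ^ t.+1)%N -> (2 ^ t <= #|Y|)%N ->
  1 / 48 <= \sum_(A : {set V} | [disjoint A & X] && ~~ [disjoint A & Y]) bern (2 ^- t.+1 : R) A.
Proof.
move=> dXY hX hY; set q := 2 ^- t.+1.
have q0 : 0 < q by rewrite invr_gt0 exprn_gt0.
have qh : q <= 1 / 2.
  by rewrite /q div1r lef_pV2 ?posrE ?exprn_gt0 // ler_eXnr // ler1n.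
have qt : q * (2 ^ t.+1)%:R = 1 by rewrite natrX /q mulVf // expf_neq0 // pnatr_eq0.
have -> : \sum_(A : {set V} | [disjoint A & X] && ~~ [disjoint A & Y]) bern q A
    = (1 - q) ^+ #|X| - (1 - q) ^+ #|X| * (1 - q) ^+ #|Y|.
  have cXY : #|X :|: Y| = (#|X| + #|Y|)%N.
    by rewrite cardsU; move: dXY; rewrite -setI_eq0 => /eqP ->; rewrite cards0 subn0.
  rewrite -exprD -cXY -!bern_miss [in RHS](bigID (fun A : {set V} => [disjoint A & Y])) /=.
  rewrite addrAC [X in _ = X - _ + _](_ : _ = \sum_(A : {set V} | [disjoint A & X :|: Y]) bern q A).
    by rewrite subrr add0r.
  by apply: eq_bigl => A; rewrite -!setI_eq0 setIUr setU_eq0.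
have a1 : 1 / 16 <= (1 - q) ^+ #|X|.
  apply: (@le_trans _ _ ((1 - q) ^+ (2 ^ t.+1))); last by apply: ler_wiXn2l; [lra|lra|exact: ltnW].
  have h1 : expR (- (2 * q)) <= 1 - q by apply: expRN2_le; lra.
  apply: (@le_trans _ _ (expR (- (2 * q)) ^+ (2 ^ t.+1))); last first.
    by apply: lerXn2r; rewrite // nnegrE ?expR_ge0 //; lra.
  rewrite -expRM_natl.
  have -> : (2 ^ t.+1)%:R * - (2 * q) = - (1 / 2) + - (1 / 2) + - (1 / 2) + - (1 / 2) :> R.
    by rewrite mulrN [2 * q]mulrC mulrA [_ * q]mulrC qt; lra.
  have e2 : 1 / 2 <= expR (- (1 / 2)) :> R by have := @expR_ge1Dx R (- (1 / 2)); lra.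
  rewrite !expRD; set z := expR _ in e2 *.
  have h4 : 1 / 4 <= z * z by nra.
  have : 1 / 16 <= (z * z) * (z * z) by nra.
  by rewrite !mulrA.
have a2 : (1 - q) ^+ #|Y| <= 2 / 3.
  apply: (@le_trans _ _ ((1 - q) ^+ (2 ^ t))); first by apply: ler_wiXn2l; [lra|lra|].
  apply: (@le_trans _ _ (expR (- q) ^+ (2 ^ t))).
    by apply: lerXn2r; rewrite ?nnegrE ?expR_ge0 //; [lra|have := @expR_ge1Dx R (- q); lra].
  rewrite -expRM_natl.
  have -> : (2 ^ t)%:R * - q = - (1 / 2) :> R.
    by move: qt; rewrite expnS natrM; lra.
  rewrite expRN -[leRHS]invf_div lef_pV2 ?posrE ?expR_gt0 ?divr_gt0 //.
  by have := @expR_ge1Dx R (1 / 2); lra.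
nra.
Qed.

(* Bourgain's argument: [rho t] is the least radius, capped at [d a b / 2], for
   which the balls around [a] and [b] both have [2 ^ t] points.  A random set of
   density [2 ^- t.+1] misses the smaller of the two open balls of radius
   [rho t.+1] and hits the other closed ball of radius [rho t] with constant
   probability. *)
Section Pair.
Variables a b : V.

Let ball (u : V) (r : R) := [set z | d u z <= r].
Let oball (u : V) (r : R) := [set z | d u z < r].
Let rad (w : V * bool) := if w.2 then d a w.1 else d b w.1.
Let big_balls t r := (2 ^ t <= #|ball a r|)%N && (2 ^ t <= #|ball b r|)%N.
Let rho t := \big[Num.min/d a b / 2]_(w | big_balls t (rad w)) rad w.

Let rho_half t : rho t <= d a b / 2.
Proof. exact: bigmin_le_id. Qed.

Let rho0 : rho 0 <= 0.
Proof.
have ball1 u : (1 <= #|ball u 0|)%N.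
  by rewrite card_gt0; apply/set0Pn; exists u; rewrite inE dxx.
rewrite -(dxx a); have -> : d a a = rad (a, true) by [].
by apply: bigmin_le_cond; rewrite /big_balls /rad /= dxx !ball1.
Qed.

Let rho_top t : (#|V| < 2 ^ t)%N -> rho t = d a b / 2.
Proof.
move=> h; rewrite /rho big_pred0 // => w; apply/negbTE; rewrite negb_and -!ltnNge.
by apply/orP; left; apply: leq_ltn_trans (max_card _) h.
Qed.

Let rho_big t : rho t < d a b / 2 -> big_balls t (rho t).
Proof.
move=> h; have /bigmin_leP[|[w hw wr]] : rho t <= rho t by [].
  by rewrite leNgt h.
have sub u : (#|ball u (rad w)| <= #|ball u (rho t)|)%N.
  by apply: subset_leq_card; apply/subsetP => z; rewrite !inE => /le_trans; apply.
by case/andP: hw => h1 h2; apply/andP; split; [exact: leq_trans h1 _|exact: leq_trans h2 _].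
Qed.

(** Closed balls grow only at distances from their centres. If both open balls had [2 ^ t] points,
    the largest distance from [a] or [b] below [rho t] would already be an admissible radius. *)
Let rho_small t : (#|oball a (rho t)| < 2 ^ t)%N || (#|oball b (rho t)| < 2 ^ t)%N.
Proof.
rewrite !ltnNge -negb_and; apply/negP => /andP[ha hb].
pose W := [set w | rad w < rho t].
have [z0 hz0] : exists z, z \in oball a (rho t).
  by apply/set0Pn; rewrite -card_gt0; apply: leq_trans ha; rewrite expn_gt0.
have w0W : (z0, true) \in W by move: hz0; rewrite !inE.
pose w1 := [arg max_(w > (z0, true) in W) rad w]%O.
have [w1W w1max] : w1 \in W /\ forall w, w \in W -> rad w <= rad w1.
  by rewrite /w1; case: arg_maxP => //= i iW h; split=> // w /h.
have : rho t <= rad w1.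
  apply: bigmin_le_cond; apply/andP; split.
    apply: leq_trans ha _; apply: subset_leq_card; apply/subsetP => z hz.
    by rewrite inE; apply: (w1max (z, true)); move: hz; rewrite !inE.
  apply: leq_trans hb _; apply: subset_leq_card; apply/subsetP => z hz.
  by rewrite inE; apply: (w1max (z, false)); move: hz; rewrite !inE.
by move: w1W; rewrite inE ltNge => /negP.
Qed.

Let scale_gain t (u v : V) : ((u == a) && (v == b)) || ((u == b) && (v == a)) ->
  (#|oball u (rho t.+1)| < 2 ^ t.+1)%N -> rho t < rho t.+1 ->
  1 / 48 * (rho t.+1 - rho t) <=
    \sum_A bern (2 ^- t.+1 : R) A * `|dist_to A a - dist_to A b|.
Proof.
move=> uv hu ht; have rt : rho t < d a b / 2 by apply: lt_le_trans (rho_half t.+1).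
have duv : d u v = d a b.
  by case/orP: uv => /andP[/eqP -> /eqP ->] //; rewrite dC.
have hv : (2 ^ t <= #|ball v (rho t)|)%N.
  have /andP[h1 h2] := rho_big rt.
  by case/orP: uv => /andP[/eqP _ /eqP ->].
have q01 : 0 <= (2 ^- t.+1 : R) <= 1.
  by rewrite invr_ge0 exprn_ge0 //= invf_le1 ?exprn_gt0 // exprn_ege1 // ler1n.
have dis : [disjoint oball u (rho t.+1) & ball v (rho t)].
  rewrite -setI_eq0; apply/eqP/setP => z; rewrite !inE; apply/negbTE/negP => /andP[h1 h2].
  have := dT u z v; rewrite duv (dC z v); have := rho_half t.+1; lra.
have := bern_miss_hit dis hu hv; set P := \sum_(A | _) _ => hP.
apply: (@le_trans _ _ (P * (rho t.+1 - rho t))).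
  by apply: ler_wpM2r => //; rewrite subr_ge0 ltW.
rewrite /P mulr_suml [leRHS](bigID (fun A : {set V} =>
  [disjoint A & oball u (rho t.+1)] && ~~ [disjoint A & ball v (rho t)])) /=.
rewrite -[leLHS]addr0; apply: lerD; last first.
  by apply: sumr_ge0 => A _; rewrite mulr_ge0 ?bern_ge0.
apply: ler_sum => A /andP[hA1 hA2]; apply: ler_wpM2l; first exact: bern_ge0.
have -> : `|dist_to A a - dist_to A b| = `|dist_to A u - dist_to A v|.
  by case/orP: uv => /andP[/eqP -> /eqP ->] //; rewrite distrC.
apply: le_trans (ler_norm _); apply: lerB.
  apply/bigmin_geP; split=> [|z zA].
    apply: le_trans (rho_half _) _; apply: (@le_trans _ _ (d a b)).
      by have := d0 a b; lra.
    rewrite (bigD1 a) //= (bigD1 b) //= -addrA lerDl addr_ge0 ?sumr_ge0 // => i _.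
    by apply: sumr_ge0.
  by have := disjointFr hA1 zA; rewrite inE => /negbT; rewrite -leNgt.
move: hA2; rewrite -setI_eq0 => /set0Pn[z /setIP[zA]]; rewrite inE => hz.
by apply: le_trans hz; apply: bigmin_le_cond.
Qed.

(** The gains of the scales telescope from [rho 0 <= 0] to [rho L], which is [d a b / 2] because no
    ball has [2 ^ L] points; hence [96 = 2 * 48]. *)
Lemma dist_le_frechet (L : nat) : (#|V| < 2 ^ L)%N ->
  d a b <= 96 * \sum_(t < L) \sum_A bern (2 ^- t.+1 : R) A * `|dist_to A a - dist_to A b|.
Proof.
move=> hL.
have gain t : 1 / 48 * (rho t.+1 - rho t) <=
    \sum_A bern (2 ^- t.+1 : R) A * `|dist_to A a - dist_to A b|.
  have [h|h] := ltP (rho t) (rho t.+1).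
    case/orP: (rho_small t.+1) => hs.
      by apply: (@scale_gain t a b) => //; rewrite !eqxx.
    by apply: (@scale_gain t b a) => //; rewrite !eqxx orbT.
  apply: (@le_trans _ _ 0); first lra.
  apply: sumr_ge0 => A _; rewrite mulr_ge0 // bern_ge0 //.
  by rewrite invr_ge0 exprn_ge0 //= invf_le1 ?exprn_gt0 // exprn_ege1 // ler1n.
have : \sum_(t < L) 1 / 48 * (rho t.+1 - rho t) <=
  \sum_(t < L) \sum_A bern (2 ^- t.+1 : R) A * `|dist_to A a - dist_to A b|.
  by apply: ler_sum => t _; exact: gain.
rewrite -mulr_sumr -(big_mkord predT (fun t => rho t.+1 - rho t)) telescope_sumr //.
by rewrite rho_top //; have := rho0; lra.
Qed.

End Pair.

(** Each [dist_to A] is a line metric, to which the cut comparison applies, and it is 1-Lipschitz on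
    the side of [H]. The weights of one scale sum to 1, so the loss is the number [L] of scales. *)
Lemma metric_le (L : nat) : (#|V| < 2 ^ L)%N ->
  \sum_(i in S) d (x i) (y i) <= 96 * L%:R * kappa * \sum_(i in H) d (x i) (y i).
Proof.
move=> hL.
have q01 t : 0 <= (2 ^- t.+1 : R) <= 1.
  by rewrite invr_ge0 exprn_ge0 //= invf_le1 ?exprn_gt0 // exprn_ege1 // ler1n.
apply: (@le_trans _ _ (96 * \sum_(t < L) \sum_A bern (2 ^- t.+1 : R) A *
    \sum_(i in S) `|dist_to A (x i) - dist_to A (y i)|)).
  apply: (@le_trans _ _ (\sum_(i in S) 96 * \sum_(t < L) \sum_A bern (2 ^- t.+1 : R) A *
      `|dist_to A (x i) - dist_to A (y i)|)).
    by apply: ler_sum => i _; exact: dist_le_frechet.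
  rewrite -mulr_sumr exchange_big /=; apply: ler_wpM2l => //; apply: ler_sum => t _.
  rewrite exchange_big /=; apply: ler_sum => A _.
  by rewrite mulr_sumr.
rewrite -!mulrA; apply: ler_wpM2l => //.
have -> : L%:R * (kappa * \sum_(i in H) d (x i) (y i))
  = \sum_(t < L) \sum_(A : {set V}) bern (2 ^- t.+1 : R) A * (kappa * \sum_(i in H) d (x i) (y i)).
  rewrite [RHS](eq_bigr (fun=> kappa * \sum_(i in H) d (x i) (y i))).
    by rewrite big_const_ord iter_addr addr0 mulr_natl.
  by move=> t _; rewrite -mulr_suml bern_sum1 mul1r.
apply: ler_sum => t _; apply: ler_sum => A _; apply: ler_wpM2l; first exact: bern_ge0.
apply: le_trans (line_le _) _; apply: ler_wpM2l => //.
by apply: ler_sum => i _; exact: dist_to_lip.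
Qed.

End Frechet.
End MetricsAndCuts.

(** * Running programs *)

Definition var (x : nat) : nexp := NGet x (NConst 0) (NConst 0) (NConst 0).
Definition arr (x : nat) (e : nexp) : nexp := NGet x e (NConst 0) (NConst 0).
Definition set_var (x : nat) (e : nexp) : cmd := NSet x (NConst 0) (NConst 0) (NConst 0) e.
Definition set_arr (x : nat) (i e : nexp) : cmd := NSet x i (NConst 0) (NConst 0) e.
Definition incr (e : nexp) : nexp := NAdd e (NConst 1).
Definition NLt (e1 e2 : nexp) : test := NLe (incr e1) e2.
Definition IfEq (e1 e2 : nexp) (c1 c2 : cmd) : cmd := If (NLe e1 e2) (If (NLe e2 e1) c1 c2) c2.
Definition For (x : nat) (e : nexp) (c : cmd) : cmd :=
  Seq (set_var x (NConst 0))
      (While (NLt (var x) e) (Seq c (set_var x (incr (var x))))).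

Fixpoint nwrites (c : cmd) : seq nat :=
  match c with
  | Skip | RSet _ _ _ => [::]
  | NSet a _ _ _ _ => [:: a]
  | Seq c1 c2 | If _ c1 c2 => nwrites c1 ++ nwrites c2
  | While _ c => nwrites c
  end.

Fixpoint rwrites (c : cmd) : seq nat :=
  match c with
  | Skip | NSet _ _ _ _ _ => [::]
  | RSet a _ _ => [:: a]
  | Seq c1 c2 | If _ c1 c2 => rwrites c1 ++ rwrites c2
  | While _ c => rwrites c
  end.

Section Runs.
Variable R : realType.
Implicit Types (st : state R) (c : cmd) (Q : state R -> Prop).

Definition runs c st (T : nat) Q := exists t st', [/\ exec c st t st', (t <= T)%N & Q st'].

Definition agree (W WR : seq nat) st st' :=
  (forall a x y z, a \notin W -> nmem st' a x y z = nmem st a x y z) /\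
  (forall a x, a \notin WR -> rmem st' a x = rmem st a x).

Lemma agree_refl W WR st : agree W WR st st.
Proof. by []. Qed.

Lemma agree_trans W WR st1 st2 st3 :
  agree W WR st1 st2 -> agree W WR st2 st3 -> agree W WR st1 st3.
Proof.
move=> [h1 h2] [h3 h4]; split=> [a x y z ha|a x ha]; first by rewrite h3 ?h1.
by rewrite h4 ?h2.
Qed.

Lemma agree_sub W WR W' WR' st1 st2 : {subset W <= W'} -> {subset WR <= WR'} ->
  agree W WR st1 st2 -> agree W' WR' st1 st2.
Proof.
move=> s1 s2 [h1 h2]; split=> [a x y z ha|a x ha]; [apply: h1|apply: h2].
  by apply: contra ha; exact: s1.
by apply: contra ha; exact: s2.
Qed.

Lemma exec_agree c st t st' : exec c st t st' -> agree (nwrites c) (rwrites c) st st'.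
Proof.
elim=> {c st t st'} //=.
- move=> st a x y z e; split=> // a' x' y' z'; rewrite inE => /negbTE h.
  by rewrite /nupd /= h.
- move=> st a x e; split=> // a' x'; rewrite inE => /negbTE h.
  by rewrite /rupd /= h.
- move=> c1 c2 st t1 st1 t2 st2 _ h1 _ h2; apply: (agree_trans (st2 := st1)).
    by apply: agree_sub h1 => a ha; rewrite mem_cat ha.
  by apply: agree_sub h2 => a ha; rewrite mem_cat ha orbT.
- move=> b c1 c2 st t st' _; case: (teval st b); apply: agree_sub => a ha;
  by rewrite mem_cat ha ?orbT.
- by move=> b c st t1 st1 t2 st2 _ _ h1 _ h2; apply: agree_trans h1 h2.
Qed.

(** The frame comes for free: arrays that [c] does not write syntactically are unchanged, so
    postconditions need only speak of the written ones. *)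
Lemma runs_conseq c st T Q T' Q' : runs c st T Q -> (T <= T')%N ->
  (forall st', agree (nwrites c) (rwrites c) st st' -> Q st' -> Q' st') -> runs c st T' Q'.
Proof.
move=> [t [st' [h1 h2 h3]]] hT hQ; exists t, st'; split=> //; first exact: leq_trans hT.
by apply: hQ => //; exact: exec_agree h1.
Qed.

Lemma runs_weaken c st T T' Q : runs c st T Q -> (T <= T')%N -> runs c st T' Q.
Proof. by move=> h hT; apply: runs_conseq h hT _. Qed.

Lemma runs_skip st Q : Q st -> runs Skip st 1 Q.
Proof. by exists 1%N, st; split=> //; exact: ESkip. Qed.

Lemma runs_nset a x y z e st Q :
  Q (nupd st a (neval st x) (neval st y) (neval st z) (neval st e)) ->
  runs (NSet a x y z e) st 1 Q.
Proof. by eexists 1%N, _; split; first exact: ENSet. Qed.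

Lemma runs_rset a x e st Q :
  Q (rupd st a (neval st x) (reval st e)) -> runs (RSet a x e) st 1 Q.
Proof. by eexists 1%N, _; split; first exact: ERSet. Qed.

Lemma runs_seq c1 c2 st T1 T2 Q :
  runs c1 st T1 (fun st1 => runs c2 st1 T2 Q) -> runs (Seq c1 c2) st (T1 + T2) Q.
Proof.
move=> [t1 [st1 [h1 h2 [t2 [st2 [h3 h4 h5]]]]]].
exists (t1 + t2)%N, st2; split=> //; first exact: ESeq h1 h3.
exact: leq_add.
Qed.

Lemma runs_if b c1 c2 st T Q : (teval st b -> runs c1 st T Q) ->
  (~~ teval st b -> runs c2 st T Q) -> runs (If b c1 c2) st T.+1 Q.
Proof.
move=> h1 h2; have : runs (if teval st b then c1 else c2) st T Q.
  by case: ifP => [/h1|/negbT/h2].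
move=> [t [st' [h3 h4 h5]]]; exists t.+1, st'; split=> //; exact: EIf.
Qed.

Lemma runs_ifeq e1 e2 c1 c2 st T Q : (neval st e1 = neval st e2 -> runs c1 st T Q) ->
  (neval st e1 <> neval st e2 -> runs c2 st T Q) -> runs (IfEq e1 e2 c1 c2) st T.+2 Q.
Proof.
have weak c : runs c st T Q -> runs c st T.+1 Q.
  by move=> h; apply: runs_conseq h _ _.
move=> h1 h2; apply: runs_if => /= t1; last by apply/weak/h2; lia.
by apply: runs_if => /= t2; [apply: h1|apply: h2]; lia.
Qed.

(** The variant is an argument of the invariant rather than a function of the memory, so it can
    count objects that the program does not store. *)
Lemma runs_while b c st T (Inv : nat -> state R -> Prop) mu :
  (forall mu st, Inv mu st -> teval st b ->
     runs c st T (fun st' => exists2 mu', (mu' < mu)%N & Inv mu' st')) ->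
  Inv mu st ->
  runs (While b c) st (mu * T.+1 + 1) (fun st' => (exists mu', Inv mu' st') /\ ~~ teval st' b).
Proof.
move=> step; elim/ltn_ind: mu st => mu IH st hI.
have [tb|tb] := boolP (teval st b); last first.
  exists 1%N, st; split; [exact: EWhileF|lia|by split=> //; exists mu].
have [t1 [st1 [e1 l1 [mu' hmu hI1]]]] := step _ _ hI tb.
have [t2 [st2 [e2 l2 Q2]]] := IH _ hmu _ hI1.
exists (t1 + t2).+1, st2; split=> //; first exact: EWhileT e1 e2.
have : (mu'.+1 * T.+1 <= mu * T.+1)%N by rewrite leq_mul2r hmu orbT.
rewrite mulSn; lia.
Qed.

(** [For] evaluates its bound again before every pass, hence the premise that [e] keeps the value
    [N] under the writes of the loop. *)
Lemma runs_for x e c st0 N T (Inv : nat -> state R -> Prop) :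
  x \notin nwrites c ->
  (forall st, agree (x :: nwrites c) (rwrites c) st0 st -> neval st e = N) ->
  (forall i st r, Inv i st -> Inv i (nupd st x 0 0 0 r)) ->
  (forall i st, (i < N)%N -> agree (x :: nwrites c) (rwrites c) st0 st ->
     nmem st x 0 0 0 = i -> Inv i st -> runs c st T (Inv i.+1)) ->
  Inv 0%N st0 ->
  runs (For x e c) st0 (N * T.+2 + 2) (Inv N).
Proof.
move=> xc eN Iupd step I0.
have agr st r : agree (x :: nwrites c) (rwrites c) st0 st ->
    agree (x :: nwrites c) (rwrites c) st0 (nupd st x 0 0 0 r).
  move=> h; apply: agree_trans h _; split=> // a x' y' z'; rewrite inE negb_or => /andP[/negbTE h _].
  by rewrite /nupd /= h.
have updx st r : nmem (nupd st x 0 0 0 r) x 0 0 0 = r by rewrite /nupd /= eqxx.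
have -> : (N * T.+2 + 2 = 1 + (N * T.+2 + 1))%N by lia.
apply: runs_seq; apply: runs_nset => /=.
have := @runs_while (NLt (var x) e) (Seq c (set_var x (incr (var x))))
  (nupd st0 x 0 0 0 0) T.+1 (fun mu st => [/\ (mu <= N)%N, agree (x :: nwrites c) (rwrites c) st0 st,
   nmem st x 0 0 0 = (N - mu)%N & Inv (N - mu)%N st]) N.
case=> [mu st [hmu ha hx hI]||t [st' [h1 h2 [[mu [hmu ha hx hI]]]]]].
- rewrite /= (eN _ ha) hx => hlt;   rewrite -addn1; apply: runs_seq.
  have hlt' : (N - mu < N)%N by lia.
  apply: runs_conseq (step _ _ hlt' ha hx hI) _ _ => // st1 ag1 I1.
  apply: runs_nset; exists mu.-1; first by lia.
  have hx1 : nmem st1 x 0 0 0 = (N - mu)%N by rewrite (proj1 ag1).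
  rewrite /= hx1; split; first by lia.
  + apply: agr; apply: agree_trans ha _; apply: agree_sub ag1 => // a.
    by rewrite inE => ->; rewrite orbT.
  + by rewrite /= !eqxx /=; lia.
  + have -> : (N - mu.-1 = (N - mu).+1)%N by lia.
    exact: Iupd.
- split=> //; first by apply/agr/agree_refl.
    by rewrite updx subnn.
  by rewrite subnn; apply: Iupd.
- rewrite /= (eN _ ha) hx => hlt; exists t, st'; split=> //.
  by move: hI; have -> : (N - mu = N)%N by lia.
Qed.

End Runs.

(** * Forest packing *)

Section Labellings.
Variable V : finType.
Implicit Types (f g : V -> V) (A : {set V}).

(** A forest is represented only by the labelling of its components. An edge between two components
    is a [merge] and loses one label, so differences of [classes] count edges. *)
Definition classes f : nat := #|f @: [set: V]|.

Definition merge f (a b : V) (v : V) : V := if f v == a then b else f v.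

Definition saturated f A : bool :=
  [forall u, forall v, (f u == f v) ==> ((u \in A) == (v \in A))].

Definition refines (T : Type) f (g : V -> T) := forall u v, f u = f v -> g u = g v.

Lemma saturatedP f A :
  reflect (forall u v, f u = f v -> (u \in A) = (v \in A)) (saturated f A).
Proof.
apply: (iffP forallP) => [h u v e|h u].
  by have /forallP/(_ v)/implyP := h u; rewrite e => /(_ (eqxx _))/eqP.
by apply/forallP => v; apply/implyP => /eqP/h ->.
Qed.

Lemma classes_merge f u v : f u != f v -> (classes (merge f (f u) (f v))).+1 = classes f.
Proof.
move=> ne; rewrite [RHS](cardsD1 (f u)) imset_f ?inE // add1n; congr (_.+1); apply: eq_card => w.
rewrite in_setD1; apply/imsetP/andP => [[w' _ ->]|[h /imsetP[w' _ e]]].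
  rewrite /merge; have [_|h] := eqVneq (f w') (f u); last by rewrite h imset_f ?inE.
  by rewrite eq_sym ne imset_f ?inE.
by exists w'; rewrite ?inE // /merge -e (negbTE h).
Qed.

Lemma classes_refines f g : refines f g -> (classes g <= classes f)%N.
Proof.
move=> h; rewrite /classes; pose s a := odflt a [pick v | f v == a].
have -> : g @: [set: V] = (fun a => g (s a)) @: (f @: [set: V]).
  apply/setP => w; apply/imsetP/imsetP => [[v _ ->]|[a /imsetP[v _ ->] ->]].
    exists (f v); first by rewrite imset_f ?inE.
    by rewrite /s; case: pickP => [v' /eqP/h //|/(_ v)]; rewrite eqxx.
  by exists (s (f v)); rewrite ?inE.
exact: leq_imset_card.
Qed.

Lemma classes_id : classes id = #|V|.
Proof. by rewrite /classes imset_id cardsT. Qed.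

Lemma classes_le f : (classes f <= #|V|)%N.
Proof. by rewrite -classes_id; apply: classes_refines => u v ->. Qed.

Lemma merge_refines (T : Type) f (g : V -> T) u v :
  refines f g -> g u = g v -> refines (merge f (f u) (f v)) g.
Proof.
move=> h e w w'; rewrite /merge.
case: (f w =P f u) => [/h hw|_]; case: (f w' =P f u) => [/h hw'|_].
- by rewrite hw hw'.
- by move/h; rewrite hw e.
- by move/h; rewrite hw' e.
- exact: h.
Qed.

Lemma saturated_merge f u v A : saturated f A -> (u \in A) = (v \in A) ->
  saturated (merge f (f u) (f v)) A.
Proof.
move=> /saturatedP h e; apply/saturatedP.
exact: (@merge_refines _ f (fun z => z \in A)).
Qed.

End Labellings.

Section Scan.
Variables (k : nat) (V : finType) (x y : 'I_k -> V) (S : {set 'I_k}) (lam : nat) (Pi : V -> V).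

Definition strong := forall A, #|cut x y S A| = 0%N \/ (lam <= #|cut x y S A|)%N.

(** Blobs are the contracted nodes: by the first clause no cut with fewer than [lam] edges separates
    two vertices of a blob. [Pi] is the partition from which the round starts. *)
Definition blob_inv (B : V -> V) :=
  (forall A, (#|cut x y S A| < lam)%N -> saturated B A) /\ refines B Pi.

Definition crossing (B : V -> V) : {set 'I_k} := [set i in S | B (x i) != B (y i)].

(** When all edges between blobs fit in [lam] forests, each forest has at most
    [classes B - classes Pi] edges. In this form, as a difference of potentials, the bound adds up
    over the rounds. *)
Definition certified (B : V -> V) :=
  (#|crossing B| + lam * classes Pi <= lam * classes B)%N.

(* [L 0] is the labelling by the current blobs and [L j.+1] the labelling by the
   components of the [j]-th forest, built from the edges numbered below [t]. *)
Definition scan_inv (B : V -> V) (t : nat) (L : nat -> V -> V) :=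
  [/\ L 0%N = B,
      forall j, (j < lam)%N -> refines B (L j.+1) /\ refines (L j.+1) Pi,
      (#|[set i in crossing B | (i < t)%N]| + \sum_(j < lam) classes (L j.+1)
         <= lam * classes B)%N
    & forall A, saturated B A ->
        (#|[set j : 'I_lam | ~~ saturated (L j.+1) A]|
           <= #|[set i in cut x y S A | (i < t)%N]|)%N].

Lemma scan_inv0 B L : blob_inv B -> L 0%N = B -> (forall j, (j < lam)%N -> L j.+1 = B) ->
  scan_inv B 0 L.
Proof.
move=> [_ hB] L0 LS; split=> // [j hj||A hA].
- by rewrite LS //; split.
- rewrite (_ : [set i in crossing B | (i < 0)%N] = set0) ?cards0; last first.
    by apply/setP => i; rewrite !inE andbF.
  rewrite (eq_bigr (fun=> classes B)) => [|j _]; last by rewrite LS.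
  by rewrite sum_nat_const card_ord.
- rewrite (_ : [set j : 'I_lam | _] = set0) ?cards0 //.
  by apply/setP => j; rewrite !inE LS // hA.
Qed.

Lemma prefix_skip (D : {set 'I_k}) (i : 'I_k) : i \notin D ->
  [set i' in D | (i' < i.+1)%N] = [set i' in D | (i' < i)%N].
Proof.
move=> h; apply/setP => i'; rewrite !inE ltnS leq_eqVlt.
case iD: (i' \in D) => //=; case: eqP => //= e.
by move: h; rewrite -(ord_inj e) iD.
Qed.

Lemma prefix_add (D : {set 'I_k}) (i : 'I_k) : i \in D ->
  #|[set i' in D | (i' < i.+1)%N]| = #|[set i' in D | (i' < i)%N]|.+1.
Proof.
move=> h; rewrite (cardsD1 i) inE h ltnSn add1n; congr (_.+1); apply: eq_card => i'.
rewrite !inE ltnS [in RHS]ltn_neqAle; case: (i' \in D); rewrite ?andbF //=.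
Qed.

Lemma prefix_mono (D : {set 'I_k}) (t t' : nat) : (t <= t')%N ->
  (#|[set i in D | (i < t)%N]| <= #|[set i in D | (i < t')%N]|)%N.
Proof.
move=> h; apply: subset_leq_card; apply/subsetP => i; rewrite !inE => /andP[-> /=].
by move/leq_trans; apply.
Qed.

Lemma scan_inv_skip B (i : 'I_k) L : ~~ ((i \in S) && (B (x i) != B (y i))) ->
  scan_inv B i L -> scan_inv B i.+1 L.
Proof.
move=> hi [L0 LS cnt sat]; split=> // [|A hA].
  by rewrite (prefix_skip (D := crossing B)) // inE.
by apply: leq_trans (sat A hA) _; apply: prefix_mono.
Qed.

(** The edge is paid for by the label lost in forest [j]. A set respected by the blobs can become
    unsaturated in this forest only if the edge crosses it, and then the counted part of its cut
    grows as well. *)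
Lemma scan_inv_place B (i : 'I_k) L L' (j : nat) : (j < lam)%N ->
  i \in S -> B (x i) != B (y i) -> Pi (x i) = Pi (y i) ->
  L j.+1 (x i) != L j.+1 (y i) ->
  L' j.+1 = merge (L j.+1) (L j.+1 (x i)) (L j.+1 (y i)) ->
  (forall j', j' <> j.+1 -> L' j' = L j') ->
  scan_inv B i L -> scan_inv B i.+1 L'.
Proof.
move=> hj iS Bi Pii ne Lj Lne [L0 LS cnt sat].
have ic : i \in crossing B by rewrite inE iS.
split=> [|j' hj'||A hA].
- by rewrite Lne.
- have [rj1 rj2] := LS j' hj'.
  have [e|/eqP e] := eqVneq j'.+1 j.+1; last by rewrite Lne.
  rewrite e Lj -e; split; last exact: merge_refines.
  by move=> u v /rj1 e'; rewrite /merge e'.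
- apply: leq_trans cnt; rewrite (prefix_add ic).
  rewrite (bigD1 (Ordinal hj)) //= [in leqRHS](bigD1 (Ordinal hj)) //= Lj.
  rewrite -(classes_merge ne) !addSn addnS ltnS leq_add2l leq_add2l leq_sum // => j' hj'.
  by rewrite Lne // => -[e]; move/eqP: hj'; apply; apply: val_inj.
- have mono j' : (j' < lam)%N -> ~~ saturated (L' j'.+1) A -> j' != j -> ~~ saturated (L j'.+1) A.
    by move=> _ h /eqP e; rewrite -Lne // => -[].
  have [cr|ncr] := boolP (i \in cut x y S A).
    rewrite (prefix_add cr) (cardsD1 (Ordinal hj)) -add1n; apply: leq_add; first by case: (_ \in _).
    apply: leq_trans (sat A hA); apply: subset_leq_card; apply/subsetP => j'.
    by rewrite !inE => /andP[e h]; apply: (mono j').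
  rewrite prefix_skip //; apply: leq_trans (sat A hA); apply: subset_leq_card; apply/subsetP => j'.
  rewrite !inE; have [e|e] := eqVneq (j' : nat) j; last by move=> h; apply: (mono j').
  rewrite e Lj; apply: contra => h; apply: saturated_merge => //.
  by move: ncr; rewrite !inE iS /= negbK => /eqP.
Qed.

(** The ends of the edge are joined in all [lam] forests. A set separating them is unsaturated in
    every forest, and the last clause of [scan_inv] converts these forests into [lam] edges of its
    cut. *)
Lemma blob_inv_contract B (i : 'I_k) L : blob_inv B -> scan_inv B i L -> Pi (x i) = Pi (y i) ->
  (forall j, (j < lam)%N -> L j.+1 (x i) = L j.+1 (y i)) ->
  blob_inv (merge B (B (x i)) (B (y i))).
Proof.
move=> [hB1 hB2] [L0 LS cnt sat] Pii hL; split; last exact: merge_refines.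
move=> A hA; have sA := hB1 A hA; apply: saturated_merge => //.
apply/eqP/negPn/negP => ne.
have : (lam <= #|[set i' in cut x y S A | (i' < i)%N]|)%N.
  apply: leq_trans (sat A sA).
  rewrite (_ : [set j : 'I_lam | _] = setT) ?cardsT ?card_ord //.
  apply/setP => j; rewrite !inE; apply/negP => /saturatedP/(_ _ _ (hL j (ltn_ord j))).
  by move/eqP; rewrite (negbTE ne).
rewrite leqNgt => /negP; apply; apply: leq_ltn_trans hA.
by apply: subset_leq_card; apply/subsetP => i'; rewrite !inE => /andP[].
Qed.

(** Every forest stays inside the classes of [Pi], so it keeps at least [classes Pi] labels. *)
Lemma scan_inv_certified B L : scan_inv B k L -> certified B.
Proof.
move=> [L0 LS cnt _]; apply: leq_trans cnt; apply: leq_add.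
  by apply: subset_leq_card; apply/subsetP => i h; rewrite inE h ltn_ord.
rewrite -[lam in leqLHS]card_ord -sum_nat_const; apply: leq_sum => j _.
by apply: classes_refines; apply: (LS j _).2.
Qed.

Lemma blob_inv_id : blob_inv id.
Proof.
split=> [A _|u v -> //].
by apply/saturatedP => u v ->.
Qed.

Lemma blob_inv_strong B : blob_inv B -> crossing B = set0 -> strong.
Proof.
move=> [hB _] cB A; have [h|] := ltnP #|cut x y S A| lam; last by right.
left; apply/eqP; rewrite cards_eq0; apply/eqP/setP => i; rewrite !inE; apply/negbTE.
rewrite negb_and negbK; have [iS|//] := boolP (i \in S); rewrite /=; apply/eqP.
apply: (saturatedP _ _ (hB A h)).
have : i \notin crossing B by rewrite cB inE.
by rewrite inE iS negbK => /eqP.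
Qed.

End Scan.

(** * Selecting a set of pairs without small cuts *)

(* Memory: row 0 of array 13 holds the contracted node of every cluster and row
   [j.+1] its component in the [j]-th forest; 7 marks the pairs still selected,
   8 and 9 give the clusters of their ends.  In one scan, 15 records whether a
   contraction occurred, 16 the row in which labels 17 and 18 are merged; 19
   records whether the round deleted a pair; 20 is [lam]; 21 to 23 are counters.
   The nodes are ['I_m.+1] rather than ['I_m] so that there is always one. *)
Definition n_exp : nexp := arr 0 (NConst 0).
Definition k_exp : nexp := arr 0 (NConst 1).
Definition m_exp : nexp := arr 0 (NConst 2).
Definition lab (j v : nexp) : nexp := NGet 13 j v (NConst 0).
Definition src_cl : nexp := arr 8 (var 21).
Definition tgt_cl : nexp := arr 9 (var 21).

Definition relabel_prog : cmd :=
  For 23 (incr m_exp)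
    (IfEq (lab (var 16) (var 23)) (var 17)
       (NSet 13 (var 16) (var 23) (NConst 0) (var 18)) Skip).

Definition select_prog : cmd :=
  Seq (set_var 16 (NConst 0))
   (For 22 (var 20)
     (IfEq (var 16) (NConst 0)
        (IfEq (lab (incr (var 22)) src_cl) (lab (incr (var 22)) tgt_cl) Skip
           (set_var 16 (incr (var 22)))) Skip)).

(** If no forest accepts the pair, variable 16 is 0 and the same relabelling acts on row 0, that is,
    contracts two blobs. The labels are copied to 17 and 18 because the relabelling overwrites the
    entries that they come from. *)
Definition place_prog : cmd :=
  Seq select_prog
  (Seq (IfEq (var 16) (NConst 0) (set_var 15 (NConst 1)) Skip)
  (Seq (set_var 17 (lab (var 16) src_cl))
  (Seq (set_var 18 (lab (var 16) tgt_cl)) relabel_prog))).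

(** After a contraction the rest of the scan is idle, since the forests were built from the old
    blobs. *)
Definition scan_step : cmd :=
  If (NLe (NConst 1) (arr 7 (var 21)))
    (IfEq (lab (NConst 0) src_cl) (lab (NConst 0) tgt_cl) Skip
      (IfEq (var 15) (NConst 0) place_prog Skip)) Skip.

Definition init_forests : cmd :=
  For 22 (var 20) (For 23 (incr m_exp)
    (NSet 13 (incr (var 22)) (var 23) (NConst 0) (lab (NConst 0) (var 23)))).

Definition scan_prog : cmd :=
  Seq (set_var 15 (NConst 0)) (Seq init_forests (For 21 k_exp scan_step)).

Definition delete_prog : cmd :=
  For 21 k_exp
    (If (NLe (NConst 1) (arr 7 (var 21)))
      (IfEq (lab (NConst 0) src_cl) (lab (NConst 0) tgt_cl) Skip
         (Seq (set_arr 7 (var 21) (NConst 0)) (set_var 19 (NConst 1)))) Skip).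

Definition round_prog : cmd :=
  Seq (For 23 (incr m_exp) (NSet 13 (NConst 0) (var 23) (NConst 0) (var 23)))
  (Seq (set_var 15 (NConst 1))
  (Seq (While (NLe (NConst 1) (var 15)) scan_prog)
  (Seq (set_var 19 (NConst 0)) delete_prog))).

Definition main_prog : cmd :=
  Seq (set_var 19 (NConst 1)) (While (NLe (NConst 1) (var 19)) round_prog).

(** * Correctness of the selection loop *)

Section MainLoop.
Variables (R : realType) (n k m lam : nat) (x y : 'I_k -> 'I_m.+1).
Implicit Types (st : state R) (L : nat -> 'I_m.+1 -> 'I_m.+1).

Let bd := (n + k + m + lam + 2)%N.

Definition ctx st :=
  [/\ nmem st 0 0 0 0 = n, nmem st 0 1 0 0 = k, nmem st 0 2 0 0 = m, nmem st 20 0 0 0 = lam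
    & forall i : 'I_k, nmem st 8 i 0 0 = x i /\ nmem st 9 i 0 0 = y i].

Definition labels st L :=
  forall j (v : 'I_m.+1), (j <= lam)%N -> nmem st 13 j v 0 = L j v.

Lemma agree_ctx W WR st st' : agree W WR st st' -> ~~ has (mem W) [:: 0; 8; 9; 20]%N ->
  ctx st -> ctx st'.
Proof.
move=> [ag _] /=; rewrite !negb_or => /and5P[h0 h8 h9 h20 _] [c1 c2 c3 c4 c5].
split; rewrite ?ag // => i; rewrite !ag //; exact: c5.
Qed.

Lemma agree_labels W WR st st' L : agree W WR st st' -> 13%N \notin W ->
  labels st L -> labels st' L.
Proof. by move=> [ag _] h hL j v hj; rewrite ag // hL. Qed.

Lemma agree_alive W WR st st' : agree W WR st st' -> 7%N \notin W ->
  output k st' = output k st.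
Proof. by move=> [ag _] h; apply/setP => i; rewrite !inE ag. Qed.

Lemma relabel_ok st L (s : nat) (a b : 'I_m.+1) : ctx st -> labels st L -> (s <= lam)%N ->
  nmem st 16 0 0 0 = s -> nmem st 17 0 0 0 = a -> nmem st 18 0 0 0 = b ->
  runs relabel_prog st (8 * bd)
    (fun st' => labels st' (fun j => if j == s then merge (L s) a b else L j)).
Proof.
move=> hc hL hs h16 h17 h18.
pose Inv (t : nat) st' := forall j (v : 'I_m.+1), (j <= lam)%N ->
  nmem st' 13 j v 0 = (if (j == s) && (v < t)%N then merge (L s) a b v else L j v).
apply: (runs_conseq (T := m.+1 * 5 + 2) (Q := Inv m.+1)); last 2 first.
- by rewrite /bd; lia.
- by move=> st' _ h j v hj; rewrite h // ltn_ord andbT; case: eqP.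
apply: runs_for => //.
- by move=> st' /agree_ctx - /(_ isT hc) [_ _ h _ _]; rewrite /= h addn1.
- move=> t st' ht [ag _] ctr hI; pose v0 := Ordinal ht.
  have r16 : nmem st' 16 0 0 0 = s by rewrite ag.
  have r17 : nmem st' 17 0 0 0 = a by rewrite ag.
  have r18 : nmem st' 18 0 0 0 = b by rewrite ag.
  have r13 : nmem st' 13 s t 0 = L s v0.
    by rewrite (hI s v0 hs) eqxx /= ltnn.
  apply: runs_ifeq; rewrite /= r16 r17 ctr r13 => e.
    apply: runs_nset => j v hj; rewrite /= r16 ctr r18 eqxx andbT.
    rewrite hI //; case: (j =P s) => [js|] //=.
    case: (v =P t :> nat) => [vt|vt].
      have -> : v = v0 by exact: val_inj.
      by rewrite leqnn /merge (val_inj e) eqxx.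
    by rewrite ltnS [(v <= t)%N]leq_eqVlt; move/eqP/negbTE: vt => ->.
  apply: runs_skip => j v hj; rewrite hI //; case: (j =P s) => [js|] //=.
  rewrite ltnS [(v <= t)%N]leq_eqVlt; case: (v =P t :> nat) => [vt|//].
  have -> : v = v0 by exact: val_inj.
  rewrite ltnn /merge js; case: eqP => // e'.
  by case: e; rewrite e'.
- by move=> j v hj; rewrite ltn0 andbF hL.
Qed.

Lemma select_ok st L (i : 'I_k) : ctx st -> labels st L -> nmem st 21 0 0 0 = i ->
  runs select_prog st (8 * bd)
    (fun st' => exists s, [/\ nmem st' 16 0 0 0 = s, (s <= lam)%N
      & if s is s'.+1 then L s (x i) != L s (y i)
        else forall j, (j < lam)%N -> L j.+1 (x i) = L j.+1 (y i)]).
Proof.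
move=> hc hL h21.
pose Inv (t : nat) st' := exists s, [/\ nmem st' 16 0 0 0 = s, (s <= t)%N
      & if s is s'.+1 then L s (x i) != L s (y i)
        else forall j, (j < t)%N -> L j.+1 (x i) = L j.+1 (y i)].
apply: (runs_weaken (T := 1 + (lam * 7 + 2)) (Q := Inv lam)); last by rewrite /bd; lia.
apply: runs_seq; apply: runs_nset.
set st1 := nupd _ _ _ _ _ _.
have hc1 : ctx st1 by [].
apply: runs_for => //.
- by move=> st' /agree_ctx - /(_ isT hc1) [_ _ _ h _].
- move=> t st' ht [ag _] ctr [s [r16 hs hI]].
  have [_ _ _ _ hxy] := hc1; have [hx hy] := hxy i.
  have r21 : nmem st' 21 0 0 0 = i by rewrite ag.
  have r8 : nmem st' 8 i 0 0 = x i by rewrite ag.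
  have r9 : nmem st' 9 i 0 0 = y i by rewrite ag.
  have r13 v : nmem st' 13 t.+1 (v : 'I_m.+1) 0 = L t.+1 v by rewrite ag //; apply: hL.
  apply: runs_ifeq; rewrite /= r16 => e.
    apply: runs_ifeq; rewrite /= ctr r21 r8 r9 addn1 !r13 => e'.
      apply: runs_skip; exists 0%N; split; rewrite ?r16 // => j; rewrite ltnS leq_eqVlt.
      case/orP => [/eqP -> |]; first exact: val_inj.
      by move: hI; rewrite e => /(_ j).
    apply: runs_nset; exists t.+1; split=> //=; first by rewrite ctr addn1.
    by apply/eqP => h; apply: e'; rewrite h.
  apply: (runs_conseq (T := 1) (Q := Inv t.+1)) => //; apply: runs_skip; exists s; split=> //.
    by apply: leq_trans hs _.
  by case: s {r16 hs} e hI.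
- by exists 0%N.
Qed.

Lemma place_ok st L (i : 'I_k) : ctx st -> labels st L -> nmem st 21 0 0 0 = i ->
  nmem st 15 0 0 0 = 0%N ->
  runs place_prog st (24 * bd)
    (fun st' => exists s, [/\ (s <= lam)%N, nmem st' 15 0 0 0 = (s == 0%N),
        labels st' (fun j => if j == s then merge (L s) (L s (x i)) (L s (y i)) else L j)
      & if s is s'.+1 then L s (x i) != L s (y i)
        else forall j, (j < lam)%N -> L j.+1 (x i) = L j.+1 (y i)]).
Proof.
move=> hc hL h21 h15.
have -> : (24 * bd = 8 * bd + ((8 * bd - 2) + (1 + (1 + 8 * bd))))%N by rewrite /bd; lia.
apply: runs_seq; apply: runs_conseq (select_ok hc hL h21) _ _ => // st1 ag1 [s [r16 hs hsel]].
have hc1 : ctx st1 by apply: agree_ctx ag1 _ hc.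
have hL1 : labels st1 L by apply: agree_labels ag1 _ hL.
have r21 : nmem st1 21 0 0 0 = i by rewrite (proj1 ag1).
have r15 : nmem st1 15 0 0 0 = 0%N by rewrite (proj1 ag1).
apply: runs_seq.
apply: (runs_conseq (T := 3) (Q := fun st' => nmem st' 15 0 0 0 = (s == 0%N))).
- apply: runs_ifeq; rewrite /= r16 => e.
    by apply: runs_nset; rewrite /= e.
  by apply: runs_skip; rewrite r15; move/eqP/negbTE: e => ->.
- by rewrite /bd; lia.
move=> st2 ag2 r15'.
have hc2 : ctx st2 by apply: agree_ctx ag2 _ hc1.
have hL2 : labels st2 L by apply: agree_labels ag2 _ hL1.
have r21' : nmem st2 21 0 0 0 = i by rewrite (proj1 ag2).
have r16' : nmem st2 16 0 0 0 = s by rewrite (proj1 ag2).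
have [_ _ _ _ hxy] := hc2; have [hx hy] := hxy i.
apply: runs_seq; apply: runs_nset; apply: runs_seq; apply: runs_nset.
set st4 := nupd _ _ _ _ _ _.
apply: (runs_conseq (@relabel_ok st4 L s (L s (x i)) (L s (y i)) _ _ _ _ _ _)) => //.
- by rewrite /= r16' r21' hx hL2.
- by rewrite /= r16' r21' hy hL2.
by move=> st' ag' hL'; exists s; split=> //; rewrite (proj1 ag').
Qed.

Section Round.
Variables (S : {set 'I_k}) (Pi : 'I_m.+1 -> 'I_m.+1).
Hypothesis S_Pi : forall i, i \in S -> Pi (x i) = Pi (y i).

Let blob_inv := blob_inv x y S lam Pi.
Let scan_inv := scan_inv x y S lam Pi.
Let certified := certified x y S lam Pi.

Lemma scan_step_ok st L B (i : 'I_k) : ctx st -> labels st L -> output k st = S ->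
  blob_inv B -> nmem st 21 0 0 0 = i ->
  (nmem st 15 0 0 0 = 0%N /\ scan_inv B i L) \/
  (nmem st 15 0 0 0 = 1%N /\ blob_inv (L 0%N) /\ (classes (L 0%N) < classes B)%N) ->
  runs scan_step st (30 * bd) (fun st' => exists2 L', labels st' L' &
    (nmem st' 15 0 0 0 = 0%N /\ scan_inv B i.+1 L') \/
    (nmem st' 15 0 0 0 = 1%N /\ blob_inv (L' 0%N) /\ (classes (L' 0%N) < classes B)%N)).
Proof.
move=> hc hL hS hB h21 hI.
have [_ _ _ _ hxy] := hc; have [hx hy] := hxy i.
apply: (runs_weaken (T := (24 * bd).+2.+2.+1)); last by rewrite /bd; lia.
have iS : (i \in S) = (nmem st 7 i 0 0 != 0%N) by rewrite -hS inE.
have skip : ~~ ((i \in S) && (L 0%N (x i) != L 0%N (y i))) \/ nmem st 15 0 0 0 <> 0%N ->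
  exists2 L', labels st L' &
    (nmem st 15 0 0 0 = 0%N /\ scan_inv B i.+1 L') \/
    (nmem st 15 0 0 0 = 1%N /\ blob_inv (L' 0%N) /\ (classes (L' 0%N) < classes B)%N).
  move=> h; exists L => //; case: hI => [[h15 hs]|]; last by right.
  left; split=> //; case: h => // h; apply: scan_inv_skip => //.
  by case: hs h => -> .
have skipr T Q : (0 < T)%N -> Q st -> runs Skip st T Q.
  by move=> hT hQ; apply: runs_conseq (runs_skip hQ) _ _.
apply: runs_if; rewrite /= h21 => iA; last first.
  apply: skipr => //; apply: skip; left; rewrite iS negb_and.
  by move: iA; rewrite lt0n => ->.
apply: runs_ifeq; rewrite /= h21 hx hy !hL // => e.
  by apply: skipr => //; apply: skip; left; rewrite (val_inj e) eqxx andbF.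
apply: runs_ifeq => /= h15; last by apply: skipr => //; [rewrite /bd; lia|apply: skip; right].
case: hI => [[_ hs]|[]]; last by rewrite h15.
have iS' : i \in S by rewrite iS -lt0n.
have L0 : L 0%N = B by case: hs.
have Bne : B (x i) != B (y i) by rewrite -L0; apply/eqP => h; apply: e; rewrite h.
apply: runs_conseq (place_ok hc hL h21 h15) _ _ => // st' _ [s [hs' r15 hL' hsel]].
exists (fun j => if j == s then merge (L s) (L s (x i)) (L s (y i)) else L j) => //.
case: s hs' r15 hL' hsel => [|s] hs' r15 hL' hsel.
  right; split=> //=; split; last by rewrite L0 -(classes_merge Bne).
  by rewrite L0; apply: (blob_inv_contract hB hs (S_Pi iS')).
left; split=> //; apply: (scan_inv_place (j := s) hs' iS' Bne (S_Pi iS') hsel _ _ hs).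
  by rewrite eqxx.
by move=> j' /eqP/negbTE ->.
Qed.

Lemma init_forests_ok st L : ctx st -> labels st L ->
  runs init_forests st (8 * bd * bd) (fun st' => labels st' (fun=> L 0%N)).
Proof.
move=> hc hL.
pose Inv (t : nat) st' := labels st' (fun j => if (j <= t)%N then L 0%N else L j).
apply: (runs_conseq (T := lam * (m.+1 * 3 + 2).+2 + 2) (Q := Inv lam)); last 2 first.
- by rewrite /bd; nia.
- by move=> st' _ h j v hj; rewrite h // hj.
apply: runs_for => //.
- by move=> st' /agree_ctx - /(_ isT hc) [_ _ _ h _].
- move=> t st1 ht ag1 ctr hI; have hc1 : ctx st1 by apply: agree_ctx ag1 _ hc.
  pose Inv' (u : nat) st' := forall j (v : 'I_m.+1), (j <= lam)%N ->
    nmem st' 13 j v 0 = (if (j <= t)%N || (j == t.+1) && (v < u)%N then L 0%N v else L j v).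
  apply: (runs_conseq (T := m.+1 * 3 + 2) (Q := Inv' m.+1)) => //; last first.
    move=> st' _ h j v hj; rewrite h // ltn_ord andbT.
    have -> : (j <= t.+1)%N = (j <= t)%N || (j == t.+1) by rewrite leq_eqVlt ltnS orbC.
    by case: ifP.
  apply: runs_for => //.
  + by move=> st' /agree_ctx - /(_ isT hc1) [_ _ h _ _]; rewrite /= h addn1.
  + move=> u st2 hu [ag2 _] ctr2 hI2; pose v0 := Ordinal hu.
    have r22 : nmem st2 22 0 0 0 = t by rewrite ag2.
    apply: runs_nset => j v hj; rewrite /= r22 ctr2 addn1 eqxx andbT.
    have -> : nmem st2 13 0 u 0 = L 0%N v0 by rewrite (hI2 0%N v0).
    rewrite hI2 //; case: (j =P t.+1) => [jt|//] /=.
    case: (v =P u :> nat) => [vu|vu].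
      by have -> : v = v0 by [exact: val_inj]; rewrite leqnn orbT.
    by rewrite ltnS [(v <= u)%N]leq_eqVlt; move/eqP/negbTE: vu => ->.
  + by move=> j v hj; rewrite hI // ltn0 andbF orbF; case: ifP.
- by move=> j v hj; rewrite hL //; case: j hj => [|j].
Qed.

Lemma scan_ok st L : ctx st -> labels st L -> output k st = S -> blob_inv (L 0%N) ->
  runs scan_prog st (50 * bd * bd) (fun st' => exists2 L', labels st' L' &
    (nmem st' 15 0 0 0 = 0%N /\ L' 0%N = L 0%N /\ certified (L 0%N)) \/
    (nmem st' 15 0 0 0 = 1%N /\ blob_inv (L' 0%N) /\ (classes (L' 0%N) < classes (L 0%N))%N)).
Proof.
move=> hc hL hS hB.
apply: (runs_weaken (T := 1 + (8 * bd * bd + (k * (30 * bd).+2 + 2)))); last by rewrite /bd; nia.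
apply: runs_seq; apply: runs_nset; set st1 := nupd _ _ _ _ _ _.
have hc1 : ctx st1 by [].
have hL1 : labels st1 L by [].
apply: runs_seq; apply: runs_conseq (init_forests_ok hc1 hL1) _ _ => // st2 ag2 hL2.
have hc2 : ctx st2 by apply: agree_ctx ag2 _ hc1.
have hS2 : output k st2 = S by rewrite (agree_alive ag2).
have r15 : nmem st2 15 0 0 0 = 0%N by rewrite (proj1 ag2).
pose Inv (t : nat) st' := exists2 L', labels st' L' &
    (nmem st' 15 0 0 0 = 0%N /\ scan_inv (L 0%N) t L') \/
    (nmem st' 15 0 0 0 = 1%N /\ blob_inv (L' 0%N) /\ (classes (L' 0%N) < classes (L 0%N))%N).
apply: (runs_conseq (T := k * (30 * bd).+2 + 2) (Q := Inv k)) => //; last first.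
  move=> st' _ [L' hL' [[h hs]|h]]; exists L' => //; [left|by right].
  by split=> //; split; [case: hs|exact: scan_inv_certified hs].
apply: runs_for => //.
- by move=> st' /agree_ctx - /(_ isT hc2) [_ h _ _ _].
- move=> t st3 ht ag3 ctr [L' hL' hI].
  have hc3 : ctx st3 by apply: agree_ctx ag3 _ hc2.
  have hS3 : output k st3 = S by rewrite (agree_alive ag3).
  exact: (@scan_step_ok st3 L' (L 0%N) (Ordinal ht)).
- by exists (fun=> L 0%N) => //; left; split=> //; apply: scan_inv0.
Qed.

Lemma delete_ok st L : ctx st -> labels st L -> output k st = S -> nmem st 19 0 0 0 = 0%N ->
  runs delete_prog st (10 * bd) (fun st' =>
    output k st' = S :\: crossing x y S (L 0%N) /\
    nmem st' 19 0 0 0 = (crossing x y S (L 0%N) != set0)).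
Proof.
move=> hc hL hS h19; set D := crossing _ _ _ _.
pose Inv (t : nat) st' := output k st' = S :\: [set i in D | (i < t)%N] /\
   nmem st' 19 0 0 0 = ([set i in D | (i < t)%N] != set0).
have pre0 : [set i in D | (i < 0)%N] = set0 by apply/setP => i; rewrite !inE andbF.
have prek : [set i in D | (i < k)%N] = D.
  by apply/setP => i; rewrite !inE ltn_ord andbT.
apply: (runs_conseq (T := k * 7 + 2) (Q := Inv k)); last 2 first.
- by rewrite /bd; lia.
- by move=> st' _; rewrite /Inv prek.
apply: runs_for => //.
- by move=> st' /agree_ctx - /(_ isT hc) [_ h _ _ _].
- move=> t st' ht ag ctr [hA hdel]; pose i := Ordinal ht.
  have hc' : ctx st' by apply: agree_ctx ag _ hc.
  have hL' : labels st' L by apply: agree_labels ag _ hL.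
  have [_ _ _ _ hxy] := hc'; have [hx hy] := hxy i.
  have iS : (nmem st' 7 t 0 0 != 0%N) = (i \in S).
    have : (i \in output k st') = (i \in S :\: [set i in D | (i < t)%N]) by rewrite hA.
    by rewrite inE => ->; rewrite !inE ltnn andbF.
  have skip : i \notin D -> Inv t.+1 st' by move=> h; rewrite /Inv (prefix_skip (i := i)).
  have skipr T Q : (0 < T)%N -> Q st' -> runs Skip st' T Q.
    by move=> hT hQ; apply: runs_conseq (runs_skip hQ) _ _.
  apply: (runs_if (T := 4)); rewrite /= ctr => iA; last first.
    apply: skipr => //; apply: skip; rewrite inE negb_and -iS.
    by move: iA; rewrite lt0n => ->.
  rewrite lt0n iS in iA.
  apply: runs_ifeq; rewrite /= ctr hx hy !hL' // => e.
    by apply: skipr => //; apply: skip; rewrite inE (val_inj e) eqxx andbF.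
  have iD : i \in D by rewrite inE iA; apply/eqP => h; apply: e; rewrite h.
  apply: (runs_seq (T1 := 1) (T2 := 1)); apply: runs_nset; apply: runs_nset.
  split; last first.
    rewrite /=; have -> // : [set i0 in D | (i0 < t.+1)%N] != set0.
    by apply/set0Pn; exists i; rewrite inE iD /=.
  apply/setP => i'; rewrite !inE /= ctr !eqxx !andbT.
  have : (i' \in output k st') = (i' \in S :\: [set i in D | (i < t)%N]) by rewrite hA.
  rewrite !inE; case: (i' =P t :> nat) => [e'|ne].
    have -> : i' = i by exact: val_inj.
    by move: iD; rewrite inE => -> /=; rewrite leqnn.
  by move=> ->; rewrite ltnS [(i' <= t)%N]leq_eqVlt; move/eqP/negbTE: ne => ->.
- by rewrite /Inv pre0 setD0 eqxx.
Qed.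

Lemma round_ok st L0 : ctx st -> labels st L0 -> output k st = S ->
  runs round_prog st (80 * bd * bd * bd) (fun st' => exists B,
    [/\ blob_inv B, certified B, output k st' = S :\: crossing x y S B,
      nmem st' 19 0 0 0 = (crossing x y S B != set0) & exists L, labels st' L]).
Proof.
move=> hc hL0 hS.
apply: (runs_weaken (T := (m.+1 * 3 + 2) + (1 + ((m.+2 * (50 * bd * bd).+1 + 1) + (1 + 10 * bd))))); last first.
  have : (m.+2 <= bd)%N by rewrite /bd; lia.
  have : (1 <= bd)%N by rewrite /bd; lia.
  move: bd => B h1 h2.
  have : (m.+2 * (50 * B * B).+1 <= B * (50 * B * B).+1)%N by rewrite leq_mul2r h2 orbT.
  nia.
apply: runs_seq.
pose Inv (t : nat) st' := labels st' (fun j v => if (j == 0)%N && (v < t)%N then v else L0 j v).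
apply: (runs_conseq (T := m.+1 * 3 + 2) (Q := Inv m.+1)) => //.
  apply: runs_for => //.
  - by move=> st' /agree_ctx - /(_ isT hc) [_ _ h _ _]; rewrite /= h addn1.
  - move=> t st' ht _ ctr hI; apply: runs_nset => j v hj; rewrite /= ctr eqxx andbT hI //.
    case: (j =P 0%N) => //= _; case: (v =P t :> nat) => [vt|vt]; first by rewrite -vt ltnSn.
    by rewrite ltnS [(v <= t)%N]leq_eqVlt; move/eqP/negbTE: vt => ->.
  - by move=> j v hj; rewrite andbF hL0.
move=> st1 ag1 hL1; apply: runs_seq; apply: runs_nset.
set st2 := nupd _ _ _ _ _ _.
have hc1 : ctx st1 by apply: agree_ctx ag1 _ hc.
have hS2 : output k st2 = S by rewrite -hS -(agree_alive ag1).
have hL2 : labels st2 (fun j v => if (j == 0)%N && (v < m.+1)%N then v else L0 j v) by [].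
set L1 := fun _ => _ in hL2.
have L1id : L1 0%N =1 id by move=> v; rewrite /L1 /= ltn_ord.
(* Each contraction lowers the number of blobs, which is the variant; a scan without contraction
   yields the certificate and ends the loop. *)
pose WInv (mu : nat) st' := [/\ ctx st', output k st' = S & exists2 L, labels st' L &
   blob_inv (L 0%N) /\
   ((nmem st' 15 0 0 0 = 1%N /\ (classes (L 0%N) < mu)%N) \/
    (nmem st' 15 0 0 0 = 0%N /\ certified (L 0%N)))].
apply: runs_seq.
apply: runs_conseq (runs_while (T := 50 * bd * bd) (Inv := WInv) (mu := m.+2) _ _) _ _.
- move=> mu st' [hc' hS' [L hL [hB [[h15 hmu]|[h15 _]]]]] /=; rewrite h15 // => _.
  apply: runs_conseq (scan_ok hc' hL hS' hB) _ _ => // st3 ag3 [L' hL' hres].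
  have hc3 : ctx st3 by apply: agree_ctx ag3 _ hc'.
  have hS3 : output k st3 = S by rewrite (agree_alive ag3).
  case: hres => [[h15' [L'0 hcert]]|[h15' [hB' hlt]]].
    exists 0%N; first by lia.
    split=> //; exists L' => //; rewrite L'0; split=> //; by right.
  exists (classes (L 0%N)) => //.
  by split=> //; exists L' => //; split=> //; left.
- split=> //; exists L1 => //; split.
    have -> : L1 0%N = id by apply/funext.
    exact: blob_inv_id.
  by left; split=> //; rewrite ltnS; apply: leq_trans (classes_le _) _; rewrite card_ord.
- by [].
move=> st3 ag3 [[mu [hc3 hS3 [L hL [hB hres]]]]] /=; rewrite -ltnNge ltnS leqn0 => /eqP h15.
case: hres => [[]|[_ hcert]]; first by rewrite h15.
apply: runs_seq; apply: runs_nset; set st4 := nupd _ _ _ _ _ _.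
have hc4 : ctx st4 by [].
have hL4 : labels st4 L by [].
have hS4 : output k st4 = S by rewrite -hS3.
apply: runs_conseq (delete_ok hc4 hL4 hS4 _) _ _ => // st5 ag5 [hS5 h19].
by exists (L 0%N); split=> //; exists L; apply: agree_labels ag5 _ hL4.
Qed.

End Round.

(** The blobs of a round become the [Pi] of the next one, since the pairs crossing them have been
    deleted; the certificates telescope, and there are never more than [m.+1] classes. A round that
    deletes nothing has no crossing pair, hence leaves no small nonempty cut. *)
Lemma main_ok st L (S0 : {set 'I_k}) (Pi0 : 'I_m.+1 -> 'I_m.+1) :
  ctx st -> labels st L -> output k st = S0 ->
  (forall i, i \in S0 -> Pi0 (x i) = Pi0 (y i)) ->
  runs main_prog st (90 * bd * bd * bd * bd) (fun st' =>
    [/\ output k st' \subset S0, forall i, i \in S0 -> x i = y i -> i \in output k st',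
        (#|S0| + lam * classes Pi0 <= #|output k st'| + lam * m.+1)%N
      & strong x y (output k st') lam]).
Proof.
move=> hc hL hS0 hPi0.
apply: (runs_weaken (T := 1 + (k.+2 * (80 * bd * bd * bd).+1 + 1))); last first.
  have : (k.+2 <= bd)%N by rewrite /bd; lia.
  have : (1 <= bd)%N by rewrite /bd; lia.
  move: bd => B h1 h2.
  have : (k.+2 * (80 * B * B * B).+1 <= B * (80 * B * B * B).+1)%N by rewrite leq_mul2r h2 orbT.
  have : (1 <= B * B * B * B)%N by rewrite !muln_gt0 h1.
  have : (B <= B * B * B * B)%N by rewrite -[leqLHS]mul1n leq_mul2r !muln_gt0 h1 orbT.
  rewrite mulnS; lia.
apply: runs_seq; apply: runs_nset; set st1 := nupd _ _ _ _ _ _.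
pose WInv (mu : nat) st' := [/\ ctx st', exists L, labels st' L & let S := output k st' in
   [/\ S \subset S0, forall i, i \in S0 -> x i = y i -> i \in S,
     exists2 Pi, (forall i, i \in S -> Pi (x i) = Pi (y i)) &
       (#|S0| + lam * classes Pi0 <= #|S| + lam * classes Pi)%N
     & (nmem st' 19 0 0 0 = 1%N /\ (#|S| < mu)%N) \/
       (nmem st' 19 0 0 0 = 0%N /\ strong x y S lam)]].
apply: runs_conseq (runs_while (T := 80 * bd * bd * bd) (Inv := WInv) (mu := k.+2) _ _) _ _.
- move=> mu st' [hc' [L' hL'] [h1 h2 [Pi hPi h3] [[h19 hmu]|[h19 _]]]] /=; rewrite h19 // => _.
  apply: runs_conseq (round_ok hPi hc' hL' (erefl _)) _ _ => // st2 ag2.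
  move=> [B [hB hcert hS2 h19' hL2]].
  have hc2 : ctx st2 by apply: agree_ctx ag2 _ hc'.
  have dsub : crossing x y (output k st') B \subset output k st'.
    by apply/subsetP => i; rewrite inE => /andP[].
  have cS2 : (#|output k st2| + #|crossing x y (output k st') B| = #|output k st'|)%N.
    by rewrite hS2 cardsD (setIidPr dsub) subnK // subset_leq_card.
  exists (#|output k st'|) => //; split=> //; split.
  + by apply: subset_trans h1; rewrite hS2 subsetDl.
  + by move=> i iS e; rewrite hS2 in_setD in_set e eqxx andbF /=; apply: h2.
  + exists B.
      move=> i; rewrite hS2 in_setD in_set negb_and negbK => /andP[+ h]; rewrite h /=.
      by move/eqP.
    move: hcert; rewrite /certified; lia.
  + rewrite h19'; have [e|ne] := eqVneq (crossing x y (output k st') B) set0.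
      by right; split=> //; rewrite hS2 e setD0; apply: blob_inv_strong hB e.
    by left; split=> //; rewrite -cS2 -[ltnLHS]addn0 ltn_add2l card_gt0.
- have hS1 : output k st1 = S0 by rewrite -hS0.
  split=> //; first by exists L.
  rewrite /= hS1; split=> //.
  + by exists Pi0.
  + left; split=> //; rewrite ltnS; apply: leq_trans (max_card _) _.
    by rewrite card_ord.
- by [].
move=> st2 _ [[mu [_ _ [h1 h2 [Pi _ h3] h4]]]] /=; rewrite -ltnNge ltnS leqn0 => /eqP h19.
split=> //; last by case: h4 => [[]|[]//]; rewrite h19.
apply: leq_trans h3 _; rewrite leq_add2l leq_mul2l.
by have := classes_le Pi; rewrite card_ord => ->; rewrite orbT.
Qed.

End MainLoop.

(* Arrays 10 and 11 mark the sources and targets that lie in a cluster, and 14 the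
   clusters of load at least [cap I / 8]. *)
Definition assign_prog (a b c : nat) : cmd :=
  For 21 k_exp (For 22 m_exp
    (If (NLe (NConst 1) (NGet 6 (var 22) (arr a (var 21)) (NConst 0)))
        (Seq (set_arr b (var 21) (var 22)) (set_arr c (var 21) (NConst 1))) Skip)).

(** Multiplication is replaced by adding 8 for every terminal of the cluster. *)
Definition big_prog : cmd :=
  For 21 m_exp
   (Seq (RSet 2 (NConst 0) (RConst 0))
   (Seq (For 22 n_exp
           (If (NLe (NConst 1) (NGet 6 (var 21) (var 22) (NConst 0)))
              (RSet 2 (NConst 0) (RAdd (RGet 2 (NConst 0)) (RConst 8))) Skip))
        (If (RLe (RGet 0 (NConst 0)) (RGet 2 (NConst 0)))
              (set_arr 14 (var 21) (NConst 1)) Skip))).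

Definition alive_prog : cmd :=
  For 21 k_exp
    (If (NLe (NConst 2) (NAdd (arr 10 (var 21)) (arr 11 (var 21))))
       (IfEq src_cl tgt_cl (set_arr 7 (var 21) (NConst 1))
          (If (NLe (NConst 2) (NAdd (arr 14 src_cl) (arr 14 tgt_cl)))
             (set_arr 7 (var 21) (NConst 1)) Skip)) Skip).

(** Reals cannot be rounded, so the integer part of [cap I / 128] is counted up, with [128 * lam.+1]
    kept in a real cell. Stopping at [n] is harmless: cuts have fewer than [n] pairs, so a larger
    threshold would demand nothing more. *)
Definition lam_prog : cmd :=
  Seq (RSet 2 (NConst 0) (RConst 128))
   (For 21 n_exp
     (If (RLe (RGet 2 (NConst 0)) (RGet 0 (NConst 0)))
        (Seq (set_var 20 (incr (var 20)))
             (RSet 2 (NConst 0) (RAdd (RGet 2 (NConst 0)) (RConst 128)))) Skip)).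

Definition find_prog : cmd :=
  Seq (assign_prog 2 8 10) (Seq (assign_prog 3 9 11)
   (Seq big_prog (Seq alive_prog (Seq lam_prog main_prog)))).

(** * Correctness of the preprocessing and of the whole program *)

Section Find.
Variables (R : realType) (n k m : nat) (I : mcnc R n k) (T : 'I_m -> cluster n).
Hypothesis cap0 : 0 <= cap I.
Hypothesis terms_inj : forall v j j', v \in cl_terms (T j) -> v \in cl_terms (T j') -> j = j'.
Implicit Types st : state R.

Definition big (j : 'I_m) : bool := cap I <= 8 * (load (T j))%:R.

Definition inst st := [/\ nmem st 0 0 0 0 = n, nmem st 0 1 0 0 = k, nmem st 0 2 0 0 = m,
    rmem st 0 0 = cap I
  & [/\ forall i : 'I_k, nmem st 2 i 0 0 = src I i, forall i : 'I_k, nmem st 3 i 0 0 = tgt I i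
     & forall (j : 'I_m) (v : 'I_n), nmem st 6 j v 0 = (v \in cl_terms (T j))]].

Lemma sum_ord_pick (l : nat) (f : 'I_l -> nat) (i0 : 'I_l) :
  (\sum_(i < l | i0 == i :> nat) f i = f i0)%N.
Proof. by rewrite (big_pred1 i0) // => i; rewrite /= eq_sym. Qed.

Lemma inst_input : inst (input I T).
Proof.
split=> //; split=> [i|i|j v] /=; rewrite ?sum_ord_pick //.
congr (nat_of_bool _); apply/existsP/idP => [[j' /existsP[v' /and3P[/eqP e /eqP e' h]]]|h].
  by rewrite (val_inj e) (val_inj e').
by exists j; apply/existsP; exists v; rewrite !eqxx.
Qed.

Lemma agree_inst W WR st st' : agree W WR st st' -> ~~ has (mem W) [:: 0; 2; 3; 6]%N ->
  0%N \notin WR -> inst st -> inst st'.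
Proof.
move=> [ag agr] /=; rewrite !negb_or => /and5P[h0 h2 h3 h6 _] hr [c1 c2 c3 c4 [c5 c6 c7]].
by split; rewrite ?ag ?agr //; split=> *; rewrite ag.
Qed.

Definition located (f : 'I_k -> 'I_n) (t : nat) (i : 'I_k) : bool :=
  [exists j : 'I_m, (j < t)%N && (f i \in cl_terms (T j))].

(** The last clause makes every entry a valid node of ['I_m.+1], also for a terminal that lies in no
    cluster. *)
Definition assigned (f : 'I_k -> 'I_n) (b c t : nat) st (i : 'I_k) :=
  [/\ nmem st c i 0 0 = located f t i,
      forall j : 'I_m, (j < t)%N -> f i \in cl_terms (T j) -> nmem st b i 0 0 = j
    & (nmem st b i 0 0 <= m)%N].

Lemma assign_ok (f : 'I_k -> 'I_n) (a b c : nat) st :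
  b != c -> (a < 7)%N -> (b \notin [:: 21; 22])%N -> (c \notin [:: 21; 22])%N ->
  (7 <= b)%N -> (7 <= c)%N ->
  inst st -> (forall i : 'I_k, nmem st a i 0 0 = f i) ->
  (forall i, nmem st b i 0 0 = 0%N /\ nmem st c i 0 0 = 0%N) ->
  runs (assign_prog a b c) st (k * (m * 5 + 2).+2 + 2)
    (fun st' => forall i, assigned f b c m st' i).
Proof.
move=> /negbTE bc a7 hb hc b7 c7 hi ha h0.
have cb : (c == b) = false by rewrite eq_sym.
move: hb hc; rewrite !inE !negb_or => /andP[/negbTE b21 /negbTE b22] /andP[/negbTE c21 /negbTE c22].
have low W d : all (leq 7) W -> (d < 7)%N -> d \notin W.
  by move=> /allP h hd; apply/negP => /h; rewrite leqNgt hd.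
have fresh i : assigned f b c 0 st i.
  have [hb0 hc0] := h0 i; split; rewrite ?hb0 ?hc0 //.
  by rewrite /located; case: existsP => // -[j].
pose Inv (t : nat) st' := forall i : 'I_k, assigned f b c (if (i < t)%N then m else 0%N) st' i.
apply: (runs_conseq (T := k * (m * 5 + 2).+2 + 2) (Q := Inv k)) => //; last first.
  by move=> st' _ h i; have := h i; rewrite ltn_ord.
apply: runs_for.
- by rewrite /= !inE ![21%N == _]eq_sym b21 c21.
- by move=> st' [ag _]; rewrite /= ag; [case: hi|apply: low; rewrite //= b7 c7].
- by move=> t st' r h i; have := h i; rewrite /assigned /= b21 c21.
- move=> t st1 ht ag1 ctr1 hI1; pose i0 := Ordinal ht.
  pose Inv' (u : nat) st' := forall i : 'I_k,
    assigned f b c (if (i < t)%N then m else if i == t :> nat then u else 0%N) st' i.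
  apply: (runs_conseq (T := m * 5 + 2) (Q := Inv' m)) => //; last first.
    by move=> st' _ h i; have := h i; rewrite ltnS [(i <= t)%N]leq_eqVlt; case: eqP => [->|//]; rewrite ltnn.
  apply: runs_for.
  + by rewrite /= !inE ![22%N == _]eq_sym b22 c22.
  + move=> st' [ag _]; rewrite /= ag; last by apply: low; rewrite //= b7 c7.
    by rewrite (proj1 ag1); [case: hi|apply: low; rewrite //= b7 c7].
  + by move=> u st' r h i; have := h i; rewrite /assigned /= b22 c22.
  + move=> u st2 hu [ag2 _] ctr2 hI2; pose j0 := Ordinal hu.
    have r21 : nmem st2 21 0 0 0 = t.
      by rewrite ag2 // !inE ![21%N == _]eq_sym b21 c21.
    have r6 : nmem st2 6 u (f i0) 0 = (f i0 \in cl_terms (T j0)).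
      rewrite ag2; last by apply: low; rewrite //= b7 c7.
      rewrite (proj1 ag1); last by apply: low; rewrite //= b7 c7.
      by case: hi => _ _ _ _ [_ _ h6]; exact: (h6 j0).
    have ra : nmem st2 a t 0 0 = f i0.
      rewrite ag2; last by apply: low; rewrite //= b7 c7.
      by rewrite (proj1 ag1); [rewrite -ha|apply: low; rewrite //= b7 c7].
    have hstep i : i != i0 -> (i == t :> nat) = false.
      by move=> ne; apply: contraNF ne => /eqP h; apply/eqP/val_inj.
    apply: (runs_if (T := 2)); rewrite /= r21 ra ctr2 r6 => hin.
      rewrite lt0b in hin.
      apply: (runs_seq (T1 := 1) (T2 := 1)); apply: runs_nset; apply: runs_nset => i.
      have := hI2 i; rewrite /assigned /= r21 ctr2 [21%N == b]eq_sym b21 !eqxx bc cb /=.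
      have [->|ne] := eqVneq i i0; last first.
        by rewrite (hstep _ ne).
      rewrite /= ltnn eqxx /= => -[_ _ _]; split.
      * have -> // : located f u.+1 i0.
        by apply/existsP; exists j0; rewrite /= ltnSn.
      * by move=> j hj hfj; rewrite (terms_inj hfj hin).
      * exact: ltnW.
    apply: (runs_weaken (T := 1)) => //; apply: runs_skip => i; have := hI2 i.
    have [->|ne] := eqVneq i i0; last by rewrite (hstep _ ne).
    rewrite /= ltnn eqxx => -[h1 h2 h3].
    have nj0 (j : 'I_m) : f i0 \in cl_terms (T j) -> (j < u.+1)%N = (j < u)%N.
      move=> hj; rewrite ltnS leq_eqVlt; case: eqP => //= e.
      by move: hin; rewrite -(_ : j = j0) ?hj //; apply: val_inj.
    split=> //.
      rewrite h1; congr (nat_of_bool _); apply: eq_existsb => j.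
      by case hj: (f i0 \in _); rewrite ?andbF // nj0.
    by move=> j hj hfj; apply: h2 => //; rewrite -nj0.
  + move=> i; have := hI1 i; case: ifP => // _; by case: ifP.
- by move=> i; exact: fresh.
Qed.

Lemma big_ok st : inst st -> (forall j, nmem st 14 j 0 0 = 0%N) ->
  runs big_prog st (m * (1 + (n * 4 + 2 + 2)).+2 + 2)
    (fun st' => (forall j : 'I_m, nmem st' 14 j 0 0 = big j) /\ nmem st' 14 m 0 0 = 0%N).
Proof.
move=> hi h0.
pose Inv (t : nat) st' := (forall j : 'I_m, nmem st' 14 j 0 0 = (j < t)%N && big j) /\
  nmem st' 14 m 0 0 = 0%N.
apply: (runs_conseq (T := m * (1 + (n * 4 + 2 + 2)).+2 + 2) (Q := Inv m)) => //; last first.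
  by move=> st' _ [h h'];split=> // j; have := h j; rewrite ltn_ord.
apply: runs_for => //.
- by move=> st' /agree_inst - /(_ isT isT hi) [_ _ h _ _].
- move=> t st1 ht ag1 ctr1 [hI1 hI1']; pose j0 := Ordinal ht.
  have hi1 : inst st1 by apply: agree_inst ag1 _ _ hi.
  apply: runs_seq; apply: runs_rset; set st2 := rupd _ _ _ _.
  have hi2 : inst st2 by [].
  apply: runs_seq.
  pose Inv' (u : nat) st' :=
    rmem st' 2 0 = 8 * #|[set v in cl_terms (T j0) | (v < u)%N]|%:R.
  apply: (runs_conseq (T := n * 4 + 2) (Q := Inv' n)) => //.
    apply: runs_for => //.
    + by move=> st' /agree_inst - /(_ isT isT hi2) [h _ _ _ _].
    + move=> u st3 hu ag3 ctr3 hI3; pose v0 := Ordinal hu.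
      have [_ _ _ _ [_ _ h6]] : inst st3 by apply: agree_inst ag3 _ _ hi2.
      have r21 : nmem st3 21 0 0 0 = t by rewrite (proj1 ag3).
      apply: (runs_if (T := 1)); rewrite /= r21 ctr3 (h6 j0 v0) lt0b => hin.
        apply: runs_rset; rewrite /Inv' /= hI3 -natr1.
        have -> : #|[set v in cl_terms (T j0) | (v < u.+1)%N]|
             = #|[set v in cl_terms (T j0) | (v < u)%N]|.+1.
          exact: (prefix_add (i := v0)).
        by rewrite -natr1; ring.
      apply: runs_skip; rewrite /Inv' hI3; congr (_ * _%:R).
      by rewrite (prefix_skip (i := v0)).
    + rewrite /Inv' /= (_ : [set v in _ | _] = set0) ?cards0 ?mulr0 //.
      by apply/setP => v; rewrite !inE andbF.
  move=> st4 ag4 hI4.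
  have r21 : nmem st4 21 0 0 0 = t by rewrite (proj1 ag4).
  have r14 j : nmem st4 14 j 0 0 = nmem st1 14 j 0 0 by rewrite (proj1 ag4).
  have r0 : rmem st4 0 0 = cap I.
    by have [_ _ _ h _] : inst st4 by apply: agree_inst ag4 _ _ hi2.
  have r2 : rmem st4 2 0 = 8 * (load (T j0))%:R.
    rewrite hI4; congr (_ * _%:R); apply: eq_card => v; rewrite !inE ltn_ord andbT //.
  apply: (runs_if (T := 1)); rewrite /= r0 r2 -/(big j0) => hb.
    apply: runs_nset; split=> /= [j|]; rewrite r21 ?r14 ?hI1' ?hI1 !andbT.
      case: (j =P t :> nat) => [e|ne].
        have -> : j = j0 by exact: val_inj.
        by rewrite hb andbT ltnSn.
      by rewrite ltnS [(j <= t)%N]leq_eqVlt; move/eqP/negbTE: ne => ->.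
    by rewrite gtn_eqF.
  apply: runs_skip; split=> [j|]; rewrite r14 ?hI1' ?hI1 //.
  rewrite ltnS [(j <= t)%N]leq_eqVlt; case: (j =P t :> nat) => [e|//].
  have -> : j = j0 by exact: val_inj.
  by rewrite (negbTE hb) !andbF.
Qed.

Lemma lam_ok st : inst st -> nmem st 20 0 0 0 = 0%N ->
  runs lam_prog st (1 + (n * 5 + 2)) (fun st' => exists lam,
    [/\ nmem st' 20 0 0 0 = lam, (lam <= n)%N, 128 * lam%:R <= cap I
      & lam = n \/ cap I < 128 * lam.+1%:R]).
Proof.
move=> hi h0; apply: runs_seq; apply: runs_rset; set st1 := rupd _ _ _ _.
have hi1 : inst st1 by [].
pose Inv (t : nat) st' := exists lam,
    [/\ nmem st' 20 0 0 0 = lam, (lam <= t)%N, 128 * lam%:R <= cap I,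
       rmem st' 2 0 = 128 * lam.+1%:R & lam = t \/ cap I < 128 * lam.+1%:R].
apply: (runs_conseq (T := n * 5 + 2) (Q := Inv n)) => //; last first.
  by move=> st' _ [lam [h1 h2 h3 h4 h5]]; exists lam.
apply: runs_for => //.
- by move=> st' /agree_inst - /(_ isT isT hi1) [h _ _ _ _].
- move=> t st' ht ag ctr [lam [h1 h2 h3 h4 h5]].
  have [_ _ _ r0 _] : inst st' by apply: agree_inst ag _ _ hi1.
  apply: (runs_if (T := 2)); rewrite /= r0 h4 => hq.
    apply: (runs_seq (T1 := 1) (T2 := 1)); apply: runs_nset; apply: runs_rset; exists lam.+1.
    rewrite /= h1 addn1 h4; split=> //.
      by rewrite -[in RHS]natr1; ring.
    by left; case: h5 => [->//|]; rewrite ltNge hq.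
  apply: (runs_weaken (T := 1)) => //; apply: runs_skip; exists lam; split=> //.
    exact: leq_trans h2 _.
  by right; rewrite ltNge.
- exists 0%N; split=> //=; first by rewrite mulr0.
    by rewrite mulr1.
  by left.
Qed.

Definition clustered (i : 'I_k) : bool :=
  [exists j, src I i \in cl_terms (T j)] && [exists j, tgt I i \in cl_terms (T j)].

Definition inner_pairs : {set 'I_k} :=
  [set i | [exists j, (src I i \in cl_terms (T j)) && (tgt I i \in cl_terms (T j))]].

(** Pairs inside a cluster are loops of the cluster graph and are never deleted. The others become
    candidates only between clusters of large load, which bounds the number of nodes to which
    deletions are charged. *)
Definition outer_pairs : {set 'I_k} :=
  [set i | [exists j, exists j', [&& src I i \in cl_terms (T j), tgt I i \in cl_terms (T j'),
      j != j', big j & big j']]].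

Lemma alive_ok st (x y : 'I_k -> 'I_m.+1) : inst st ->
  (forall i : 'I_k, assigned (src I) 8 10 m st i /\ nmem st 8 i 0 0 = x i) ->
  (forall i : 'I_k, assigned (tgt I) 9 11 m st i /\ nmem st 9 i 0 0 = y i) ->
  (forall j : 'I_m, nmem st 14 j 0 0 = big j) -> nmem st 14 m 0 0 = 0%N ->
  (forall i, nmem st 7 i 0 0 = 0%N) ->
  runs alive_prog st (k * 7 + 2)
    (fun st' => output k st' = inner_pairs :|: outer_pairs).
Proof.
move=> hi hx hy hb hbm h0.
pose Inv (t : nat) st' := forall i : 'I_k, (nmem st' 7 i 0 0 != 0%N) =
  (i < t)%N && (i \in inner_pairs :|: outer_pairs).
apply: (runs_conseq (T := k * 7 + 2) (Q := Inv k)) => //; last first.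
  by move=> st' _ h; apply/setP => i; rewrite inE h ltn_ord.
have locm f i : located f m i = [exists j, f i \in cl_terms (T j)].
  by apply: eq_existsb => j; rewrite ltn_ord.
apply: runs_for => //.
- by move=> st' /agree_inst - /(_ isT isT hi) [_ h _ _ _].
- move=> t st' ht [ag _] ctr hI; pose i0 := Ordinal ht.
  have [[h10 h8 _] hx8] := hx i0; have [[h11 h9 _] hy9] := hy i0.
  rewrite locm in h10; rewrite locm in h11.
  have r10 : nmem st' 10 t 0 0 = [exists j, src I i0 \in cl_terms (T j)] by rewrite ag.
  have r11 : nmem st' 11 t 0 0 = [exists j, tgt I i0 \in cl_terms (T j)] by rewrite ag.
  have r8 : nmem st' 8 t 0 0 = x i0 by rewrite ag.
  have r9 : nmem st' 9 t 0 0 = y i0 by rewrite ag.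
  have xE j : src I i0 \in cl_terms (T j) -> x i0 = j :> nat by rewrite -hx8; apply: h8.
  have yE j : tgt I i0 \in cl_terms (T j) -> y i0 = j :> nat by rewrite -hy9; apply: h9.
  have done_ (st2 : state R) (bb : bool) : (i0 \in inner_pairs :|: outer_pairs) = bb ->
    (forall i : 'I_k, i != i0 -> nmem st2 7 i 0 0 = nmem st' 7 i 0 0) ->
    (nmem st2 7 t 0 0 != 0%N) = bb -> Inv t.+1 st2.
    move=> hbb hne heq i; have [->|ne] := eqVneq i i0; first by rewrite heq hbb /= ltnSn.
    rewrite hne // hI ltnS [(i <= t)%N]leq_eqVlt; case: eqP => // e.
    by case/eqP: ne; apply: val_inj.
  have old : nmem st' 7 t 0 0 = 0%N.
    by have := hI i0; rewrite /= ltnn /= => /negbFE/eqP.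
  have skipr T' Q : (0 < T')%N -> Q st' -> runs Skip st' T' Q.
    by move=> hT hQ; apply: runs_weaken (runs_skip hQ) _.
  have unclustered : ~~ ([exists j, src I i0 \in cl_terms (T j)] &&
      [exists j, tgt I i0 \in cl_terms (T j)]) -> (i0 \in inner_pairs :|: outer_pairs) = false.
    move=> h; apply: contraNF h; rewrite !inE => /orP[/existsP[j /andP[h1 h2]]|].
      by apply/andP; split; apply/existsP; exists j.
    case/existsP=> j /existsP[j' /and5P[h1 h2 _ _ _]].
    by apply/andP; split; apply/existsP; [exists j|exists j'].
  apply: (runs_if (T := 4)); rewrite /= ctr r10 r11 => hcl; last first.
    apply: skipr => //; apply: (done_ _ false) => //; last by rewrite old.
    by apply: unclustered; move: hcl; do 2 case: [exists _, _].
  have /andP[/existsP[j sj] /existsP[j' tj']] : [exists j, src I i0 \in cl_terms (T j)] &&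
      [exists j, tgt I i0 \in cl_terms (T j)] by move: hcl; do 2 case: [exists _, _].
  have inE0 : (i0 \in inner_pairs :|: outer_pairs) = (j == j') || (big j && big j').
    rewrite !inE; have [e|ne] := eqVneq j j'.
      by apply/orP; left; apply/existsP; exists j'; rewrite tj' -e sj.
    have -> : [exists j0, (src I i0 \in cl_terms (T j0)) && (tgt I i0 \in cl_terms (T j0))] = false.
      apply/existsP => -[j0 /andP[h1 h2]]; case/eqP: ne.
      by rewrite (terms_inj sj h1) (terms_inj tj' h2).
    rewrite /=; apply/existsP/andP => [[j1 /existsP[j2 /and5P[h1 h2 _ h3 h4]]]|[h1 h2]].
      by rewrite (terms_inj sj h1) (terms_inj tj' h2).
    by exists j; apply/existsP; exists j'; rewrite sj tj' ne h1 h2.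
  have set7 : nmem (nupd st' 7 t 0 0 1) 7 t 0 0 = 1%N by rewrite /= eqxx.
  have keep7 i : i != i0 -> nmem (nupd st' 7 t 0 0 1) 7 i 0 0 = nmem st' 7 i 0 0.
    move=> ne; rewrite /= andbT; case: (i =P t :> nat) => // e.
    by case/eqP: ne; apply: val_inj.
  apply: (runs_ifeq (T := 2)); rewrite /= ctr r8 r9 (xE _ sj) (yE _ tj') => e.
    apply: (runs_weaken (T := 1)) => //; apply: runs_nset; rewrite /= ctr.
    by apply: (done_ _ true _ keep7); rewrite ?set7 // inE0 (val_inj e) eqxx.
  have ne : (j == j') = false by apply/eqP => h; apply: e; rewrite h.
  have b14 : nmem st' 14 j 0 0 = big j by rewrite ag.
  have b14' : nmem st' 14 j' 0 0 = big j' by rewrite ag.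
  apply: (runs_if (T := 1)); rewrite /= ctr r8 r9 (xE _ sj) (yE _ tj') b14 b14' => hbb.
    apply: runs_nset; rewrite /= ctr.
    apply: (done_ _ true _ keep7); rewrite ?set7 // inE0 ne /=.
    by move: hbb; case: (big j); case: (big j').
  apply: runs_skip; apply: (done_ _ false) => //; last by rewrite old.
  by rewrite inE0 ne; move: hbb; case: (big j); case: (big j').
- by move=> i; rewrite h0.
Qed.

Lemma find_ok : runs find_prog (input I T) (200 * (2 * n + k + m + 2) ^ 4)
  (fun st' => exists (lam : nat) (x y : 'I_k -> 'I_m.+1),
    [/\ [/\ (lam <= n)%N, 128 * lam%:R <= cap I & lam = n \/ cap I < 128 * lam.+1%:R],
      forall i j, src I i \in cl_terms (T j) -> x i = j :> nat,
      forall i j, tgt I i \in cl_terms (T j) -> y i = j :> nat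
    & let S := output k st' in
      [/\ S \subset inner_pairs :|: outer_pairs, inner_pairs \subset S,
        (#|inner_pairs :|: outer_pairs| <= #|S| + lam * #|[set j | big j]|)%N
      & strong x y S lam]]).
Proof.
set st0 := input I T; have hi0 : inst st0 := inst_input.
set B := (2 * n + k + m + 2)%N.
have hB : (1 + n <= B)%N /\ (1 + k <= B)%N /\ (1 + m <= B)%N by rewrite /B; lia.
have [hn [hk hm]] := hB.
apply: (runs_weaken (T := k * (m * 5 + 2).+2 + 2 + (k * (m * 5 + 2).+2 + 2 +
  (m * (1 + (n * 4 + 2 + 2)).+2 + 2 + (k * 7 + 2 + (1 + (n * 5 + 2) + 90 * B * B * B * B)))))); last first.
  have -> : (B ^ 4 = B * B * (B * B))%N by rewrite !expnS expn0 muln1 !mulnA.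
  have -> : (90 * B * B * B * B = 90 * (B * B * (B * B)))%N by rewrite !mulnA.
  have h2 : (B * B <= B * B * (B * B))%N by rewrite -[leqLHS]mul1n leq_mul2r; nia.
  have h1 : (B <= B * B)%N by rewrite -[leqLHS]mul1n leq_mul2r; lia.
  have hkm : (k * m <= B * B)%N by rewrite leq_mul //; lia.
  have hmn : (m * n <= B * B)%N by rewrite leq_mul //; lia.
  move: (B * B * (B * B))%N (B * B)%N h1 h2 hkm hmn => B4 B2 h1 h2 hkm hmn.
  nia.
apply: runs_seq.
apply: runs_conseq (assign_ok (f := src I) (a := 2) (b := 8) (c := 10) _ _ _ _ _ _ hi0 _ _) _ _ => //.
  by case: hi0 => _ _ _ _ [].
move=> st1 ag1 hx1; have hi1 : inst st1 by apply: agree_inst ag1 _ _ hi0.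
apply: runs_seq.
apply: runs_conseq (assign_ok (f := tgt I) (a := 3) (b := 9) (c := 11) _ _ _ _ _ _ hi1 _ _) _ _ => //.
- by case: hi1 => _ _ _ _ [].
- by move=> i; rewrite !(proj1 ag1).
move=> st2 ag2 hy2; have hi2 : inst st2 by apply: agree_inst ag2 _ _ hi1.
have z2 a x y z : a \notin [:: 0; 1; 2; 3; 4; 5; 6; 8; 9; 10; 11; 21; 22]%N -> nmem st2 a x y z = 0%N.
  move=> h; rewrite (proj1 ag2) ?(proj1 ag1) //.
  - by move: a h; do 7 case=> //.
  - by apply: contra h; rewrite !inE; lia.
  - by apply: contra h; rewrite !inE; lia.
apply: runs_seq; apply: runs_conseq (big_ok hi2 _) _ _ => //; first by move=> j; rewrite z2.
move=> st3 ag3 [hb3 hbm3]; have hi3 : inst st3 by apply: agree_inst ag3 _ _ hi2.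
pose x i : 'I_m.+1 := inord (nmem st1 8 (i : 'I_k) 0 0).
pose y i : 'I_m.+1 := inord (nmem st2 9 (i : 'I_k) 0 0).
have hx3 i : assigned (src I) 8 10 m st3 i /\ nmem st3 8 i 0 0 = x i.
  have [h1 h2 h3] := hx1 i; rewrite /assigned !(proj1 ag3) // !(proj1 ag2) //.
  by rewrite /x inordK.
have hy3 i : assigned (tgt I) 9 11 m st3 i /\ nmem st3 9 i 0 0 = y i.
  have [h1 h2 h3] := hy2 i; rewrite /assigned !(proj1 ag3) //.
  by rewrite /y inordK.
apply: runs_seq; apply: runs_conseq (alive_ok hi3 hx3 hy3 hb3 hbm3 _) _ _ => //.
  by move=> i; rewrite (proj1 ag3) // z2.
move=> st4 ag4 hS4; have hi4 : inst st4 by apply: agree_inst ag4 _ _ hi3.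
apply: runs_seq; apply: runs_conseq (lam_ok hi4 _) _ _ => //.
  by rewrite (proj1 ag4) // (proj1 ag3) // z2.
move=> st5 ag5 [lam [hlam lam1 lam2 lam3]].
have hi5 : inst st5 by apply: agree_inst ag5 _ _ hi4.
have hc5 : ctx n lam x y st5.
  have [h1 h2 h3 _ _] := hi5; split=> // i.
  have [_ hx] := hx3 i; have [_ hy] := hy3 i.
  by rewrite -hx -hy !(proj1 ag5) // !(proj1 ag4).
have hL5 : labels lam st5 (fun _ _ => ord0 : 'I_m.+1).
  by move=> j v _; rewrite (proj1 ag5) // (proj1 ag4) // (proj1 ag3) // z2.
have hS5 : output k st5 = inner_pairs :|: outer_pairs.
  by rewrite -hS4; apply: agree_alive ag5 _.
have xE i j : src I i \in cl_terms (T j) -> x i = j :> nat.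
  by move=> h; have [[_ hj _] <-] := hx3 i; apply: hj.
have yE i j : tgt I i \in cl_terms (T j) -> y i = j :> nat.
  by move=> h; have [[_ hj _] <-] := hy3 i; apply: hj.
(* The initial partition joins all big clusters and leaves every other node alone, so each candidate
   pair lies inside a class. It has at least [m.+1 - #|bigs|] classes, whence at most
   [lam * #|bigs|] deletions. *)
pose bigs := [set v : 'I_m.+1 | [exists j : 'I_m, (v == j :> nat) && big j]].
pose v0 := odflt ord0 [pick v in bigs].
pose Pi0 (v : 'I_m.+1) := if v \in bigs then v0 else v.
have hPi0 i : i \in inner_pairs :|: outer_pairs -> Pi0 (x i) = Pi0 (y i).
  rewrite !inE => /orP[/existsP[j /andP[h1 h2]]|].
    by congr Pi0; apply: val_inj; rewrite /= (xE _ _ h1) (yE _ _ h2).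
  case/existsP=> j /existsP[j' /and5P[h1 h2 _ h3 h4]]; rewrite /Pi0.
  have -> : x i \in bigs by rewrite inE; apply/existsP; exists j; rewrite (xE _ _ h1) eqxx.
  by have -> : y i \in bigs by rewrite inE; apply/existsP; exists j'; rewrite (yE _ _ h2) eqxx.
have cbigs : #|bigs| = #|[set j | big j]|.
  have winj : injective (widen_ord (leqnSn m)) by move=> j j' [] /val_inj.
  rewrite -(card_imset _ winj); apply: eq_card => v.
  rewrite inE; apply/existsP/imsetP => [[j /andP[/eqP e hj]]|[j hj ->]].
    by exists j; rewrite ?inE //; apply: val_inj.
  by exists j; rewrite eqxx; move: hj; rewrite inE.
have cPi0 : (m.+1 <= classes Pi0 + #|bigs|)%N.
  have : (#|~: bigs| <= classes Pi0)%N.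
    apply: subset_leq_card; apply/subsetP => v; rewrite inE => h.
    by apply/imsetP; exists v => //; rewrite /Pi0 (negbTE h).
  by have := cardsC bigs; rewrite card_ord; lia.
apply: runs_conseq (main_ok hc5 hL5 hS5 hPi0) _ _.
  have hb : (n + k + m + lam + 2 <= B)%N by rewrite /B; lia.
  by rewrite !leq_mul.
move=> st6 _ [m1 m2 m3 m4]; exists lam, x, y; split=> //; split=> //.
  apply/subsetP => i; rewrite inE => /existsP[j /andP[h1 h2]]; apply: m2.
    by rewrite !inE; apply/orP; left; apply/existsP; exists j; rewrite h1 h2.
  by apply: val_inj; rewrite /= (xE _ _ h1) (yE _ _ h2).
have : (lam * m.+1 <= lam * (classes Pi0 + #|bigs|))%N by rewrite leq_mul2l cPi0 orbT.
by move: m3; rewrite -cbigs mulnDr; lia.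
Qed.

End Find.

(** * Routing through clusters and sampled paths *)

Lemma path_infix (V : eqType) (r : rel V) s p :
  (forall u v, infix [:: u; v] (s :: p) -> r u v) -> path r s p.
Proof.
elim: p s => [//|s' p IH] s h /=; apply/andP; split.
  by apply: h; apply: prefixW; rewrite /= !eqxx prefix0s.
by apply: IH => u v huv; apply: h; rewrite infix_consl huv orbT.
Qed.

Lemma paths_through (n : nat) (e : rel 'I_n) (W : {set 'I_n}) (s t : 'I_n) :
  s \in W -> connect (induced e W) s t ->
  exists2 P : gpath n, P \in paths e s t & {subset (P : seq 'I_n) <= W}.
Proof.
move=> sW /connectP[p0 hp0 ->]; case: (shortenP hp0) => p hp up _.
have pW : {subset s :: p <= W}.
  move=> v; rewrite inE => /predU1P[->//|].
  elim: p s {sW up hp0} hp => [//|v' p IH] s' /= /andP[/and3P[_ _ hv'] hp].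
  by rewrite inE => /predU1P[->//|]; apply: IH hp.
have sz : (size (s :: p) <= n)%N.
  by rewrite -[n in leqRHS]card_ord -(card_uniqP up) max_card.
exists (Bseq sz : gpath n) => //; rewrite inE /= eqxx eqxx /=.
have -> /= : path e s p by apply: sub_path hp => u v /and3P[].
exact: up.
Qed.

Lemma connect_mono (V : finType) (e e' : rel V) :
  subrel e e' -> subrel (connect e) (connect e').
Proof. by move=> sub; apply: connect_sub => a b /sub/connect1. Qed.

Section Routing.
Variables (R : realType) (n k m : nat) (I : mcnc R n k) (T : 'I_m -> cluster n).
Variables (w : outcome n k) (S : {set 'I_k}) (x y : 'I_k -> 'I_m.+1).
Let H := S :&: w.1.
Hypothesis src_inj : injective (src I).
Hypothesis tree : forall j, is_tree (edge I) (cl_verts (T j)) (cl_edge (T j)).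
Hypothesis terms_verts : forall j, cl_terms (T j) \subset cl_verts (T j).
Hypothesis Sx : forall i, i \in S -> exists2 j : 'I_m, src I i \in cl_terms (T j) & x i = j :> nat.
Hypothesis Sy : forall i, i \in S -> exists2 j : 'I_m, tgt I i \in cl_terms (T j) & y i = j :> nat.
Hypothesis Upath : forall i, i \in w.1 -> w.2 i \in req_paths I i.

(** The additional node [m] has no vertices. *)
Definition node_verts (v : 'I_m.+1) : {set 'I_n} :=
  [set u | [exists j : 'I_m, (v == j :> nat) && (u \in cl_verts (T j))]].

Lemma node_vertsE (v : 'I_m.+1) (j : 'I_m) : v = j :> nat -> node_verts v = cl_verts (T j).
Proof.
move=> e; apply/setP => u; rewrite inE; apply/existsP/idP => [[j' /andP[/eqP e']]|h].
  by rewrite (_ : j' = j) //; apply: val_inj; rewrite /= -e'.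
by exists j; rewrite e eqxx.
Qed.

Lemma src_node i : i \in S -> src I i \in node_verts (x i).
Proof.
move=> /Sx[j hj e]; rewrite (node_vertsE e); exact: (subsetP (terms_verts j)).
Qed.

Lemma tgt_node i : i \in S -> tgt I i \in node_verts (y i).
Proof.
move=> /Sy[j hj e]; rewrite (node_vertsE e); exact: (subsetP (terms_verts j)).
Qed.

Lemma Fedge_sym : symmetric (Fedge T w).
Proof.
move=> u v; rewrite /Fedge /=; congr (_ || _).
  by apply: eq_existsb => j; have [[s _] _ _ _] := tree j; rewrite s.
by apply: eq_existsb => i; rewrite orbC.
Qed.

Section Inside.
Variable W : {set 'I_n}.
Let G := induced (Fedge T w) W.

Lemma G_sym : connect_sym G.
Proof.
apply: sym_connect_sym => u v; rewrite /G /induced /= Fedge_sym.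
by rewrite [(u \in W) && _]andbC.
Qed.

Lemma node_connect (v : 'I_m.+1) u u' : node_verts v \subset W ->
  u \in node_verts v -> u' \in node_verts v -> connect G u u'.
Proof.
move=> sub; rewrite inE => /existsP[j /andP[/eqP e uj]].
rewrite (node_vertsE e) in sub *; move=> uj'.
have [[_ te] _ conn _] := tree j.
apply: (connect_mono (e := cl_edge (T j))); last exact: conn.
move=> a b hab; have /and3P[_ ha hb] := te _ _ hab.
rewrite /G /induced /= !(subsetP sub) // !andbT.
by apply/orP; left; apply/existsP; exists j.
Qed.

Lemma link_connect i : i \in w.1 -> [set u | u \in (w.2 i : seq 'I_n)] \subset W ->
  connect G (src I i) (tgt I i).
Proof.
move=> iM sub; have := Upath iM; rewrite inE.
have inW u : u \in (w.2 i : seq 'I_n) -> u \in W.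
  by move=> h; apply: (subsetP sub); rewrite inE.
case E : (w.2 i : seq 'I_n) => [//|s p] /and4P[/eqP <- _ /eqP <- _].
apply/connectP; exists p => //; apply: path_infix => u v huv.
have /andP[uW vW] : (u \in W) && (v \in W).
  by apply/andP; split; apply: inW; rewrite E; apply: (mem_infix huv); rewrite !inE eqxx ?orbT.
rewrite /G /induced /= uW vW !andbT; apply/orP; right; apply/existsP; exists i.
by rewrite iM E huv.
Qed.

End Inside.

Definition link_rel (F : {set 'I_k}) : rel 'I_m.+1 :=
  [rel u v | [exists i in F, ((x i == u) && (y i == v)) || ((x i == v) && (y i == u))]].

Lemma link_rel_sym F : connect_sym (link_rel F).
Proof.
apply: sym_connect_sym => u v; apply: eq_existsb => i; congr (_ && _).
by rewrite orbC.
Qed.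

Definition span (F : {set 'I_k}) : {set 'I_n} :=
  \bigcup_(i in F) ([set u | u \in (w.2 i : seq 'I_n)] :|: node_verts (x i) :|: node_verts (y i)).

(** A walk in the cluster graph is realised by alternating tree paths inside clusters with the
    chosen paths of sampled pairs; both stay in [span F]. *)
Lemma span_connect (F : {set 'I_k}) v0 u0 p : F \subset H -> path (link_rel F) v0 p ->
  node_verts v0 \subset span F -> u0 \in node_verts v0 ->
  forall u, u \in node_verts (last v0 p) -> connect (induced (Fedge T w) (span F)) u0 u.
Proof.
move=> FH; elim: p v0 u0 => [|v1 p IH] v0 u0 /=.
  by move=> _ sub hu0 u hu; apply: node_connect sub hu0 hu.
case/andP=> /existsP[i /andP[iF hi]] hp sub hu0 u hu.
have /setIP[iS iM] := subsetP FH i iF.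
have subi := bigcup_sup (F := fun i => [set u | u \in (w.2 i : seq 'I_n)] :|: node_verts (x i) :|: node_verts (y i)) i iF.
have subU : [set u | u \in (w.2 i : seq 'I_n)] \subset span F.
  by apply: subset_trans subi; rewrite -setUA subsetUl.
have subx : node_verts (x i) \subset span F.
  by apply: subset_trans subi; rewrite setUAC subsetUr.
have suby : node_verts (y i) \subset span F.
  by apply: subset_trans subi; rewrite subsetUr.
have lk := link_connect iM subU.
case/orP: hi => /andP[/eqP e0 /eqP e1].
  apply: connect_trans (node_connect sub hu0 (_ : src I i \in _)) _; first by rewrite -e0 src_node.
  apply: connect_trans lk _; apply: (IH v1) => //; first by rewrite -e1.
  by rewrite -e1 tgt_node.
apply: connect_trans (node_connect sub hu0 (_ : tgt I i \in _)) _; first by rewrite -e1 tgt_node.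
rewrite G_sym in lk.
apply: connect_trans lk _; apply: (IH v1) => //; first by rewrite -e0.
by rewrite -e0 src_node.
Qed.

Variables (kappa a1 a2 a3 a4 : R) (Lg : nat).
Hypothesis kappa0 : 0 <= kappa.
Hypothesis a20 : 0 <= a2.
Hypothesis a40 : 0 <= a4.
Hypothesis cut_le : forall A, #|cut x y S A|%:R <= kappa * #|cut x y H A|%:R.
Hypothesis link_load : forall v, #|[set i in H | v \in (w.2 i : seq 'I_n)]|%:R <= a1.
Hypothesis x_load : forall j : 'I_m, #|[set i in H | x i == j :> nat]|%:R <= a2.
Hypothesis y_load : forall j : 'I_m, #|[set i in H | y i == j :> nat]|%:R <= a2.
Hypothesis overlap : forall v, #|[set j | v \in cl_verts (T j)]|%:R <= a3.
Hypothesis loads : forall j, (load (T j))%:R <= a4.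
Hypothesis m_le : (m.+1 < 2 ^ Lg)%N.

Section Lengths.
Variables (l : 'I_n -> R) (D : 'I_k -> R).
Hypothesis l0 : forall v, 0 <= l v.
Hypothesis D_le : forall i (P : gpath n), i \in S -> P \in paths (Fedge T w) (src I i) (tgt I i) ->
  D i <= \sum_(v | v \in (P : seq 'I_n)) l v.

Let len (W : {set 'I_n}) := \sum_(v in W) l v.

Lemma lenU (A B : {set 'I_n}) : len (A :|: B) <= len A + len B.
Proof.
rewrite /len ![\sum_(_ in _) _]big_mkcond -big_split; apply: ler_sum => v _.
by rewrite inE; case: (v \in A); case: (v \in B); rewrite /= ?addr0 ?add0r // lerDl.
Qed.

(** A route may enter and leave a cluster anywhere, so a link pays for the whole clusters at its
    ends in addition to its path. *)
Definition link_len i := len [set u | u \in (w.2 i : seq 'I_n)] + len (node_verts (x i))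
  + len (node_verts (y i)).

Lemma len_ge0 A : 0 <= len A.
Proof. exact: sumr_ge0. Qed.

Lemma link_len_ge0 i : 0 <= link_len i.
Proof. by rewrite !addr_ge0 ?len_ge0. Qed.

Lemma len_span F : len (span F) <= \sum_(i in F) link_len i.
Proof.
rewrite /span; apply: (big_ind2 (fun A r => len A <= r)).
- by rewrite /len big_set0.
- by move=> A r A' r' h h'; apply: le_trans (lenU _ _) (lerD h h').
- by move=> i _; apply: le_trans (lenU _ _) _; rewrite lerD2r lenU.
Qed.

Lemma D_le_len i (W : {set 'I_n}) : i \in S -> src I i \in W ->
  connect (induced (Fedge T w) W) (src I i) (tgt I i) -> D i <= len W.
Proof.
move=> iS sW /(paths_through sW)[P hP PW]; apply: le_trans (D_le iS hP) _.
rewrite /len [leLHS]big_mkcond [leRHS]big_mkcond; apply: ler_sum => v _.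
by case: ifP => [/PW ->//|_]; case: ifP.
Qed.

Lemma D_le_links i (F : {set 'I_k}) : i \in S -> F \subset H -> x i != y i ->
  connect (link_rel F) (x i) (y i) -> D i <= \sum_(i' in F) link_len i'.
Proof.
move=> iS FH ne /connectP[[|v1 p] hp ey]; first by rewrite /= in ey; rewrite ey eqxx in ne.
have sub : node_verts (x i) \subset span F.
  move: hp => /= /andP[/existsP[i' /andP[iF hi]] _].
  have subi := bigcup_sup (F := fun i => [set u | u \in (w.2 i : seq 'I_n)] :|: node_verts (x i) :|: node_verts (y i)) i' iF.
  case/orP: hi => /andP[/eqP e0 /eqP e1].
    by rewrite -e0; apply: subset_trans subi; rewrite setUAC subsetUr.
  by rewrite -e1; apply: subset_trans subi; rewrite subsetUr.
apply: le_trans (len_span F); apply: D_le_len => //.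
  by apply: (subsetP sub); apply: src_node.
by apply: (span_connect FH hp sub); [exact: src_node|rewrite -ey tgt_node].
Qed.

(** The cheapest connecting set of links, rather than a shortest path: the triangle inequality then
    follows by taking a union. The default, the length of all links, also serves for nodes that no
    set connects. *)
Definition dist (u v : 'I_m.+1) : R :=
  \big[Num.min/(\sum_(i in H) link_len i)]_(F : {set 'I_k} | (F \subset H) && connect (link_rel F) u v)
    \sum_(i in F) link_len i.

Lemma dist_ge0 u v : 0 <= dist u v.
Proof.
apply/bigmin_geP; split=> [|F _]; by apply: sumr_ge0 => i _; exact: link_len_ge0.
Qed.

Lemma dist_le (F : {set 'I_k}) u v : F \subset H -> connect (link_rel F) u v ->
  dist u v <= \sum_(i in F) link_len i.
Proof. by move=> FH c; apply: bigmin_le_cond; rewrite FH c. Qed.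

Lemma dist_xx u : dist u u = 0.
Proof.
apply/eqP; rewrite eq_le dist_ge0 andbT; apply: le_trans (dist_le (sub0set H) (connect0 _ u)) _.
by rewrite big_set0.
Qed.

Lemma dist_sym u v : dist u v = dist v u.
Proof. by apply: eq_bigl => F; rewrite link_rel_sym. Qed.

Lemma dist_tri u v z : dist u z <= dist u v + dist v z.
Proof.
have top a b : dist a b <= \sum_(i in H) link_len i by exact: bigmin_le_id.
have /bigmin_leP[h|[F1 /andP[s1 c1] h1]] : dist u v <= dist u v by [].
  by apply: le_trans (top _ _) _; apply: le_trans h _; rewrite lerDl dist_ge0.
have /bigmin_leP[h|[F2 /andP[s2 c2] h2]] : dist v z <= dist v z by [].
  by apply: le_trans (top _ _) _; apply: le_trans h _; rewrite lerDr dist_ge0.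
apply: le_trans (lerD h1 h2).
have mono (F F' : {set 'I_k}) : F \subset F' -> subrel (connect (link_rel F)) (connect (link_rel F')).
  move=> sub; apply: connect_mono => a b /existsP[i /andP[iF hi]]; apply/existsP; exists i.
  by rewrite (subsetP sub).
apply: le_trans (dist_le (F := F1 :|: F2) _ _) _.
- by rewrite subUset s1.
- by apply: (connect_trans (mono _ _ (subsetUl F1 F2) _ _ c1)); apply: mono c2; exact: subsetUr.
rewrite ![\sum_(_ in _) _]big_mkcond -big_split; apply: ler_sum => i _.
by rewrite inE; case: (i \in F1); case: (i \in F2); rewrite /= ?addr0 ?add0r // lerDl link_len_ge0.
Qed.

(** Otherwise the component of [x i] would define a cut that contains a pair of [S] but no sampled
    pair, against [cut_le]. *)
Lemma link_connected i : i \in S -> connect (link_rel H) (x i) (y i).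
Proof.
move=> iS; pose A := [set v | connect (link_rel H) (x i) v].
have cH : cut x y H A = set0.
  apply/setP => i'; rewrite [LHS]in_set in_set0; apply/negbTE; rewrite negb_and negbK.
  have [iH|//] := boolP (i' \in H); rewrite /= !inE.
  have step : connect (link_rel H) (x i') (y i').
    by apply: connect1; apply/existsP; exists i'; rewrite iH !eqxx.
  have step' : connect (link_rel H) (y i') (x i') by rewrite link_rel_sym.
  by apply/eqP; apply/idP/idP => h; [apply: connect_trans h step|apply: connect_trans h step'].
have := cut_le A; rewrite cH cards0 mulr0 lern0 cards_eq0 => /eqP cS.
have : i \notin cut x y S A by rewrite cS inE.
by rewrite !inE iS negbK connect0 => /eqP <-.
Qed.

Lemma D_le_dist i : i \in S -> D i <= (if x i == y i then len (node_verts (x i)) else 0) + dist (x i) (y i).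
Proof.
move=> iS; case: eqVneq => [e|ne].
  rewrite -[leLHS]addr0; apply: lerD; last exact: dist_ge0.
  apply: D_le_len => //; first exact: src_node.
  apply: (node_connect (v := x i)) => //; first exact: src_node.
  by rewrite e tgt_node.
rewrite add0r; apply/bigmin_geP; split=> [|F /andP[sF cF]]; first by apply: D_le_links => //; exact: link_connected.
exact: D_le_links.
Qed.

(** Double counting: the length of a vertex is charged by at most [c] pairs at each of the at most
    [a3] clusters through it. *)
Lemma sum_node_len (Q : {set 'I_k}) (z : 'I_k -> 'I_m.+1) (c : R) : 0 <= c ->
  (forall j : 'I_m, #|[set i in Q | z i == j :> nat]|%:R <= c) ->
  \sum_(i in Q) len (node_verts (z i)) <= a3 * c * \sum_v l v.
Proof.
move=> c0 hc.
have nodeE i u : (u \in node_verts (z i))%:R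
    = \sum_(j | u \in cl_verts (T j)) (z i == j :> nat)%:R :> R.
  rewrite inE; case: existsP => [[j /andP[/eqP e uj]]|h].
    rewrite (bigD1 j) //= e eqxx big1 ?addr0 // => j' /andP[_ ne].
    by rewrite (_ : (j == j' :> nat) = false) //; apply: contraNF ne => /eqP/val_inj ->.
  rewrite big1 // => j uj; case: eqP => // e; case: h; exists j; by rewrite e eqxx.
have -> : \sum_(i in Q) len (node_verts (z i)) =
   \sum_u l u * \sum_(j | u \in cl_verts (T j)) #|[set i in Q | z i == j :> nat]|%:R.
  transitivity (\sum_(i in Q) \sum_u l u * (u \in node_verts (z i))%:R).
    apply: eq_bigr => i _; rewrite /len big_mkcond; apply: eq_bigr => u _.
    by case: ifP; rewrite ?mulr1 ?mulr0.
  rewrite exchange_big /=; apply: eq_bigr => u _; rewrite -mulr_sumr; congr (_ * _).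
  rewrite (eq_bigr _ (fun i _ => nodeE i u)) exchange_big /=; apply: eq_bigr => j _.
  rewrite -sum1_card natr_sum [RHS]big_mkcond [LHS]big_mkcond /=; apply: eq_bigr => i _.
  by rewrite inE; case: (i \in Q) => //=; case: ifP.
rewrite mulr_sumr; apply: ler_sum => u _; rewrite [leRHS]mulrC; apply: ler_wpM2l => //.
apply: (@le_trans _ _ (\sum_(j | u \in cl_verts (T j)) c)); first by apply: ler_sum.
rewrite sumr_const -mulr_natl ler_wpM2r //; apply: le_trans (overlap u).
by rewrite ler_nat; apply: subset_leq_card; apply/subsetP => j; rewrite inE.
Qed.

(** Pairs inside a cluster use its tree, which costs overlap times load. For the rest, the metric
    comparison passes from [S] to the sampled pairs, whose distance is at most their own link; paths
    are then counted by [link_load], and end clusters by overlap times sampled degree. *)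
Lemma sum_D : \sum_(i in S) D i <=
  (a3 * a4 + 96 * Lg%:R * kappa * (a1 + 2 * (a3 * a2))) * \sum_v l v.
Proof.
have xS (j : 'I_m) : #|[set i in S | x i == j :> nat]|%:R <= a4.
  apply: le_trans (loads j); rewrite ler_nat /load -(card_imset _ src_inj).
  apply: subset_leq_card; apply/subsetP => v /imsetP[i + ->]; rewrite inE => /andP[iS /eqP e].
  have [j' hj' e'] := Sx iS; rewrite (_ : j = j') //.
  by apply: val_inj; rewrite /= -e -e'.
apply: (@le_trans _ _ (\sum_(i in S) len (node_verts (x i)) + \sum_(i in S) dist (x i) (y i))).
  rewrite -big_split; apply: ler_sum => i iS; apply: le_trans (D_le_dist iS) _.
  by rewrite lerD2r; case: ifP => // _; exact: len_ge0.
rewrite mulrDl; apply: lerD; first exact: sum_node_len.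
have m_le' : (#|{: 'I_m.+1}| < 2 ^ Lg)%N by rewrite card_ord.
apply: le_trans (metric_le kappa0 cut_le dist_ge0 dist_xx dist_sym dist_tri m_le') _.
rewrite -[leRHS]mulrA; apply: ler_wpM2l; first by rewrite !mulr_ge0 ?ler0n.
apply: (@le_trans _ _ (\sum_(i in H) link_len i)).
  apply: ler_sum => i iH; rewrite -[leRHS](big_set1 +%R i (fun i => link_len i)).
  apply: dist_le; first by rewrite sub1set.
  by apply: connect1; apply/existsP; exists i; rewrite !inE !eqxx.
rewrite /link_len !big_split /= mulrDl -addrA; apply: lerD; last first.
  have h1 := sum_node_len a20 x_load; have h2 := sum_node_len a20 y_load; lra.
have -> : \sum_(i in H) len [set u | u \in (w.2 i : seq 'I_n)]
   = \sum_u l u * #|[set i in H | u \in (w.2 i : seq 'I_n)]|%:R.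
  transitivity (\sum_(i in H) \sum_u l u * (u \in (w.2 i : seq 'I_n))%:R).
    apply: eq_bigr => i _; rewrite /len big_mkcond; apply: eq_bigr => u _.
    by rewrite inE; case: ifP; rewrite ?mulr1 ?mulr0.
  rewrite exchange_big /=; apply: eq_bigr => u _; rewrite -mulr_sumr; congr (_ * _).
  rewrite -sum1_card natr_sum [RHS]big_mkcond [LHS]big_mkcond /=; apply: eq_bigr => i _.
  by rewrite [in RHS]in_set; case: (i \in H) => //=; case: ifP.
rewrite mulr_sumr; apply: ler_sum => u _; rewrite [leRHS]mulrC; apply: ler_wpM2l => //; exact: link_load.
Qed.

End Lengths.

Lemma routing : routable (Fedge T w) (src I) (tgt I) S setT
  (a3 * a4 + 96 * Lg%:R * kappa * (a1 + 2 * (a3 * a2))).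
Proof. by apply: routable_dual => l D l0 hD; exact: sum_D. Qed.

End Routing.

Section DirectRouting.
Variables (R : realType) (n k m : nat) (I : mcnc R n k) (T : 'I_m -> cluster n).

(** Meant for the case in which all pairs are sampled: each one uses its own chosen path. *)
Lemma direct_routing (w : outcome n k) (S : {set 'I_k}) (a1 : R) : S \subset w.1 ->
  (forall i, i \in w.1 -> w.2 i \in req_paths I i) ->
  (forall v, #|[set i in w.1 | v \in (w.2 i : seq 'I_n)]|%:R <= a1) ->
  routable (Fedge T w) (src I) (tgt I) S setT a1.
Proof.
move=> SM hU hload.
have Up i : i \in S -> w.2 i \in paths (Fedge T w) (src I i) (tgt I i).
  move=> /(subsetP SM) iM; have := hU i iM; rewrite !inE.
  case E : (w.2 i : seq 'I_n) => [//|s p] /and4P[-> _ -> ->]; rewrite !andbT.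
  apply: path_infix => u v huv; apply/orP; right; apply/existsP; exists i.
  by rewrite iM E huv.
exists (fun i P => (P == w.2 i)%:R); split=> [i P|i iS|v _]; first exact: ler0n.
  rewrite (bigD1 (w.2 i)) ?Up //= eqxx big1 ?addr0 // => P /andP[_ /negbTE ->].
  by [].
apply: le_trans (hload v); rewrite -sum1_card natr_sum [leRHS]big_mkcond [leLHS]big_mkcond /=.
apply: ler_sum => i _; rewrite inE; case: ifP => [iS|_]; last by case: ifP.
rewrite (subsetP SM) //=.
rewrite [leLHS]big_mkcond (bigD1 (w.2 i)) //= Up // eqxx big1 ?addr0; first by case: ifP.
by move=> P /negbTE ->; case: ifP.
Qed.

End DirectRouting.

(** * The number of selected pairs *)

Lemma sum_card_disjoint (J V : finType) (P : pred J) (A : J -> {set V}) (W : {set V}) :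
  (forall j, P j -> A j \subset W) ->
  (forall v j j', P j -> P j' -> v \in A j -> v \in A j' -> j = j') ->
  (\sum_(j | P j) #|A j| <= #|W|)%N.
Proof.
move=> sub dis.
rewrite (eq_bigr (fun j => \sum_v (v \in A j : nat))%N) => [|j _]; last first.
  by rewrite -sum1_card big_mkcond; apply: eq_bigr => v _; case: (v \in A j).
rewrite exchange_big -sum1_card [leqRHS]big_mkcond /=; apply: leq_sum => v _.
have [/existsP[j /andP[Pj vj]]|none] := boolP [exists j, P j && (v \in A j)].
  rewrite (subsetP (sub j Pj)) // (bigD1 j) //= vj big1 // => j' /andP[Pj' ne].
  by case vj' : (v \in A j') => //; rewrite (dis _ _ _ Pj Pj' vj vj') eqxx in ne.
rewrite big1 // => j Pj; move: none; rewrite negb_exists => /forallP/(_ j).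
by rewrite Pj /=; case: (v \in A j).
Qed.

Section Counting.
Variables (R : realType) (n k m : nat) (I : mcnc R n k) (T : 'I_m -> cluster n) (L : R).
Hypothesis cap0 : 0 < cap I.
Hypothesis src_inj : injective (src I).
Hypothesis tgt_inj : injective (tgt I).
Hypothesis src_tgt : forall i j, src I i != tgt I j.
Hypothesis wf : forall j, cluster_wf I (T j).
Hypothesis kinds : forall j, internal I L (T j) \/ external I L (T j).
Hypothesis terms_inj : forall v j j', v \in cl_terms (T j) -> v \in cl_terms (T j') -> j = j'.

Let unmated j := cl_terms (T j) :\: mated_inside I (T j).
Let inner := inner_pairs I T.
Let outer := outer_pairs I T.

Lemma mates_src i v : mates I (src I i) v -> v = tgt I i.
Proof.
move=> /existsP[i' /orP[/andP[/eqP e /eqP ->]|/andP[/eqP e _]]].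
  by rewrite (src_inj e).
by have := src_tgt i i'; rewrite e eqxx.
Qed.

Lemma mates_tgt i v : mates I (tgt I i) v -> v = src I i.
Proof.
move=> /existsP[i' /orP[/andP[/eqP e _]|/andP[/eqP e /eqP ->]]].
  by have := src_tgt i' i; rewrite e eqxx.
by rewrite (tgt_inj e).
Qed.

Lemma mated_sub j : mated_inside I (T j) \subset (src I @: inner) :|: (tgt I @: inner).
Proof.
apply/subsetP => v; rewrite inE => /andP[vj /existsP[u /andP[uj /existsP[i hi]]]].
have ii : i \in inner.
  rewrite inE; apply/existsP; exists j.
  by case/orP: hi => /andP[/eqP <- /eqP <-]; rewrite vj uj.
by rewrite inE; case/orP: hi => /andP[/eqP -> _]; rewrite imset_f ?orbT.
Qed.

Lemma sum_mated : (\sum_j #|mated_inside I (T j)| <= 2 * #|inner|)%N.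
Proof.
apply: leq_trans (sum_card_disjoint (W := (src I @: inner) :|: (tgt I @: inner)) _ _) _.
- by move=> j _; exact: mated_sub.
- by move=> v j j' _ _; rewrite !inE => /andP[h _] /andP[h' _]; apply: terms_inj h h'.
apply: leq_trans (leq_card_setU _ _) _; rewrite mul2n -addnn.
by apply: leq_add; exact: leq_imset_card.
Qed.

Lemma sum_load : (\sum_j load (T j) <= 2 * k)%N.
Proof.
apply: leq_trans (sum_card_disjoint (W := (src I @: setT) :|: (tgt I @: setT)) _ _) _.
- move=> j _; apply/subsetP => v vj; have [_ _ /(_ v vj)[u /existsP[i hi]]] := wf j.
  by rewrite inE; case/orP: hi => /andP[/eqP -> _]; rewrite imset_f ?orbT.
- by move=> v j j' _ _; exact: terms_inj.
apply: leq_trans (leq_card_setU _ _) _; rewrite mul2n -addnn.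
by apply: leq_add; apply: leq_trans (leq_imset_card _ _) _; rewrite cardsT card_ord.
Qed.

(** A load below [cap I / 8] rules out an external cluster, so the cluster is internal and most of
    its terminals are mated inside. *)
Lemma small_unmated j : ~~ big I T j -> (#|unmated j| <= #|mated_inside I (T j)|)%N.
Proof.
have msub : mated_inside I (T j) \subset cl_terms (T j).
  by apply/subsetP => v; rewrite inE => /andP[].
have cu : (#|unmated j| + #|mated_inside I (T j)| = load (T j))%N.
  by rewrite /unmated cardsD (setIidPr msub) subnK // subset_leq_card.
rewrite /big -ltNge => hb; case: (kinds j) => [[_ h]|[_ h]]; first by lia.
have : #|unmated j|%:R <= (load (T j))%:R :> R by rewrite ler_nat -cu leq_addr.
rewrite /unmated; lra.
Qed.

(** A clustered pair that is not a candidate has an end in a small cluster without its mate. There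
    are at most as many such ends as mated terminals of small clusters, and each inner pair supplies
    two of the latter. *)
Lemma lost_pairs : (#|[set i | clustered I T i]| <= #|inner :|: outer| + 2 * #|inner|)%N.
Proof.
pose U := \bigcup_(j | ~~ big I T j) unmated j.
have cU : (#|U| <= 2 * #|inner|)%N.
  apply: leq_trans sum_mated; rewrite [leqRHS](bigID (big I T)) /=.
  apply: leq_trans (leq_addl _ _).
  apply: (@leq_trans (\sum_(j | ~~ big I T j) #|unmated j|)).
    rewrite /U; apply: (big_ind2 (fun (A : {set 'I_n}) s => (#|A| <= s)%N)) => [|A a B b hA hB|//].
      by rewrite cards0.
    by apply: leq_trans (leq_card_setU _ _) (leq_add hA hB).
  by apply: leq_sum => j; exact: small_unmated.
pose lost := [set i | clustered I T i] :\: (inner :|: outer).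
have lostU i : i \in lost -> (src I i \in U) || (tgt I i \in U).
  rewrite in_setD in_set in_setU negb_or => /andP[/andP[ni no] /andP[/existsP[j sj] /existsP[j' tj']]].
  have ne : j != j'.
    apply: contraNneq ni => e; rewrite inE; apply/existsP; exists j'.
    by rewrite tj' -e sj.
  have nb : ~~ big I T j || ~~ big I T j'.
    rewrite -negb_and; apply: contra no => /andP[bj bj']; rewrite inE; apply/existsP; exists j.
    by apply/existsP; exists j'; rewrite sj tj' ne bj bj'.
  case/orP: nb => nb; apply/orP; [left|right]; apply/bigcupP; [exists j|exists j'] => //.
    rewrite inE sj andbT inE sj /=; apply/existsP => -[v /andP[vj /mates_src ev]].
    by case/eqP: ne; apply: (terms_inj (v := v)) => //; rewrite ev.
  rewrite inE tj' andbT inE tj' /=; apply/existsP => -[v /andP[vj /mates_tgt ev]].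
  by case/eqP: ne; apply: (terms_inj (v := v)) => //; rewrite ev.
have clost : (#|lost| <= #|U|)%N.
  pose h i := if src I i \in U then src I i else tgt I i.
  have hinj : injective h.
    move=> i i'; rewrite /h; (case: ifP => _; case: ifP => _) => [/src_inj//|e|e|/tgt_inj//].
      by have := src_tgt i i'; rewrite e eqxx.
    by have := src_tgt i' i; rewrite e eqxx.
  rewrite -(card_imset _ hinj); apply: subset_leq_card; apply/subsetP => v /imsetP[i /lostU hi ->].
  by rewrite /h; case: ifP hi.
have : (#|[set i | clustered I T i]| <= #|(inner :|: outer) :|: lost|)%N.
  apply: subset_leq_card; apply/subsetP => i hi.
  by rewrite in_setU in_setD hi andbT orbN.
move=> h0; apply: leq_trans h0 _; apply: leq_trans (leq_card_setU _ _) _.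
by rewrite leq_add2l; apply: leq_trans clost cU.
Qed.

Lemma many_pairs (S : {set 'I_k}) (lam : nat) : 128 * lam%:R <= cap I -> inner \subset S ->
  (#|inner :|: outer| <= #|S| + lam * #|[set j | big I T j]|)%N ->
  k%:R / 4 <= #|[set i | clustered I T i]|%:R :> R ->
  1 / 24 * k%:R <= #|S|%:R :> R.
Proof.
move=> hlam /subset_leq_card hin hio hk.
(* Big clusters have load at least [cap I / 8] each and at most [2 * k] together, so with
   [lam <= cap I / 128] at most [k / 8] pairs are deleted. As inner pairs survive,
   [k / 4 <= 3 * #|S| + k / 8], which gives [1 / 24]. *)
have hN : cap I * #|[set j | big I T j]|%:R <= 16 * k%:R.
  apply: (@le_trans _ _ (\sum_(j in [set j | big I T j]) 8 * (load (T j))%:R)).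
    rewrite mulr_natr -sumr_const; apply: ler_sum => j; by rewrite inE.
  rewrite -mulr_sumr -natr_sum.
  have : (\sum_(j in [set j | big I T j]) load (T j) <= 2 * k)%N.
    by apply: leq_trans sum_load; rewrite [leqRHS](bigID (mem [set j | big I T j])) /= leq_addr.
  rewrite -(ler_nat R) natrM; lra.
have hl : lam%:R * #|[set j | big I T j]|%:R <= k%:R / 8 :> R.
  have : 128 * lam%:R * #|[set j | big I T j]|%:R <= cap I * #|[set j | big I T j]|%:R.
    by apply: ler_wpM2r.
  lra.
have h1 : #|inner :|: outer|%:R <= #|S|%:R + lam%:R * #|[set j | big I T j]|%:R :> R.
  by rewrite -natrM -natrD ler_nat.
have h2 : #|[set i | clustered I T i]|%:R <= #|inner :|: outer|%:R + 2 * #|inner|%:R :> R.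
  by rewrite -natrM -natrD ler_nat; exact: lost_pairs.
have h3 : #|inner|%:R <= #|S|%:R :> R by rewrite ler_nat.
lra.
Qed.

(** Every tree has a vertex, so the overlap limits the number of clusters. This makes the running
    time polynomial in [n] and the number of scales logarithmic. *)
Lemma clusters_le (b : R) : 0 < b ->
  (forall v, #|[set j | v \in cl_verts (T j)]|%:R <= b * ln n%:R) ->
  m%:R <= b * n%:R * ln n%:R :> R.
Proof.
move=> b0 hv.
have hm : (m <= \sum_(v < n) #|[set j | v \in cl_verts (T j)]|)%N.
  have -> : (\sum_(v < n) #|[set j | v \in cl_verts (T j)]| = \sum_j #|cl_verts (T j)|)%N.
    transitivity (\sum_(v < n) \sum_j (v \in cl_verts (T j) : nat))%N.
      apply: eq_bigr => v _; rewrite -sum1_card big_mkcond; apply: eq_bigr => j _.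
      by rewrite inE; case: (v \in _).
    rewrite exchange_big; apply: eq_bigr => j _; rewrite -sum1_card [RHS]big_mkcond.
    by apply: eq_bigr => v _; case: (v \in _).
  rewrite -[leqLHS]card_ord -sum1_card; apply: leq_sum => j _.
  by rewrite card_gt0; have [[_ h _ _] _ _] := wf j.
apply: (@le_trans _ _ (\sum_(v < n) b * ln n%:R)).
  apply: (@le_trans _ _ (\sum_(v < n) #|[set j | v \in cl_verts (T j)]|)%:R); first by rewrite ler_nat.
  by rewrite natr_sum; apply: ler_sum.
by rewrite sumr_const card_ord -[leLHS]mulr_natr mulrAC.
Qed.

End Counting.

(** * Hallucination *)

Section Law.
Variables (R : realType) (n k : nat) (I : mcnc R n k) (C Ci : R)
  (sol : {set 'I_k} -> option (lp_sol R n)).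
Hypothesis wf : mcnc_wf I.
Hypothesis C0 : 0 <= C.
Hypothesis Ci0 : 0 <= Ci.
Hypothesis solP : lp_solver I Ci sol.
Implicit Types (M : {set 'I_k}) (U : {ffun 'I_k -> gpath n}) (w : outcome n k).

Let p := hal_prob I C.
Let cap0 : 0 < cap I. Proof. by case: wf. Qed.
Let cost0 v : 0 <= cost I v. Proof. by case: wf. Qed.
Let src_inj : injective (src I). Proof. by case: wf => _ []. Qed.
Let ln0 : 0 <= ln n%:R :> R. Proof. exact: ln_nat_ge0. Qed.

Lemma hal_prob01 : 0 <= p <= 1.
Proof.
by rewrite /p /hal_prob le_min ler01 ge_min lexx /= !divr_ge0 ?mulr_ge0 // ltW.
Qed.

Lemma hal_prob_cap (r c : R) : 0 <= r -> r <= c * cap I -> p * r <= C * ln n%:R * c.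
Proof.
move=> r0 hr; apply: (@le_trans _ _ (C * ln n%:R / cap I * r)).
  by apply: ler_wpM2r => //; rewrite /p /hal_prob ge_min lexx orbT.
rewrite -!mulrA; apply: ler_wpM2l => //; apply: ler_wpM2l => //.
by rewrite mulrC ler_pdivrMr.
Qed.

Lemma law_split w : law I C sol w = bern p w.1 * plaw (path_law I sol w.1) w.2.
Proof. by []. Qed.

Lemma flow_gt0 M y i : sol M = Some y -> i \in M -> 0 < \sum_(P in req_paths I i) y.1 P.
Proof.
move=> e iM; have := solP M; rewrite e => -[[_ h _ _] _].
exact: lt_le_trans cap0 (h i iM).
Qed.

Lemma path_law_ge0 M i P : 0 <= path_law I sol M i P.
Proof.
rewrite /path_law; case e : (sol M) => [y|]; last exact: ler0n.
case iM : (i \in M); last exact: ler0n.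
case: ifP => // _; rewrite divr_ge0 ?(ltW (flow_gt0 e iM)) //.
by have := solP M; rewrite e => -[[h _ _ _] _].
Qed.

Lemma path_law_sum1 M i : \sum_P path_law I sol M i P = 1.
Proof.
have nil1 : \sum_(P : gpath n) ((P : seq 'I_n) == [::])%:R = 1 :> R.
  have s0 : (size ([::] : seq 'I_n) <= n)%N by [].
  rewrite (bigD1 (Bseq s0 : gpath n)) //= big1 ?addr0 // => P ne.
  case: eqP => // e; case/eqP: ne; exact: val_inj.
rewrite /path_law; case e : (sol M) => [y|] //; case iM : (i \in M) => //.
by rewrite -big_mkcond -mulr_suml divff // gt_eqF // (flow_gt0 e iM).
Qed.

Lemma path_law_supp M i P : sol M <> None -> i \in M -> path_law I sol M i P != 0 ->
  P \in req_paths I i.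
Proof.
rewrite /path_law; case: (sol M) => [y|] // _ ->.
by case: ifP => //; rewrite eqxx.
Qed.

Lemma law_ge0 w : 0 <= law I C sol w.
Proof.
rewrite law_split mulr_ge0 ?bern_ge0 ?hal_prob01 //.
by apply: prodr_ge0 => i _; exact: path_law_ge0.
Qed.

Lemma sum_law (F : outcome n k -> R) :
  \sum_w law I C sol w * F w =
  \sum_M bern p M * \sum_U plaw (path_law I sol M) U * F (M, U).
Proof.
rewrite (eq_bigr (fun w => bern p w.1 * (plaw (path_law I sol w.1) w.2 * F (w.1, w.2)))); last first.
  by move=> [M U] _; rewrite law_split mulrA.
rewrite -(pair_bigA _ (fun M U => bern p M * (plaw (path_law I sol M) U * F (M, U)))) /=.
by apply: eq_bigr => M _; rewrite mulr_sumr.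
Qed.

Lemma sum_lawP (B : pred (outcome n k)) :
  \sum_(w | B w) law I C sol w =
  \sum_M bern p M * \sum_(U | B (M, U)) plaw (path_law I sol M) U.
Proof.
rewrite big_mkcond; have := sum_law (fun w => (B w)%:R).
rewrite (eq_bigr (fun w => if B w then law I C sol w else 0)) => [->|w _]; last first.
  by case: (B w); rewrite ?mulr1 ?mulr0.
apply: eq_bigr => M _; congr (_ * _); rewrite [RHS]big_mkcond; apply: eq_bigr => U _.
by case: (B _); rewrite ?mulr1 ?mulr0.
Qed.

Lemma plaw1 M : \sum_U plaw (path_law I sol M) U = 1.
Proof. by apply: plaw_sum1 => i; exact: path_law_sum1. Qed.

Lemma sum_law_fst (B : pred {set 'I_k}) :
  \sum_(w | B w.1) law I C sol w = \sum_(M | B M) bern p M.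
Proof.
rewrite sum_lawP [RHS]big_mkcond; apply: eq_bigr => M _ /=; case: ifP => _.
  by rewrite plaw1 mulr1.
by rewrite big_pred0 ?mulr0.
Qed.

Lemma sum_law1 : \sum_w law I C sol w = 1.
Proof. by rewrite (sum_law_fst predT) bern_sum1. Qed.

Lemma prob_compl (E : outcome n k -> Prop) :
  Prob I C sol E = 1 - \sum_(w | ~~ `[< E w >]) law I C sol w.
Proof.
by rewrite -sum_law1 [in RHS](bigID (fun w => `[< E w >])) /= addrK.
Qed.

Lemma prob_all (E : outcome n k -> Prop) : (forall w, E w) -> Prob I C sol E = 1.
Proof.
move=> h; rewrite -sum_law1; apply: eq_bigl => w; exact/asboolP.
Qed.

(** The left side is the expected number of chosen paths through [v] given [M]. The flow of a pair
    is at least [cap I], so normalising it turns the capacity row into this bound. *)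
Lemma lp_load M y v : sol M = Some y ->
  \sum_(i in M) \sum_(P in req_paths I i | v \in (P : seq 'I_n)) path_law I sol M i P <= y.2 v.
Proof.
move=> e; have := solP M; rewrite e => -[[y0 ydem ycap _] _].
rewrite -(ler_pM2l cap0); apply: le_trans (ycap v); rewrite mulr_sumr; apply: ler_sum => i iM.
rewrite mulr_sumr; apply: ler_sum => P /andP[hP _].
rewrite /path_law e iM hP mulrCA ler_piMr // ler_pdivrMr ?mul1r; first exact: ydem.
exact: flow_gt0 e iM.
Qed.

Lemma path_law_load M i (v : 'I_n) : i \in M -> sol M <> None ->
  \sum_(P : gpath n) path_law I sol M i P * (v \in (P : seq 'I_n))%:R
  = \sum_(P in req_paths I i | v \in (P : seq 'I_n)) path_law I sol M i P.
Proof.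
move=> iM hs; rewrite [RHS]big_mkcond; apply: eq_bigr => P _.
have [hP|hP] := boolP (P \in req_paths I i); first by rewrite /=; case: (v \in _); rewrite ?mulr1 ?mulr0.
have -> : path_law I sol M i P = 0 by apply: contraNeq hP; exact: path_law_supp.
by rewrite mul0r.
Qed.

(** Given [M], the paths are independent and the box constraint on [y.2 v] bounds the mean; if the
    program is infeasible, all chosen paths are empty. *)
Lemma link_tail (a1 : R) :
  \sum_(w : outcome n k | [exists v, a1 < #|[set i in w.1 | v \in (w.2 i : seq 'I_n)]|%:R]) law I C sol w
    <= n%:R * expR (3 * (Ci * ln n%:R) - a1).
Proof.
apply: (@le_trans _ _ (\sum_(v < n) \sum_(w : outcome n k | a1 < #|[set i in w.1 | v \in (w.2 i : seq 'I_n)]|%:R) law I C sol w)).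
  by apply: union_bound => [w|w /existsP[v hv]]; [apply: law_ge0|exists v].
apply: (@le_trans _ _ (\sum_(v < n) expR (3 * (Ci * ln n%:R) - a1))); last first.
  by rewrite sumr_const card_ord -[leLHS]mulr_natl.
apply: ler_sum => v _; rewrite sum_lawP -[leRHS]mul1r -[X in _ <= X * _](@bern_sum1 R 'I_k p) mulr_suml.
apply: ler_sum => M _; apply: ler_wpM2l; first exact: bern_ge0 hal_prob01.
pose h (i : 'I_k) (P : gpath n) : R := ((i \in M) && (v \in (P : seq 'I_n)))%:R.
have hE U : #|[set i in M | v \in (U i : seq 'I_n)]|%:R = \sum_i h i (U i).
  rewrite -sum1_card natr_sum big_mkcond; apply: eq_bigr => i _.
  by rewrite inE /h; case: (_ && _).
rewrite (eq_bigl (fun U : {ffun 'I_k -> gpath n} => a1 < \sum_i h i (U i))); last by move=> U; rewrite /= hE.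
apply: plaw_chernoff => [i P|i|i P|].
- exact: path_law_ge0.
- exact: path_law_sum1.
- by rewrite /h ler0n lern1 leq_b1.
case e : (sol M) => [y|]; last first.
  rewrite big1 ?mulr_ge0 // => i _; rewrite big1 // => P _.
  rewrite /path_law e /h; case: eqP => [->|_]; last by rewrite mul0r.
  by rewrite in_nil andbF mulr0.
apply: (@le_trans _ _ (y.2 v)); last first.
  by have := solP M; rewrite e => -[[_ _ _ /(_ v)/andP[]]].
apply: le_trans (lp_load v e); rewrite [leRHS]big_mkcond; apply: ler_sum => i _.
case: ifP => iM; last by rewrite big1 // => P _; rewrite /h iM mulr0.
rewrite -path_law_load ?e //; apply: ler_sum => P _; by rewrite /h iM.
Qed.

(** * The optimum as a solution for the sampled demands *)

Section Optimum.
Variable Opt : {set 'I_n}.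
Hypothesis Opt_feasible : feasible I Opt.

Lemma induced_path i (P : gpath n) : P \in paths (induced (edge I) Opt) (src I i) (tgt I i) ->
  P \in req_paths I i /\ {subset (P : seq 'I_n) <= Opt}.
Proof.
rewrite !inE; case E : (P : seq 'I_n) => [//|s q] /and4P[/eqP -> hq hl hu].
rewrite eqxx hl hu (sub_path _ hq) => [|u v /and3P[]//]; split=> //.
have ne : src I i != tgt I i by case: wf => _ [].
case: q hq hl {hu E} => [|v q] hq hl; first by rewrite /= (negbTE ne) in hl.
have sO : src I i \in Opt by case/andP: hq => /and3P[].
move=> u; rewrite inE => /predU1P[->//|]; move: (v :: q) (src I i) hq {sO hl ne} => {v}q.
elim: q => [//|v q IH] s' /= /andP[/and3P[_ _ hv] hq].
by rewrite inE => /predU1P[->//|]; exact: IH hq.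
Qed.

(** The flow in [Opt] is scaled by [cap I], and [y.2] is the unscaled load that [M] puts on a
    vertex; it vanishes outside [Opt]. *)
Lemma fits_of_load (f : 'I_k -> gpath n -> R) M :
  (forall i P, 0 <= f i P) ->
  (forall i, \sum_(P in paths (induced (edge I) Opt) (src I i) (tgt I i)) f i P = 1) ->
  (forall v, \sum_(i in M) \sum_(P in paths (induced (edge I) Opt) (src I i) (tgt I i)
      | v \in (P : seq 'I_n)) f i P <= Ci * ln n%:R) ->
  fits_in I Ci Opt M.
Proof.
move=> f0 f1 hload.
pose Q i := paths (induced (edge I) Opt) (src I i) (tgt I i).
pose y1 P := \sum_(i in M) (if P \in Q i then cap I * f i P else 0).
pose y2 v := \sum_(i in M) \sum_(P in Q i | v \in (P : seq 'I_n)) f i P.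
(* The source of a request path determines its pair, so the sum defining [y1] has a single term. *)
have y1E i P : i \in M -> P \in req_paths I i -> y1 P = if P \in Q i then cap I * f i P else 0.
  move=> iM hP; rewrite /y1 (bigD1 i) //= [X in _ + X]big1 ?addr0 // => i' /andP[_ ne].
  case: ifP => // /induced_path[hP' _]; case/eqP: ne; apply: src_inj.
  move: hP hP'; rewrite !inE; case: (P : seq 'I_n) => [//|s q].
  by case/and4P=> /eqP -> _ _ _ /and4P[/eqP -> _ _ _].
exists (y1, y2); last first.
  move=> v vO; rewrite /= /y2 big1 // => i _; rewrite big1 // => P /andP[/induced_path[_ h] /h].
  by rewrite (negbTE vO).
split=> [P|i iM|v|v] /=.
- by apply: sumr_ge0 => i _; case: ifP => // _; rewrite mulr_ge0 // ltW.
- rewrite (eq_bigr (fun P => if P \in Q i then cap I * f i P else 0)); last by move=> P; exact: y1E.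
  rewrite -[leLHS]mulr1 -(f1 i) mulr_sumr -big_mkcondr /= [leLHS]big_mkcond [leRHS]big_mkcond.
  apply: ler_sum => P _; case: ifP => [hP|_]; last by case: ifP => // _; rewrite mulr_ge0 // ltW.
  by have [-> _] := induced_path hP.
- rewrite /y2 mulr_sumr; apply: ler_sum => i iM; rewrite mulr_sumr.
  rewrite (eq_bigr (fun P => if P \in Q i then cap I * f i P else 0)); last first.
    by move=> P /andP[hP _]; exact: y1E.
  rewrite -big_mkcondr /= [leLHS]big_mkcond [leRHS]big_mkcond.
  apply: ler_sum => P _; rewrite -andbA andbC; case: ifP => [/andP[/andP[h1 h2] h3]|_].
    by rewrite h2 h1.
  by case: ifP => // _; rewrite mulr_ge0 // ltW.
- by rewrite hload andbT; apply: sumr_ge0 => i _; apply: sumr_ge0.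
Qed.

(** All pairs together send at most [cap I] through [v], and sampling has probability at most
    [C * ln n / cap I], so the mean load is at most [C * ln n]; each pair contributes at most 1. *)
Lemma fits_tail :
  \sum_(M : {set 'I_k} | ~~ `[< fits_in I Ci Opt M >]) bern p M
    <= n%:R * expR (3 * (C * ln n%:R) - Ci * ln n%:R).
Proof.
have [f [f0 f1 fcap]] := Opt_feasible.
have f1' i : \sum_(P in paths (induced (edge I) Opt) (src I i) (tgt I i)) f i P = 1.
  by apply: f1; rewrite inE.
pose g (v : 'I_n) i := \sum_(P in paths (induced (edge I) Opt) (src I i) (tgt I i)
      | v \in (P : seq 'I_n)) f i P.
have g0 v i : 0 <= g v i by apply: sumr_ge0.
have g1 v i : g v i <= 1.
  rewrite -(f1' i) /g [leLHS]big_mkcondr; apply: ler_sum => P _; by case: ifP.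
apply: (@le_trans _ _ (\sum_(v < n) \sum_(M : {set 'I_k} | Ci * ln n%:R < \sum_(i in M) g v i) bern p M)).
  apply: union_bound => [M|M hM]; first exact: bern_ge0 hal_prob01.
  have [/existsP[v hv]|none] := boolP [exists v, Ci * ln n%:R < \sum_(i in M) g v i]; first by exists v.
  case/negP: hM; apply/asboolP; apply: (fits_of_load f0 f1') => v.
  by move: none; rewrite negb_exists => /forallP/(_ v); rewrite -leNgt.
apply: (@le_trans _ _ (\sum_(v < n) expR (3 * (C * ln n%:R) - Ci * ln n%:R))); last first.
  by rewrite sumr_const card_ord -[leLHS]mulr_natl.
apply: ler_sum => v _; apply: bern_chernoff_up => [|i|]; first exact: hal_prob01.
  by rewrite g0 g1.
rewrite -[leRHS]mulr1; apply: hal_prob_cap; first by apply: sumr_ge0.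
rewrite mul1r; have := fcap v; rewrite inE => /(_ isT); apply: le_trans.
by rewrite [leRHS](eq_bigl predT) // => i; rewrite inE.
Qed.

(** * Expected cost of the clusters and chosen paths *)

Section Cost.
Variables (m : nat) (T : 'I_m -> cluster n).
Let Tcost := \sum_j costs (cost I) (cl_verts (T j)).

Lemma cost_Fverts w : costs (cost I) (Fverts T w) <=
  Tcost + \sum_v cost I v * #|[set i in w.1 | v \in (w.2 i : seq 'I_n)]|%:R.
Proof.
rewrite /Tcost /costs (eq_bigr (fun j => \sum_v cost I v * (v \in cl_verts (T j))%:R)); last first.
  by move=> j _; rewrite big_mkcond; apply: eq_bigr => v _; case: (_ \in _); rewrite ?mulr1 ?mulr0.
rewrite exchange_big -big_split [leLHS]big_mkcond /=; apply: ler_sum => v _.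
have sum0 : 0 <= \sum_(j < m) cost I v * (v \in cl_verts (T j))%:R.
  by apply: sumr_ge0 => j _; rewrite mulr_ge0.
have card0 : 0 <= cost I v * #|[set i in w.1 | v \in (w.2 i : seq 'I_n)]|%:R.
  by rewrite mulr_ge0.
case: ifP => [|_]; last by rewrite addr_ge0.
rewrite inE => /orP[/existsP[j hj]|/existsP[i /andP[iM hi]]].
  rewrite -[leLHS]addr0; apply: lerD => //; rewrite (bigD1 j) //= hj mulr1 lerDl.
  by apply: sumr_ge0 => j' _; rewrite mulr_ge0.
rewrite -[leLHS]add0r; apply: lerD => //; rewrite ler_peMr // ler1n card_gt0.
by apply/set0Pn; exists i; rewrite inE iM.
Qed.

Lemma fits_sol M : fits_in I Ci Opt M -> exists2 y, sol M = Some y &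
  lp_obj I y <= Ci * ln n%:R * costs (cost I) Opt.
Proof.
move=> [y' hy' y'0]; have := solP M; case e : (sol M) => [y|]; last by move=> /(_ y').
move=> [_ /(_ y' hy') h]; exists y => //; apply: le_trans h _.
rewrite /lp_obj /costs mulr_sumr [leRHS]big_mkcond; apply: ler_sum => v _.
case: ifP => [_|/negbT/y'0 ->]; last by rewrite mulr0.
by rewrite mulrC; apply: ler_wpM2r => //; case: hy' => _ _ _ /(_ v)/andP[].
Qed.

Let bnd := Tcost + Ci * ln n%:R * costs (cost I) Opt.

Lemma expect_fits_cond M : fits_in I Ci Opt M ->
  \sum_U plaw (path_law I sol M) U * costs (cost I) (Fverts T (M, U)) <= bnd.
Proof.
move=> /fits_sol[y e hobj].
have pl0 U : 0 <= plaw (path_law I sol M) U by apply: prodr_ge0 => i _; exact: path_law_ge0.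
apply: (@le_trans _ _ (\sum_U plaw (path_law I sol M) U * (Tcost +
    \sum_v cost I v * #|[set i in M | v \in (U i : seq 'I_n)]|%:R))).
  by apply: ler_sum => U _; apply: ler_wpM2l => //; exact: (cost_Fverts (M, U)).
under eq_bigr do rewrite mulrDr.
rewrite big_split /= -mulr_suml plaw1 mul1r lerD2l; apply: le_trans hobj.
under eq_bigr do rewrite mulr_sumr.
rewrite exchange_big /=; apply: ler_sum => v _.
under eq_bigr do rewrite mulrCA.
rewrite -mulr_sumr; apply: ler_wpM2l => //; apply: le_trans (lp_load v e).
rewrite (eq_bigr (fun U => \sum_(i in M) plaw (path_law I sol M) U * (v \in (U i : seq 'I_n))%:R)); last first.
  move=> U _; rewrite -mulr_sumr; congr (_ * _); rewrite -sum1_card natr_sum big_mkcond [RHS]big_mkcond.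
  by apply: eq_bigr => i _; rewrite inE; case: (i \in M) => //=; case: (_ \in _).
rewrite exchange_big /=; apply: ler_sum => i iM.
rewrite (plaw_marginal (fun P : gpath n => (v \in (P : seq 'I_n))%:R)); last exact: path_law_sum1.
by rewrite path_law_load // e.
Qed.

Lemma expect_fits :
  Expect I C sol (fun w => costs (cost I) (Fverts T w) * `[< fits_in I Ci Opt w.1 >]%:R)
    <= bnd * Prob I C sol (fun w => fits_in I Ci Opt w.1).
Proof.
rewrite /Expect /Prob (sum_law_fst (fun M => `[< fits_in I Ci Opt M >])) sum_law.
rewrite mulr_sumr [leRHS]big_mkcond; apply: ler_sum => M _; case: asboolP => hM.
  rewrite [leRHS]mulrC; apply: ler_wpM2l; first exact: bern_ge0 hal_prob01.
  by under eq_bigr do rewrite mulr1; exact: expect_fits_cond.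
by rewrite big1 ?mulr0 // => U _; rewrite mulr0 mulr0.
Qed.

(** When the demands do not fit, the cost is estimated by that of [n] vertices of cost [c]. *)
Lemma expect_all (c : R) : 0 <= c -> (forall v, cost I v <= c) ->
  Expect I C sol (fun w => costs (cost I) (Fverts T w)) <=
    bnd * Prob I C sol (fun w => fits_in I Ci Opt w.1)
    + n%:R * c * \sum_(M : {set 'I_k} | ~~ `[< fits_in I Ci Opt M >]) bern p M.
Proof.
move=> c0 hc; rewrite /Expect.
rewrite (eq_bigr (fun w => law I C sol w * (costs (cost I) (Fverts T w) * `[< fits_in I Ci Opt w.1 >]%:R)
  + law I C sol w * (costs (cost I) (Fverts T w) * (~~ `[< fits_in I Ci Opt w.1 >])%:R))); last first.
  by move=> w _; rewrite -mulrDr -mulrDr; case: asboolP => _; rewrite ?addr0 ?add0r mulr1.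
rewrite big_split /=; apply: lerD; first exact: expect_fits.
rewrite -(sum_law_fst (fun M => ~~ `[< fits_in I Ci Opt M >])) mulr_sumr [leRHS]big_mkcond.
apply: ler_sum => w _; case: ifP => _ /=; last by rewrite !mulr0.
rewrite mulr1 [leRHS]mulrC; apply: ler_wpM2l; first exact: law_ge0.
apply: (@le_trans _ _ (\sum_(v in 'I_n) c)); last by rewrite sumr_const card_ord -[leLHS]mulr_natl.
rewrite /costs big_mkcond; apply: ler_sum => v _; by case: ifP.
Qed.

End Cost.
End Optimum.
End Law.

(** * Union bounds for the cuts and degrees of the sample *)

Section Tails.
Variables (R : realType) (n k d : nat) (I : mcnc R n k) (C : R).
Hypothesis n1 : (1 < n)%N.
Hypothesis k_le : (2 * k <= n)%N.
Hypothesis wf : mcnc_wf I.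
Hypothesis C_big : 32 * 256 * (d + 5)%:R <= C.

Let p := hal_prob I C.
Let tiny : R := (n%:R ^+ d.+3)^-1.
Let cap0 : 0 < cap I. Proof. by case: wf. Qed.
Let npos : (0 < n)%N. Proof. exact: ltnW. Qed.
Let n0 : 0 < n%:R :> R. Proof. by rewrite ltr0n. Qed.
Let lnh : 1 / 2 <= ln n%:R :> R. Proof. exact: ln_nat_ge_half. Qed.
Let C0 : 0 <= C. Proof. by apply: le_trans C_big; rewrite !mulr_ge0. Qed.

Lemma tinyE (c : R) : (d + 4)%:R * ln n%:R <= c -> n%:R * expR (- c) <= tiny.
Proof.
move=> hc; apply: (@le_trans _ _ (n%:R * expR (- ((d + 4)%:R * ln n%:R)))).
  by apply: ler_wpM2l; [exact: ltW|rewrite ler_expR lerN2].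
rewrite (expRN_natln R _ npos).
by rewrite /tiny addn4 exprS invfM mulrA divff ?gt_eqF // mul1r.
Qed.

Lemma card_lt_n (D : {set 'I_k}) : (#|D| < n)%N.
Proof. apply: leq_ltn_trans (max_card _) _; rewrite card_ord; move: k_le npos; lia. Qed.

(** If [lam = n], all cuts are empty. Otherwise [lam >= cap I / 256], and [C_big] gives
    [p * lam >= 32 * (d + 5) * ln n]. The lower tail of a cut has exponent [p / 4] per edge: in
    [sum_cuts] one half of it covers [4 / lam * ln n], and the other half is [sg], for which
    [eps <= n ^ - (d + 4)]. *)
Lemma cut_tail (m lam : nat) (x y : 'I_k -> 'I_m.+1) (S : {set 'I_k}) :
  C * ln n%:R < cap I -> 128 * lam%:R <= cap I -> lam = n \/ cap I < 128 * lam.+1%:R ->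
  strong x y S lam ->
  \sum_(M : {set 'I_k} | ~~ [forall A : {set 'I_m.+1},
        p * #|cut x y S A|%:R / 4 <= #|M :&: cut x y S A|%:R]) bern p M <= tiny.
Proof.
move=> hp hl1 hl2 hS; have tiny0 : 0 <= tiny by rewrite invr_ge0 exprn_ge0 // ltW.
case: hl2 => [ln|hl2].
  rewrite big_pred0 // => M; apply/negbTE; rewrite negbK; apply/forallP => A.
  have -> : #|cut x y S A| = 0%N.
    by case: (hS A) => //; rewrite ln leqNgt card_lt_n.
  by rewrite mulr0 mul0r ler0n.
have p01 : 0 <= p <= 1 by exact: (hal_prob01 wf C0).
have cap128 : 128 <= cap I.
  have h1 : 32 * 256 * 5%:R <= C by apply: le_trans C_big; apply: ler_wpM2l; rewrite ?ler_nat ?leq_addl //; lra.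
  have : 32 * 256 * 5%:R * (1 / 2) <= C * ln n%:R by apply: ler_pM => //; lra.
  lra.
have lam0 : (0 < lam)%N.
  by case: lam hl2 {hl1 hS} => //; rewrite mulr1 ltNge cap128.
have lamR : 1 <= lam%:R :> R by rewrite ler1n.
have hlam : cap I <= 256 * lam%:R.
  by move: hl2; rewrite -[lam.+1%:R]natr1; lra.
have pE : p = C * ln n%:R / cap I.
  by rewrite /p /hal_prob min_r // ler_pdivrMr // mul1r ltW.
have plam : 32 * ((d + 5)%:R * ln n%:R) <= p * lam%:R.
  have h1 : p * cap I = C * ln n%:R by rewrite pE mulfVK // gt_eqF.
  have h2 : p * cap I <= p * (256 * lam%:R) by apply: ler_wpM2l => //; case/andP: p01.
  have h3 : 32 * 256 * (d + 5)%:R * ln n%:R <= C * ln n%:R.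
    by apply: ler_wpM2r => //; exact: ln_nat_ge0.
  lra.
have dln : 5 * ln n%:R <= (d + 5)%:R * ln n%:R :> R.
  by apply: ler_wpM2r; rewrite ?ln_nat_ge0 // ler_nat leq_addl.
set eps := 2 * expR (- (p / 8 * lam%:R / 4)).
have epsE : eps <= (n%:R ^+ (d + 4))^-1.
  rewrite -(expRN_natln R _ npos).
  apply: (@le_trans _ _ (n%:R * expR (- ((d + 5)%:R * ln n%:R)))).
    apply: ler_pM; rewrite ?expR_ge0 ?ler0n //; first by rewrite ler_nat.
    rewrite ler_expR lerN2; lra.
  rewrite -[X in X * _](lnK (_ : n%:R \is Num.pos)) ?posrE // -expRD ler_expR.
  rewrite addnS -natr1; lra.
have eps0 : 0 <= eps by rewrite mulr_ge0 ?expR_ge0.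
have nd1 : (n%:R ^+ (d + 4))^-1 <= 1 :> R.
  by rewrite invf_le1 ?exprn_gt0 // exprn_ege1 // ler1n.
have eps1 : eps <= 1 := le_trans epsE nd1.
apply: (@le_trans _ _ (\sum_(D in cuts x y S) \sum_(M : {set 'I_k} | #|M :&: D|%:R < p * #|D|%:R / 4) bern p M)).
  apply: union_bound => [M|M]; first exact: bern_ge0.
  rewrite negb_forall => /existsP[A hA]; exists (cut x y S A); last by rewrite ltNge.
  apply/cutsP; exists A => //; apply/eqP => e; move: hA.
  by rewrite e cards0 mulr0 mul0r ler0n.
apply: (@le_trans _ _ (\sum_(D in cuts x y S) expR (- (p / 4 * #|D|%:R)))).
  apply: ler_sum => D _; apply: le_trans (bern_chernoff_low D p01) _.
  by rewrite ler_expR lerN2; lra.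
have p0 : 0 <= p by case/andP: p01.
apply: (@le_trans _ _ (n%:R * eps ^+ 2)).
  apply: (sum_cuts (c := lam)) => //.
  - by rewrite divr_ge0.
  - move=> D /cutsP[A -> D0]; case: (hS A) => // h.
    by move: D0; rewrite -cards_eq0 h.
  - apply: leq_trans k_le; rewrite mul2n -addnn.
    apply: (@leq_trans #|x @: [set: 'I_k] :|: y @: [set: 'I_k]|).
      apply: subset_leq_card; apply/subsetP => v; rewrite inE => /existsP[i /and3P[_ _ hi]].
      by rewrite inE; case/orP: hi => /eqP <-; rewrite imset_f ?orbT.
    apply: leq_trans (leq_card_setU _ _) _.
    by apply: leq_add; apply: leq_trans (leq_imset_card _ _) _; rewrite cardsT card_ord.
  - have h : 4 / lam%:R * ln n%:R <= p / 8.
      rewrite mulrAC ler_pdivrMr; last by rewrite ltr0n.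
      have -> : p / 8 * lam%:R = p * lam%:R / 8 by rewrite mulrAC.
      move: plam dln lnh; set t := (d + 5)%:R * ln n%:R; set u := p * lam%:R; set l := ln n%:R.
      move: t u l => t u l; lra.
    lra.
apply: (@le_trans _ _ (n%:R * (n%:R ^+ (d + 4))^-1)).
  apply: ler_wpM2l; first exact: ltW.
  by apply: le_trans epsE; rewrite expr2 ler_piMr.
by rewrite /tiny addn4 exprS invfM mulrA divff ?gt_eqF // mul1r.
Qed.

(** The union runs over the pairs [i0] of [S], fewer than [n], instead of over the nodes: a node of
    positive degree is [z i0] for one of them. *)
Lemma degree_tail (m : nat) (S : {set 'I_k}) (z : 'I_k -> 'I_m.+1) (c a2 : R) :
  0 <= c -> (forall i0, i0 \in S -> #|[set i in S | z i == z i0]|%:R <= c * cap I) ->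
  3 * (C * ln n%:R * c) + (d + 4)%:R * ln n%:R <= a2 ->
  \sum_(M : {set 'I_k} | [exists j : 'I_m.+1, a2 < #|[set i in S :&: M | z i == j]|%:R]) bern p M <= tiny.
Proof.
move=> c0 hc ha2; have p01 : 0 <= p <= 1 by exact: (hal_prob01 wf C0).
have a20 : 0 <= a2.
  apply: le_trans ha2; have := lnh; rewrite -[X in X <= _ -> _](addr0 (1 / 2)) => h.
  by rewrite addr_ge0 // !mulr_ge0 // ln_nat_ge0.
pose g (i0 i : 'I_k) : R := ((i \in S) && (z i == z i0))%:R.
apply: (@le_trans _ _ (\sum_(i0 in S) \sum_(M : {set 'I_k} | a2 < \sum_(i in M) g i0 i) bern p M)).
  apply: union_bound => [M|M /existsP[j hj]]; first exact: bern_ge0.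
  have [i0] : exists i0, i0 \in [set i in S :&: M | z i == j].
    by apply/set0Pn; rewrite -card_gt0 -(ltr0n R); apply: le_lt_trans hj.
  rewrite 2!inE => /andP[/andP[i0S _] /eqP zi0]; exists i0 => //.
  apply: lt_le_trans hj _; rewrite -sum1_card natr_sum big_mkcond [leRHS]big_mkcond /=.
  apply: ler_sum => i _; rewrite /g !inE zi0; case: (i \in S); case: (i \in M) => //=.
  by case: eqP.
apply: (@le_trans _ _ (\sum_(i0 in S) expR (- ((d + 4)%:R * ln n%:R)))).
  apply: ler_sum => i0 i0S.
  apply: (@le_trans _ _ (expR (3 * (C * ln n%:R * c) - a2))); last by rewrite ler_expR; lra.
  apply: bern_chernoff_up => //; first by move=> i; rewrite /g ler0n lern1 leq_b1.
  apply: hal_prob_cap => //; first by apply: sumr_ge0.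
  apply: le_trans (hc i0 i0S); rewrite -sum1_card natr_sum [leRHS]big_mkcond.
  by apply: ler_sum => i _; rewrite /g inE; case: (_ && _).
rewrite sumr_const -[leLHS]mulr_natl.
apply: le_trans (tinyE (lexx _)); apply: ler_wpM2r; first exact: expR_ge0.
by rewrite ler_nat ltnW // card_lt_n.
Qed.

End Tails.

(** * Elementary bounds on the instance and on the number of scales *)

Section Preliminaries.
Variable R : realType.

Lemma pairs_le n k (I : mcnc R n k) : mcnc_wf I -> (2 * k <= n)%N.
Proof.
case=> _ [si ti st] _ _.
have cs : #|src I @: [set: 'I_k]| = k by rewrite card_imset // cardsT card_ord.
have ct : #|tgt I @: [set: 'I_k]| = k by rewrite card_imset // cardsT card_ord.
have -> : (2 * k = #|src I @: [set: 'I_k]| + #|tgt I @: [set: 'I_k]|)%N.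
  by rewrite cs ct mul2n addnn.
rewrite -[leqRHS]card_ord.
have -> : (#|src I @: [set: 'I_k]| + #|tgt I @: [set: 'I_k]|
    = #|(src I @: [set: 'I_k]) :|: (tgt I @: [set: 'I_k])|)%N.
  rewrite cardsU (_ : _ :&: _ = set0) ?cards0 ?subn0 //; apply/setP => v; rewrite !inE.
  by apply/negP => /andP[/imsetP[i _ ->] /imsetP[j _ /eqP e]]; move: (st i j); rewrite e.
exact: max_card.
Qed.

Lemma cap_ge1 n k (I : mcnc R n k) (W : {set 'I_n}) : feasible I W -> (0 < k)%N -> 1 <= cap I.
Proof.
move=> [f [f0 f1 fcap]] k0; pose i0 := Ordinal k0.
have := fcap (src I i0); rewrite inE => /(_ isT); apply: le_trans.
rewrite (bigD1 i0) ?inE //= -(f1 i0) ?inE //.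
rewrite [X in _ <= X + _](_ : _ = \sum_(P in paths (induced (edge I) W) (src I i0) (tgt I i0)) f i0 P).
  rewrite lerDl; apply: sumr_ge0 => i _; exact: sumr_ge0.
apply: eq_bigl => P; rewrite andb_idr // inE.
by case: (P : seq 'I_n) => [//|s q] /and4P[/eqP -> _ _ _]; rewrite inE eqxx.
Qed.

Lemma routable_mono n k (e : rel 'I_n) (s t : 'I_k -> 'I_n) S B (b b' : R) : b <= b' ->
  routable e s t S B b -> routable e s t S B b'.
Proof. by move=> bb [f [h1 h2 h3]]; exists f; split=> // v /h3 /le_trans; apply. Qed.

(** In a complete graph with unit costs and one source, every solution contains source and sink, and
    these two suffice. The bound allows terms without the ratio to be absorbed in the cost
    estimate. *)
Lemma ssnc_ratio_ge1 (A : ssnc_algorithm R) alpha beta n :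
  ssnc_approx A alpha beta -> (1 < n)%N -> 1 <= alpha n.
Proof.
move=> hA n1.
pose s := Ordinal (ltnW n1); pose t := Ordinal n1.
have st : s != t by [].
pose J := Ssnc [rel u v : 'I_n | u != v] (fun _ : 'I_1 => s) t (fun=> 1 : R) 1.
have wfJ : ssnc_wf J.
  split=> //=.
    by split=> [u v|u]; rewrite /= ?eqxx // eq_sym.
  by split=> [i j _|//]; rewrite [i]ord1 [j]ord1.
pose W0 : {set 'I_n} := [set s; t].
have feas : ssnc_feasible J W0.
  have sz : (size [:: s; t] <= n)%N by [].
  pose P0 : gpath n := Bseq sz.
  have P0in : P0 \in paths (induced (ss_edge J) W0) s t.
    by rewrite inE /= /induced /= !inE ?eqxx ?orbT.
  have sum1 (B : pred (gpath n)) : \sum_(P in paths (induced (ss_edge J) W0) s t | B P) (P == P0)%:R = (B P0)%:R :> R.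
    rewrite big_mkcond (bigD1 P0) //= P0in ?eqxx big1 ?addr0; first by case: (B P0).
    by move=> P /negbTE ->; case: ifP.
  exists (fun _ P => (P == P0)%:R); split=> [i P|i _|v _] /=; first exact: ler0n.
    by apply: etrans (sum1 predT); apply: eq_bigl => P; rewrite andbT.
  rewrite (bigD1 ord0) ?inE //= sum1 big1 ?addr0 ?lern1 ?leq_b1 // => i.
  by rewrite [i]ord1 andbF.
have := hA n 1%N J wfJ (ex_intro _ W0 feas).
case: (A n 1%N J) => W U [h1 h2 _]; have := h1 W0 feas; have := h2 ord0.
rewrite inE; case: (U ord0 : seq 'I_n) => [//|u q] /and4P[/eqP -> hq /eqP hl _].
have [sW tW] : s \in W /\ t \in W.
  case: q hq hl => [_ /= e|v q /= /andP[/and3P[_ sW vW] hq] hl]; first by rewrite -e eqxx in st.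
  split=> //; rewrite -hl.
  elim: q v vW hq {hl} => [//|v' q IH] v vW /= /andP[/and3P[_ _ v'W]]; exact: IH.
have cost1 (X : {set 'I_n}) : costs (ss_cost J) X = #|X|%:R by rewrite /costs sumr_const.
rewrite !cost1 cards2 st => h.
have h2' : 2 <= #|W|%:R :> R.
  rewrite ler_nat -[2%N]/((s != t).+1) -cards2; apply: subset_leq_card.
  by apply/subsetP => v; rewrite !inE => /orP[] /eqP ->.
have : 2 <= alpha n * 2 := le_trans h2' h; lra.
Qed.

Lemma ln_nat_le (n : nat) : ln n%:R <= n%:R :> R.
Proof.
case: n => [|n]; first by rewrite ln0.
have h : - 1 < n%:R :> R by apply: (lt_le_trans _ (ler0n _ _)); rewrite ltrN10.
by rewrite -natr1 addrC; apply: le_trans (le_ln1Dx h) _; rewrite lerDr.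
Qed.

Lemma scales_le (n m : nat) (b : R) : (1 < n)%N -> 0 < b -> m%:R <= b * n%:R * ln n%:R ->
  exists2 L : nat, (m.+1 < 2 ^ L)%N & L%:R <= (4 * ln (b + 1) + 6) * ln n%:R :> R.
Proof.
move=> n1 b0 hm; exists (trunc_log 2 m.+1).+1; first exact: trunc_log_ltn.
set t := trunc_log 2 m.+1.
have ht : (2 ^ t <= m.+1)%N by apply: trunc_logP.
have nR : 1 <= n%:R :> R by rewrite ler1n ltnW.
have nR0 : 0 < n%:R :> R by apply: lt_le_trans nR.
have lnh := @ln_nat_ge_half R n n1.
have hm1 : (2 ^ t)%:R <= (b + 1) * n%:R ^+ 2 :> R.
  apply: (@le_trans _ _ m.+1%:R); first by rewrite ler_nat.
  rewrite -natr1 mulrDl mul1r; apply: lerD.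
    apply: le_trans hm _; rewrite -mulrA; apply: ler_wpM2l; first exact: ltW.
    by rewrite expr2; apply: ler_wpM2l; [exact: ltW|exact: ln_nat_le].
  by rewrite exprn_ege1.
have b1 : 0 < b + 1 by rewrite addr_gt0.
have hln : ln (2 : R) * t%:R <= ln (b + 1) + 2 * ln n%:R.
  have : ln ((2 ^ t)%:R : R) <= ln ((b + 1) * n%:R ^+ 2).
    by rewrite ler_ln // posrE ?ltr0n ?expn_gt0 // mulr_gt0 // exprn_gt0.
  have -> : ln ((2 ^ t)%:R : R) = ln 2 * t%:R by rewrite natrX lnXn // mulr_natr.
  by rewrite lnM ?posrE ?exprn_gt0 // lnXn // [2 * _]mulr_natl.
have l2 := @ln2_ge_half R.
have t0 : 0 <= t%:R :> R := ler0n _ _.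
have lb : 0 <= ln (b + 1) by apply: ln_ge0; rewrite lerDr ltW.
rewrite -natr1; nra.
Qed.

End Preliminaries.

(** * The theorem *)

Section Constants.
Variable R : realType.

(** Chernoff thresholds: three times the mean, plus [(d + 4) * ln n] so that at most [n] events fail
    together with probability at most [n ^ - (d + 3)]. In [degree_const], the factor 2 of [d + 4]
    raises [ln n] to its square, as [ln n >= 1 / 2]. *)
Definition link_const (d : nat) (Ci : R) : R := 3 * Ci + (d + 4)%:R.
Definition degree_const (d : nat) (C Cii : R) : R := 3 * (C * Cii) + 2 * (d + 4)%:R.
Definition scale_const (b : R) : R := 4 * ln (b + 1) + 6.
Definition route_const (d : nat) (C Ci Cii b : R) : R :=
  2 * b * Cii + 4 * link_const d Ci
  + 384 * scale_const b / C * (4 * link_const d Ci + 2 * b * degree_const d C Cii).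

Lemma cube_ge (l B c : R) : 1 / 2 <= l -> 1 <= B -> 0 <= c -> c * l <= 4 * c * B * l ^+ 3.
Proof.
move=> hl hB c0.
have h2 : 1 <= 4 * (l * l) * B by nra.
have -> : 4 * c * B * l ^+ 3 = c * l * (4 * (l * l) * B) by ring.
by rewrite ler_peMr // mulr_ge0 //; lra.
Qed.

(** [t1] bounds the share of the pairs inside clusters, [t2] cancels the number of scales against
    the sampling probability, [t3] bounds the links; lower powers of [l] are raised to the cube by
    [l >= 1 / 2]. *)
Lemma const_bound (C Cii b K1 K2 K3 l B q Lg : R) : 0 < C -> 0 <= Cii -> 0 <= b ->
  0 <= K1 -> 0 <= K2 -> 0 <= K3 -> 1 / 2 <= l -> 1 <= B -> 0 < q -> 0 <= Lg -> Lg <= K3 * l ->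
  b * l * (Cii * B * l * q) + 96 * Lg * (4 / (C * l / q)) * (K1 * l + 2 * (b * l * (K2 * B * l ^+ 2)))
  <= (2 * b * Cii + 4 * K1 + 384 * K3 / C * (4 * K1 + 2 * b * K2)) * B * l ^+ 3 * q.
Proof.
move=> C0 Cii0 b0 K10 K20 K30 hl hB q0 Lg0 hLg.
have l0 : 0 < l by lra.
have B0 : 0 < B by lra.
have t1 : b * l * (Cii * B * l * q) <= 2 * b * Cii * B * l ^+ 3 * q.
  have -> : b * l * (Cii * B * l * q) = b * Cii * B * (l * l) * q * 1 by ring.
  have -> : 2 * b * Cii * B * l ^+ 3 * q = b * Cii * B * (l * l) * q * (2 * l) by ring.
  by apply: ler_wpM2l; [rewrite !mulr_ge0 // ltW|lra].
have t2 : 96 * Lg * (4 / (C * l / q)) <= 384 * K3 / C * q.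
  have -> : 96 * Lg * (4 / (C * l / q)) = 384 / C * q * (Lg / l).
    by field; rewrite !gt_eqF.
  have -> : 384 * K3 / C * q = 384 / C * q * K3 by field; rewrite gt_eqF.
  apply: ler_wpM2l; first by rewrite !mulr_ge0 // ?invr_ge0 ltW.
  by rewrite ler_pdivrMr.
have t3 : K1 * l + 2 * (b * l * (K2 * B * l ^+ 2)) <= (4 * K1 + 2 * b * K2) * B * l ^+ 3.
  have h := cube_ge hl hB K10.
  have -> : 2 * (b * l * (K2 * B * l ^+ 2)) = 2 * b * K2 * B * l ^+ 3 by ring.
  have -> : (4 * K1 + 2 * b * K2) * B * l ^+ 3 = 4 * K1 * B * l ^+ 3 + 2 * b * K2 * B * l ^+ 3 by ring.
  by rewrite lerD2r.
have t4 : 0 <= K1 * l + 2 * (b * l * (K2 * B * l ^+ 2)).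
  by rewrite addr_ge0 ?mulr_ge0 ?exprn_ge0 // ltW.
have t5 : 0 <= 96 * Lg * (4 / (C * l / q)).
  by rewrite !mulr_ge0 ?invr_ge0 ?mulr_ge0 ?invr_ge0 // ltW.
have t6 := ler_pM t5 t4 t2 t3.
have t7 : 0 <= 4 * K1 * B * l ^+ 3 * q by rewrite !mulr_ge0 // ltW.
apply: le_trans (lerD t1 t6) _; rewrite -subr_ge0.
by apply: le_trans t7 _; rewrite le_eqVlt; apply/orP; left; apply/eqP; field; rewrite gt_eqF.
Qed.

End Constants.

Section Union.
Variables (R : realType) (O : finType) (l : O -> R).
Hypothesis l0 : forall w, 0 <= l w.

Lemma sum_or (B B' : pred O) :
  \sum_(w | B w || B' w) l w <= \sum_(w | B w) l w + \sum_(w | B' w) l w.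
Proof.
rewrite [leLHS]big_mkcond [X in _ <= X + _]big_mkcond [X in _ <= _ + X]big_mkcond -big_split.
by apply: ler_sum => w _; case: (B w); case: (B' w); rewrite /= ?addr0 ?add0r // lerDl.
Qed.

Lemma sum_cover (Q B : pred O) : (forall w, Q w -> l w != 0 -> B w) ->
  \sum_(w | Q w) l w <= \sum_(w | B w) l w.
Proof.
move=> h; rewrite [leLHS]big_mkcond [leRHS]big_mkcond; apply: ler_sum => w _.
case: ifP => [Qw|_]; last by case: ifP.
by case: ifP => // /negbT nB; rewrite le_eqVlt; apply/orP; left; apply: contraNT nB; exact: h.
Qed.

End Union.

(** * All bad events together *)

Section WithHighProbability.
Variables (R : realType) (n k d : nat) (I : mcnc R n k) (C Ci Cii b beta : R).
Variables (Opt : {set 'I_n}) (m : nat) (T : 'I_m -> cluster n).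
Variable sol : {set 'I_k} -> option (lp_sol R n).
Hypothesis n1 : (1 < n)%N.
Hypothesis k0 : (0 < k)%N.
Hypothesis wf : mcnc_wf I.
Hypothesis feas : feasible I Opt.
Hypothesis solP : lp_solver I Ci sol.
Hypothesis C_big : 32 * 256 * (d + 5)%:R <= C.
Hypothesis Ci_big : 3 * C + (d + 4)%:R <= Ci.
Hypothesis Cii0 : 0 < Cii.
Hypothesis b0 : 0 < b.
Hypothesis beta1 : 1 <= beta.
Let L := Cii * beta ^+ 2 * ln n%:R * cap I.
Hypothesis clusters : forall j, cluster_wf I (T j) /\ (internal I L (T j) \/ external I L (T j)).
Hypothesis overlap : forall v, #|[set j | v \in cl_verts (T j)]|%:R <= b * ln n%:R.
Hypothesis terms_inj : forall v j j', v \in cl_terms (T j) -> v \in cl_terms (T j') -> j = j'.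
Variables (lam : nat) (x y : 'I_k -> 'I_m.+1) (S : {set 'I_k}).
Hypothesis lam1 : 128 * lam%:R <= cap I.
Hypothesis lam2 : lam = n \/ cap I < 128 * lam.+1%:R.
Hypothesis Sx : forall i, i \in S -> exists2 j : 'I_m, src I i \in cl_terms (T j) & x i = j :> nat.
Hypothesis Sy : forall i, i \in S -> exists2 j : 'I_m, tgt I i \in cl_terms (T j) & y i = j :> nat.
Hypothesis S_strong : strong x y S lam.

Let l : R := ln n%:R.
Let p := hal_prob I C.
Let tiny : R := (n%:R ^+ d.+3)^-1.
Let K1 := link_const d Ci.
Let K2 := degree_const d C Cii.
Let cap0 : 0 < cap I. Proof. by case: wf. Qed.
Let C0 : 0 < C.
Proof. by apply: lt_le_trans C_big; rewrite !mulr_gt0 // ltr0n addn_gt0 orbT. Qed.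
Let Ci0 : 0 <= Ci.
Proof. by apply: le_trans Ci_big; rewrite addr_ge0 ?mulr_ge0 // ltW. Qed.
Let lh : 1 / 2 <= l. Proof. exact: ln_nat_ge_half. Qed.
Let l0 : 0 <= l. Proof. exact: ln_nat_ge0. Qed.
Let B1 : 1 <= beta ^+ 2. Proof. exact: exprn_ege1. Qed.
Let B0 : 0 <= beta ^+ 2. Proof. exact: le_trans ler01 B1. Qed.

Let bad_fit (w : outcome n k) := ~~ `[< fits_in I Ci Opt w.1 >].
Let bad_link (w : outcome n k) :=
  [exists v, K1 * l < #|[set i in w.1 | v \in (w.2 i : seq 'I_n)]|%:R].
Let bad_cut (w : outcome n k) := ~~ [forall A : {set 'I_m.+1},
        p * #|cut x y S A|%:R / 4 <= #|w.1 :&: cut x y S A|%:R].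
Let bad_degree (z : 'I_k -> 'I_m.+1) (w : outcome n k) :=
  [exists j : 'I_m.+1, K2 * beta ^+ 2 * l ^+ 2 < #|[set i in S :&: w.1 | z i == j]|%:R].

Let law0 := law_ge0 wf (ltW C0) solP.

Lemma bad_fit_le : \sum_(w | bad_fit w) law I C sol w <= tiny.
Proof.
rewrite /bad_fit (sum_law_fst C wf solP (fun M => ~~ `[< fits_in I Ci Opt M >])).
apply: le_trans (fits_tail Ci wf (ltW C0) feas) _.
have -> : 3 * (C * ln n%:R) - Ci * ln n%:R = - (Ci * l - 3 * (C * l)) by rewrite opprB.
apply: tinyE => //.
have := ler_wpM2r l0 Ci_big; rewrite /l; lra.
Qed.

Lemma bad_link_le : \sum_(w | bad_link w) law I C sol w <= tiny.
Proof.
apply: le_trans (link_tail wf (ltW C0) Ci0 solP _) _.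
have -> : 3 * (Ci * ln n%:R) - K1 * l = - (K1 * l - 3 * (Ci * l)) by rewrite opprB.
by apply: tinyE => //; rewrite /K1 /link_const /l; lra.
Qed.

Lemma bad_cut_le : C * l < cap I -> \sum_(w | bad_cut w) law I C sol w <= tiny.
Proof.
move=> hp; rewrite /bad_cut (sum_law_fst C wf solP (fun M => ~~ [forall A : {set 'I_m.+1},
        p * #|cut x y S A|%:R / 4 <= #|M :&: cut x y S A|%:R])).
exact: (cut_tail n1 (pairs_le wf) wf C_big hp lam1 lam2 S_strong).
Qed.

Lemma load_le j : (load (T j))%:R <= L.
Proof. by have [_ [[]|[]]] := clusters j. Qed.

Lemma bad_degree_le (f : 'I_k -> 'I_n) (z : 'I_k -> 'I_m.+1) : injective f ->
  (forall i, i \in S -> exists2 j : 'I_m, f i \in cl_terms (T j) & z i = j :> nat) ->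
  \sum_(w | bad_degree z w) law I C sol w <= tiny.
Proof.
move=> finj Sz; rewrite /bad_degree (sum_law_fst C wf solP (fun M =>
  [exists j : 'I_m.+1, K2 * beta ^+ 2 * l ^+ 2 < #|[set i in S :&: M | z i == j]|%:R])).
apply: (degree_tail n1 (pairs_le wf) wf C_big (c := Cii * beta ^+ 2 * l)).
- by apply: mulr_ge0 => //; apply: mulr_ge0 => //; exact: ltW.
- move=> i0 i0S; have [j hj e] := Sz i0 i0S; apply: le_trans (load_le j).
  rewrite ler_nat /load -(card_imset _ finj); apply: subset_leq_card.
  apply/subsetP => v /imsetP[i + ->]; rewrite inE => /andP[iS /eqP ez].
  have [j' hj' e'] := Sz i iS; rewrite (_ : j = j') //.
  by apply: val_inj; rewrite /= -e -e' ez.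
rewrite /K2 /degree_const -/l.
have h1 : (d + 4)%:R * l <= 2 * (d + 4)%:R * beta ^+ 2 * l ^+ 2.
  have h2 : 1 <= 2 * (beta ^+ 2 * l).
    have h3 : l <= beta ^+ 2 * l by rewrite ler_peMl.
    by move: h3 lh; move: (beta ^+ 2 * l) l => u v; lra.
  have -> : 2 * (d + 4)%:R * beta ^+ 2 * l ^+ 2 = (d + 4)%:R * l * (2 * (beta ^+ 2 * l)) by ring.
  by rewrite ler_peMr // mulr_ge0.
have -> : (3 * (C * Cii) + 2 * (d + 4)%:R) * beta ^+ 2 * l ^+ 2
   = 3 * (C * l * (Cii * beta ^+ 2 * l)) + 2 * (d + 4)%:R * beta ^+ 2 * l ^+ 2 by ring.
by rewrite lerD2l.
Qed.

Lemma support_path (w : outcome n k) : law I C sol w != 0 -> ~~ bad_fit w ->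
  forall i, i \in w.1 -> w.2 i \in req_paths I i.
Proof.
rewrite negbK => hw /asboolP hfit i iM.
have [y' e _] := fits_sol wf solP hfit.
apply: (path_law_supp (sol := sol) (M := w.1)) => //; first by rewrite e.
move: hw; rewrite law_split mulf_eq0 negb_or => /andP[_ /prodf_neq0]; exact.
Qed.

Let Kr := route_const d C Ci Cii b.

(** The five bad events concern fitting, links, cuts and the degrees at the two ends; the exponent
    [d + 3] leaves room for them since [n ^ 3 >= 8]. *)
Lemma five_tiny : 5 * tiny <= (n%:R ^+ d)^-1.
Proof.
have n2 : 2 <= n%:R :> R by rewrite ler_nat.
have npos : 0 < n%:R :> R by lra.
have n3 : 8 <= n%:R ^+ 3 :> R.
  have -> : 8 = 2 ^+ 3 :> R by ring.
  by apply: lerXn2r; rewrite ?nnegrE // ltW.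
rewrite /tiny (_ : n%:R ^+ d.+3 = n%:R ^+ d * n%:R ^+ 3); last by rewrite -exprD addn3.
rewrite invfM mulrCA ler_piMr ?invr_ge0 ?exprn_ge0 ?(ltW npos) //.
by rewrite ler_pdivrMr ?exprn_gt0 // mul1r; lra.
Qed.

Lemma K1_ge0 : 0 <= K1. Proof. by rewrite /K1 /link_const addr_ge0 // mulr_ge0. Qed.

Lemma K2_ge0 : 0 <= K2.
Proof. by rewrite /K2 /degree_const addr_ge0 ?mulr_ge0 // ltW. Qed.

Lemma K3_ge0 : 0 <= scale_const b.
Proof. by rewrite /scale_const addr_ge0 // mulr_ge0 // ln_ge0 // lerDr ltW. Qed.

Lemma route_const_ge : 4 * K1 <= Kr.
Proof.
have h1 := K1_ge0; have h2 := K2_ge0; have h3 := K3_ge0.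
rewrite /Kr /route_const -/K1 -/K2 addrAC lerDr.
have hb := ltW b0; have hCii := ltW Cii0; have hC := ltW C0.
apply: addr_ge0; first by apply: mulr_ge0 => //; exact: mulr_ge0.
apply: mulr_ge0; first by apply: divr_ge0 => //; exact: mulr_ge0.
apply: addr_ge0; first exact: mulr_ge0.
by apply: mulr_ge0 => //; exact: mulr_ge0.
Qed.

Lemma route_whp : 1 - (n%:R ^+ d)^-1 <= Prob I C sol (fun w =>
   routable (Fedge T w) (src I) (tgt I) S setT (Kr * beta ^+ 2 * l ^+ 3 * cap I)).
Proof.
rewrite (prob_compl C wf solP) lerB //; apply: le_trans _ five_tiny.
have tiny0 : 0 <= tiny by rewrite invr_ge0 exprn_ge0.
have tree j : is_tree (edge I) (cl_verts (T j)) (cl_edge (T j)) by have [[]] := clusters j.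
have tv j : cl_terms (T j) \subset cl_verts (T j) by have [[]] := clusters j.
(* When the sampling probability is 1, the chosen paths already route [S], and [cap I >= 1] brings
   the load [K1 * l] below the required bound. *)
have [hp|hp] := ltP (C * l) (cap I); last first.
  apply: (@le_trans _ _ (\sum_(w | bad_fit w || bad_link w) law I C sol w)).
    apply: sum_cover => // w hw lw; apply: contraNT hw; rewrite negb_or => /andP[gf gl].
    apply/asboolP; apply: (routable_mono (b := K1 * l)).
      apply: le_trans (cube_ge lh B1 K1_ge0) _.
      have cap1 := cap_ge1 feas k0.
      rewrite -[leLHS]mulr1; apply: ler_pM => //.
        by rewrite mulr_ge0 ?exprn_ge0 // mulr_ge0 // mulr_ge0 // K1_ge0.
      by apply: ler_wpM2r; rewrite ?exprn_ge0 //; apply: ler_wpM2r => //; exact: route_const_ge.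
    apply: direct_routing.
    - have p1 : p = 1 by rewrite /p /hal_prob min_l // ler_pdivlMr // mul1r.
      apply/subsetP => i _; apply/negPn/negP => iM; case/eqP: lw.
      rewrite law_split -/p p1 /bern (bigD1 i) //= (negbTE iM) subrr !mul0r //.
    - exact: support_path.
    - by move=> v; move: gl; rewrite negb_exists => /forallP/(_ v); rewrite -leNgt.
  apply: le_trans (sum_or _ _ _) _ => //; have := bad_fit_le; have := bad_link_le; lra.
have hbad : \sum_(w | bad_fit w || bad_link w || bad_cut w || bad_degree x w || bad_degree y w)
    law I C sol w <= 5 * tiny.
  have h1 := bad_fit_le; have h2 := bad_link_le; have h3 := bad_cut_le hp.
  have h4 : \sum_(w | bad_degree x w) law I C sol w <= tiny.
    by apply: (bad_degree_le (f := src I)) => //; case: wf => _ [].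
  have h5 : \sum_(w | bad_degree y w) law I C sol w <= tiny.
    by apply: (bad_degree_le (f := tgt I)) => //; case: wf => _ [].
  apply: le_trans (sum_or law0 _ _) _.
  have := sum_or law0 (fun w => bad_fit w || bad_link w || bad_cut w) (bad_degree x).
  have := sum_or law0 (fun w => bad_fit w || bad_link w) bad_cut.
  have := sum_or law0 bad_fit bad_link.
  lra.
apply: le_trans hbad; apply: sum_cover => // w hw lw; apply: contraNT hw.
rewrite !negb_or => /andP[/andP[/andP[/andP[gf gl] gc] gx] gy]; apply/asboolP.
have wfT j : cluster_wf I (T j) by have [] := clusters j.
have [Lg hLg1 hLg2] := scales_le n1 b0 (clusters_le wfT b0 overlap).
have p0 : 0 < p.
  have lpos : 0 < l by apply: lt_le_trans lh; lra.
  by rewrite /p /hal_prob lt_min ltr01 divr_gt0 // mulr_gt0.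
have pE : p = C * l / cap I.
  by rewrite /p /hal_prob min_r // ler_pdivrMr // mul1r ltW.
(* Here [kappa = 4 / p], because on the good event a cut keeps a quarter of its expected number of
   sampled pairs. *)
apply: (routable_mono (b := (b * l) * L
   + 96 * Lg%:R * (4 / p) * (K1 * l + 2 * ((b * l) * (K2 * beta ^+ 2 * l ^+ 2))))).
  rewrite pE; apply: const_bound => //; rewrite ?(ltW Cii0) ?(ltW b0) //.
  - exact: K1_ge0.
  - exact: K2_ge0.
  - exact: K3_ge0.
have [_ [sinj tinj _] _ _] := wf.
apply: (routing (x := x) (y := y)) => //.
- exact: support_path.
- by rewrite divr_ge0 // ltW.
- by rewrite mulr_ge0 ?exprn_ge0 // mulr_ge0 // K2_ge0.
- by rewrite /L mulr_ge0 ?(ltW cap0) // mulr_ge0 // mulr_ge0 // ltW.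
- move=> A; rewrite mulrAC ler_pdivlMr //.
  move: gc; rewrite negbK => /forallP/(_ A).
  have -> : cut x y (S :&: w.1) A = w.1 :&: cut x y S A.
    by apply/setP => i; rewrite !inE andbA [(i \in w.1) && _]andbC.
  lra.
- move=> v; move: gl; rewrite negb_exists => /forallP/(_ v); rewrite -leNgt; apply: le_trans.
  rewrite ler_nat; apply: subset_leq_card; apply/subsetP => i; rewrite !inE.
  by move=> /andP[/andP[_ ->] ->].
- move=> j; move: gx; rewrite negb_exists => /forallP/(_ (widen_ord (leqnSn m) j)); rewrite -leNgt.
  by [].
- move=> j; move: gy; rewrite negb_exists => /forallP/(_ (widen_ord (leqnSn m) j)); rewrite -leNgt.
  by [].
- exact: load_le.
Qed.

End WithHighProbability.

Lemma small_n (R : realType) n k (I : mcnc R n k) : mcnc_wf I -> (n <= 1)%N -> k = 0%N.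
Proof. by move/pairs_le; lia. Qed.

(** * The event of fitting and the cost bounds *)

Section Fits.
Variables (R : realType) (n k d : nat) (I : mcnc R n k) (C Ci : R).
Variables (Opt : {set 'I_n}) (sol : {set 'I_k} -> option (lp_sol R n)).
Hypothesis wf : mcnc_wf I.
Hypothesis feas : feasible I Opt.
Hypothesis solP : lp_solver I Ci sol.
Hypothesis C0 : 0 <= C.
Hypothesis Ci_big : 3 * C + (d + 4)%:R <= Ci.

Let good (w : outcome n k) := fits_in I Ci Opt w.1.
Let Ci0 : 0 <= Ci.
Proof. by apply: le_trans Ci_big; rewrite addr_ge0 ?mulr_ge0. Qed.

Lemma no_pairs_fits (M : {set 'I_k}) : k = 0%N -> fits_in I Ci Opt M.
Proof.
move=> k0; have [f [f0 f1 _]] := feas.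
apply: (fits_of_load wf f0) => [i|v]; first by apply: f1; rewrite inE.
rewrite big1 ?mulr_ge0 ?ln_nat_ge0 // => i.
by exfalso; case: i => i; rewrite k0.
Qed.

(** The exponent exceeds the final one by 1: the additional factor [n] pays for the number of
    vertices when [expect_cost] charges the bad event. *)
Lemma good_whp : 1 - (n%:R ^+ d.+1)^-1 <= Prob I C sol good.
Proof.
have [n1|/(small_n wf) k0] := ltnP 1 n; last first.
  rewrite (prob_all C wf solP); last by move=> w; exact: no_pairs_fits.
  by rewrite gerBl invr_ge0 exprn_ge0.
rewrite (prob_compl C wf solP) lerB // (sum_law_fst C wf solP (fun M => ~~ `[< fits_in I Ci Opt M >])).
apply: le_trans (fits_tail Ci wf C0 feas) _.
have -> : 3 * (C * ln n%:R) - Ci * ln n%:R = - (Ci * ln n%:R - 3 * (C * ln n%:R)) by rewrite opprB.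
apply: le_trans (tinyE (d := d) n1 _) _.
  by have := ler_wpM2r (@ln_nat_ge0 R n) Ci_big; lra.
rewrite lef_pV2 ?posrE ?exprn_gt0 ?ltr0n ?(ltnW n1) //.
by apply: ler_weXn2l; [rewrite ler1n ltnW|rewrite ltnS leqW].
Qed.

Lemma prob_good_ge0 : 0 <= Prob I C sol good.
Proof. by apply: sumr_ge0 => w _; exact: (law_ge0 wf C0 solP). Qed.

Lemma prob_good_le1 : Prob I C sol good <= 1.
Proof.
rewrite (prob_compl C wf solP) gerBl; apply: sumr_ge0 => w _; exact: (law_ge0 wf C0 solP).
Qed.

End Fits.

Section Costs.
Variables (R : realType) (n k d : nat) (I : mcnc R n k) (C Ci a alpha K : R).
Variables (Opt : {set 'I_n}) (m : nat) (T : 'I_m -> cluster n).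
Variable sol : {set 'I_k} -> option (lp_sol R n).
Hypothesis wf : mcnc_wf I.
Hypothesis feas : feasible I Opt.
Hypothesis solP : lp_solver I Ci sol.
Hypothesis C0 : 0 <= C.
Hypothesis Ci_big : 3 * C + (d + 4)%:R <= Ci.
Hypothesis alpha1 : (1 < n)%N -> 1 <= alpha.
Hypothesis K_big : a + Ci + 2 <= K.
Hypothesis T_cost : \sum_j costs (cost I) (cl_verts (T j))
        <= a * alpha * ln n%:R * costs (cost I) Opt.

Let good (w : outcome n k) := fits_in I Ci Opt w.1.
Let cOpt := costs (cost I) Opt.
Let bound := K * alpha * ln n%:R * cOpt.
Let Ci0 : 0 <= Ci.
Proof. by apply: le_trans Ci_big; rewrite addr_ge0 ?mulr_ge0. Qed.
Let cOpt0 : 0 <= cOpt. Proof. by apply: sumr_ge0 => v _; case: wf. Qed.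

Let Tcost := \sum_j costs (cost I) (cl_verts (T j)).

(** The spare [cOpt] is the share of the bad event. The 2 in [K_big] absorbs it, because
    [ln n >= 1 / 2] and [alpha >= 1]. *)
Lemma base_cost_gt1 : (1 < n)%N -> Tcost + Ci * ln n%:R * cOpt + cOpt <= bound.
Proof.
move=> n1; have hl := @ln_nat_ge_half R n n1; have ha := alpha1 n1.
set l := ln n%:R in hl *.
have hlc : 0 <= l * cOpt by rewrite mulr_ge0 // /l ln_nat_ge0.
have hal : l * cOpt <= alpha * (l * cOpt) by rewrite ler_peMl.
have h1 : Ci * l * cOpt <= Ci * (alpha * (l * cOpt)) by rewrite -mulrA ler_wpM2l.
have h2 : cOpt <= 2 * (alpha * (l * cOpt)).
  have : cOpt <= 2 * (l * cOpt) by rewrite mulrA ler_peMl //; lra.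
  by move/le_trans; apply; rewrite ler_pM2l.
have h3 : (a + Ci + 2) * (alpha * (l * cOpt)) <= bound.
  rewrite /bound -[leRHS]mulrA -[leRHS]mulrA ler_wpM2r //.
  by apply: mulr_ge0 => //; apply: le_trans ha.
have h4 : Tcost <= a * (alpha * (l * cOpt)) by move: T_cost; rewrite !mulrA.
lra.
Qed.

Lemma base_cost : Tcost + Ci * ln n%:R * cOpt <= bound.
Proof.
have [/base_cost_gt1|n1] := ltnP 1 n.
  by apply: le_trans; rewrite lerDl.
have l0 : ln n%:R = 0 :> R by apply/eqP; rewrite eq_le ln_nat_ge0 ln_le0 // lern1.
by move: T_cost; rewrite /bound l0 !(mulr0, mul0r) addr0.
Qed.

Lemma Tcost_ge0 : 0 <= Tcost.
Proof. by apply: sumr_ge0 => j _; apply: sumr_ge0 => v _; case: wf. Qed.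

Lemma expect_good : Expect I C sol (fun w => costs (cost I) (Fverts T w) * `[< good w >]%:R)
  <= bound * Prob I C sol good.
Proof.
apply: le_trans (expect_fits wf C0 solP Opt T) _.
by apply: ler_wpM2r; [exact: (prob_good_ge0 Opt wf solP C0)|exact: base_cost].
Qed.

Lemma expect_cost : (forall v, cost I v <= n%:R ^+ d * cOpt) ->
  Expect I C sol (fun w => costs (cost I) (Fverts T w)) <= bound.
Proof.
move=> hc; have c0 : 0 <= n%:R ^+ d * cOpt by rewrite mulr_ge0 ?exprn_ge0.
apply: le_trans (expect_all wf C0 solP Opt T c0 hc) _.
have bnd0 : 0 <= Tcost + Ci * ln n%:R * cOpt.
  by rewrite addr_ge0 ?Tcost_ge0 // !mulr_ge0 // ln_nat_ge0.
have bad : \sum_(M : {set 'I_k} | ~~ `[< fits_in I Ci Opt M >]) bern (hal_prob I C) M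
    = 1 - Prob I C sol good.
  by rewrite (prob_compl C wf solP) (sum_law_fst C wf solP (fun M => ~~ `[< fits_in I Ci Opt M >])) opprB addrCA subrr addr0.
have [n1|/(small_n wf) k0] := ltnP 1 n; last first.
  have e : Prob I C sol good = 1.
    by rewrite (prob_all C wf solP) // => w; exact: (no_pairs_fits wf feas C0 Ci_big).
  by rewrite bad -/good e subrr mulr0 addr0 mulr1; exact: base_cost.
apply: le_trans (base_cost_gt1 n1); apply: lerD.
  rewrite -[leRHS]mulr1; apply: ler_wpM2l => //.
  exact: (prob_good_le1 Opt wf solP C0).
have npos : 0 < n%:R :> R by rewrite ltr0n ltnW.
rewrite bad; apply: (@le_trans _ _ (n%:R * (n%:R ^+ d * cOpt) * (n%:R ^+ d.+1)^-1)).
  by apply: ler_wpM2l; [rewrite mulr_ge0|have := good_whp wf feas solP C0 Ci_big; rewrite -/good; lra].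
by rewrite mulrA -exprS mulrAC divff ?mul1r // gt_eqF // exprn_gt0.
Qed.

End Costs.

Lemma prob_mono (R : realType) n k (I : mcnc R n k) C sol (E E' : outcome n k -> Prop) :
  (forall w, 0 <= law I C sol w) -> (forall w, E w -> E' w) ->
  Prob I C sol E <= Prob I C sol E'.
Proof.
move=> l0 h; rewrite /Prob [leLHS]big_mkcond [leRHS]big_mkcond; apply: ler_sum => w _.
case: asboolP => [/h/asboolP ->//|_]; by case: ifP.
Qed.

Lemma runtime_le (n k m Y : nat) : (2 * k <= n)%N -> (m <= Y * n ^ 2)%N ->
  (200 * (2 * n + k + m + 2) ^ 4 <= 200 * (Y + 5) ^ 4 * n.+1 ^ (200 * (Y + 5) ^ 4))%N.
Proof.
move=> hk hm.
have h : (2 * n + k + m + 2 <= (Y + 5) * n.+1 ^ 2)%N.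
  rewrite expnS expn1; move: hm; rewrite expnS expn1 => hm; nia.
rewrite -mulnA leq_pmul2l //; apply: (@leq_trans (((Y + 5) * n.+1 ^ 2) ^ 4)).
  by rewrite leq_exp2r.
rewrite expnMn -expnM leq_pmul2l ?expn_gt0 ?addn_gt0 ?orbT //; apply: leq_pexp2l => //.
by apply: (@leq_trans 200) => //; rewrite leq_pmulr // expn_gt0 addn_gt0 orbT.
Qed.

Lemma sum_clusters_le (R : realType) (n m : nat) (b : R) : 0 < b ->
  m%:R <= b * n%:R * ln n%:R -> (m <= Num.bound b * n ^ 2)%N.
Proof.
move=> b0 hm; rewrite -(ler_nat R) natrM natrX; apply: le_trans hm _.
rewrite -mulrA; apply: ler_pM; rewrite ?mulr_ge0 ?ln_nat_ge0 ?(ltW b0) //.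
  by apply/ltW/archi_boundP/ltW.
by rewrite expr2; apply: ler_wpM2l => //; exact: ln_nat_le.
Qed.

(** The program is fixed before the instance and sees neither the sample nor the solution of the
    linear program. The cost is bounded in two forms, on the event of fitting and unconditionally
    under a bound on vertex costs, because outside the event the optimum of the linear program is
    not bounded by the cost of [Opt]. *)
Theorem theorem8 (R : realType) (d : nat) :
  exists2 C0 : R, 0 < C0 & forall C : R, C0 <= C ->
  exists2 Ci0 : R, 0 < Ci0 & forall Ci : R, Ci0 <= Ci ->
  forall Cii a b : R, 0 < Cii -> 0 < a -> 0 < b ->
  exists (K delta : R) (find : cmd) (e : nat), [/\ 0 < K, 0 < delta &
  forall (alpha beta : nat -> R) (A : ssnc_algorithm R),
    ssnc_approx A alpha beta -> (forall n, 1 <= beta n) ->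
  forall (n k : nat) (I : mcnc R n k) (Opt : {set 'I_n})
         (m : nat) (T : 'I_m -> cluster n)
         (sol : {set 'I_k} -> option (lp_sol R n)),
    mcnc_wf I -> is_opt I Opt ->
    good_clustering I (alpha n) (beta n) Cii a b Opt T ->
    lp_solver I Ci sol ->
    let X := fun w => costs (cost I) (Fverts T w) in
    let good := fun w : outcome n k => fits_in I Ci Opt w.1 in
    let bound := K * alpha n * ln n%:R * costs (cost I) Opt in
    [/\ 1 - (n%:R ^+ d)^-1 <= Prob I C sol good,
        Expect I C sol (fun w => X w * `[< good w >]%:R)
          <= bound * Prob I C sol good,
        (forall v, cost I v <= n%:R ^+ d * costs (cost I) Opt) ->
          Expect I C sol X <= bound
      & exists (t : nat) (st : state R),
        [/\ exec find (input I T) t st,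
            (t <= e * n.+1 ^ e)%N,
            delta * k%:R <= #|output k st|%:R
          & 1 - (n%:R ^+ d)^-1
              <= Prob I C sol (fun w =>
                   routable (Fedge T w) (src I) (tgt I) (output k st) setT
                     (K * beta n ^+ 2 * ln n%:R ^+ 3 * cap I))]]].
Proof.
have C0pos : 0 < 32 * 256 * (d + 5)%:R :> R by rewrite !mulr_gt0 // ltr0n addn_gt0 orbT.
exists (32 * 256 * (d + 5)%:R) => // C hC.
have C0 : 0 < C := lt_le_trans C0pos hC.
have Ci0pos : 0 < 3 * C + (d + 4)%:R by rewrite ltr_wpDr // mulr_gt0.
exists (3 * C + (d + 4)%:R) => // Ci hCi Cii a b hCii ha hb.
have Ci0 : 0 < Ci := lt_le_trans Ci0pos hCi.
pose Kr := route_const d C Ci Cii b.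
have Kr0 : 0 <= Kr.
  have h := route_const_ge hC hCi hCii hb; apply: le_trans h.
  by rewrite mulr_ge0 // /link_const addr_ge0 // mulr_ge0 // ltW.
pose e := (200 * (Num.bound b + 5) ^ 4)%N.
exists (a + Ci + 2 + Kr), (1 / 24), find_prog, e; split.
- by rewrite ltr_wpDr // addr_gt0 // addr_gt0.
- by rewrite divr_gt0.
move=> alpha beta A hA hbeta n k I Opt m T sol wf [feas _] [hT hTc hov hkc hinj] solP X good bound.
have alpha1 : (1 < n)%N -> 1 <= alpha n by exact: ssnc_ratio_ge1 hA.
have Kbig : a + Ci + 2 <= a + Ci + 2 + Kr by rewrite lerDl.
have [[sym_e irr_e] [sinj tinj st] cost0 cap0] := wf.
have wfT j : cluster_wf I (T j) by have [] := hT j.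
have kT j : internal I (Cii * beta n ^+ 2 * ln n%:R * cap I) (T j) \/
   external I (Cii * beta n ^+ 2 * ln n%:R * cap I) (T j) by have [] := hT j.
split.
- apply: le_trans (good_whp wf feas solP (ltW C0) hCi).
  have [n1|n1] := ltnP 0 n; last first.
    have -> : n%:R = 0 :> R by apply/eqP; rewrite pnatr_eq0 -leqn0.
    by rewrite [0 ^+ d.+1]exprS mul0r invr0 lerB // invr_ge0 exprn_ge0.
  rewrite lerB // lef_pV2 ?posrE ?exprn_gt0 ?ltr0n //.
  by apply: ler_weXn2l; rewrite ?ler1n.
- exact: (expect_good wf solP (ltW C0) hCi alpha1 Kbig hTc).
- exact: (expect_cost wf feas solP (ltW C0) hCi alpha1 Kbig hTc).
have [t [st' [hexec ht [lam [x [y [[lam0 lam1 lam2] hx hy [hS1 hS2 hS3 hS4]]]]]]]] := find_ok (ltW cap0) hinj.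
exists t, st'; split=> //.
- apply: leq_trans ht _; apply: runtime_le; first exact: pairs_le wf.
  by apply: (sum_clusters_le hb); exact: clusters_le wfT _ hb hov.
- exact: (many_pairs cap0 sinj tinj st wfT kT hinj lam1 hS2 hS3 hkc).
have Kbnd : Kr * beta n ^+ 2 * ln n%:R ^+ 3 * cap I
    <= (a + Ci + 2 + Kr) * beta n ^+ 2 * ln n%:R ^+ 3 * cap I.
  apply: ler_wpM2r; first exact: ltW.
  apply: ler_wpM2r; first by rewrite exprn_ge0 ?ln_nat_ge0.
  apply: ler_wpM2r; first by rewrite exprn_ge0 // (le_trans ler01).
  by rewrite lerDr addr_ge0 // addr_ge0 // ltW.
have [k0|k0] := posnP k.
  rewrite (prob_all C wf solP) ?gerBl ?invr_ge0 ?exprn_ge0 // => w.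
  apply: routable_mono Kbnd _; exists (fun _ _ => 0); split=> // [i|v _].
    by exfalso; case: i => i; rewrite k0.
  rewrite big1 => [|i _]; last by rewrite big1.
  by rewrite mulr_ge0 ?(ltW cap0) // mulr_ge0 ?exprn_ge0 ?ln_nat_ge0 // mulr_ge0 // exprn_ge0 // (le_trans ler01).
have n1 : (1 < n)%N by apply: leq_trans (pairs_le wf); rewrite leq_pmulr.
have inS i : i \in output k st' -> (exists j, src I i \in cl_terms (T j)) /\ (exists j, tgt I i \in cl_terms (T j)).
  move=> /(subsetP hS1); rewrite !inE => /orP[/existsP[j /andP[h1 h2]]|/existsP[j /existsP[j' /and5P[h1 h2 _ _ _]]]].
    by split; exists j.
  by split; [exists j|exists j'].
have Sx i : i \in output k st' -> exists2 j : 'I_m, src I i \in cl_terms (T j) & x i = j :> nat.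
  by move=> /inS[[j hj] _]; exists j => //; exact: hx.
have Sy i : i \in output k st' -> exists2 j : 'I_m, tgt I i \in cl_terms (T j) & y i = j :> nat.
  by move=> /inS[_ [j hj]]; exists j => //; exact: hy.
apply: le_trans (route_whp n1 k0 wf feas solP hC hCi hCii hb (hbeta n) hT hov lam1 lam2 Sx Sy hS4) _.
apply: prob_mono => [w|w]; first exact: (law_ge0 wf (ltW C0) solP).
exact: routable_mono.
Qed.
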